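(* For any $a, b \in \{1, 2, \dots, 9\}$, the logarithmic density of the set $$A_{a,b} = \{n \in \mathbb{N}: n! \text{ starts with } a \text{ and } p_n\# \text{ starts with } b \}$$ is given by the product of the corresponding Benford probabilities: $$\lim_{N \to \infty} \frac{1}{\log N} \sum_{n=1}^N \frac{1}{n} 1_{A_{a,b}}(n) = \log_{10}(1+ 1/a) \cdot \log_{10}(1+ 1/b).$$
   Context: $p_n$ is the $n$-th prime and $p_n\# = p_1p_2\cdots p_n$ is the product of the first $n$ primes. ''Starts with $a$'' means that the first (leading) decimal digit is $a$. *)

(* Defs.v *)
From mathcomp Require Import all_boot all_order all_algebra.
From mathcomp Require Import all_classical all_reals all_analysis.

Set Implicit Arguments.
Unset Strict Implicit.
Unset Printing Implicit Defensive.

Import Order.TTheory GRing.Theory Num.Theory.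
Import numFieldNormedType.Exports.

Local Open Scope nat_scope.

(* For m > 0, 10 ^ trunc_log 10 m is the largest power of 10 below or equal
   to m, so the quotient is the first decimal digit of m (and it is 0 for
   m = 0). *)
Definition leading_digit (m : nat) : nat := m %/ 10 ^ trunc_log 10 m.

Lemma ex_prime_above (m : nat) : exists p, (m < p) && prime p.
Proof. by have [p ltmp pr_p] := prime_above m; exists p; rewrite ltmp. Qed.

Definition next_prime (m : nat) : nat := ex_minn (ex_prime_above m).

(* Indexed from 1: nth_prime 1 = 2, nth_prime 2 = 3, nth_prime 3 = 5;
   the value nth_prime 0 = 1 is junk. *)
Definition nth_prime (n : nat) : nat := iter n next_prime 1.

Definition primorial (n : nat) : nat := \prod_(1 <= i < n.+1) nth_prime i.

Local Open Scope classical_set_scope.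

Definition benford_set (a b : nat) : set nat :=
  [set n | [/\ 0 < n, leading_digit n`! = a & leading_digit (primorial n) = b]].

Local Open Scope ring_scope.

Definition log10 (R : realType) (x : R) : R := ln x / ln 10.

(* At N = 0, 1 the factor (ln N%:R)^-1 is the junk value 0. *)
Definition has_log_density (R : realType) (A : set nat) (d : R) : Prop :=
  (fun N : nat =>
     (ln (N%:R : R))^-1 * \sum_(1 <= n < N.+1) (n%:R)^-1 * \1_A n)
    @ \oo --> d.

(* Main.v *)
(* By Weyl's criterion it suffices to show that cos (f n) has logarithmic mean 0,
   where f n = A ln n! + B ln p_n# + c and (A, B) <> (0, 0). The increments
   g n = A ln (n + 1) + B ln p_(n+1) vary slowly, so f is almost linear on blocks
   of K consecutive integers, and averaging over blocks (van der Corput) reduces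
   the claim to the logarithmic means of cos (d g n), d >= 1. The prime number
   theorem gives g n = (A + B) ln n + B ln ln n + o(1). If A + B <> 0 these means
   vanish; if A + B = 0 they are means of cos (d B ln ln n), which need not tend to
   0 but are O(1 / d), and that suffices because the Fejer kernel only involves
   the average of 1 / d over d < K.

   The prime number theorem is proved by the elementary method: Selberg's
   symmetry formula, obtained from the Tatuzawa--Iseki identity, and the fact that
   psi (x) - x changes slowly and has bounded logarithmic sums. *)

Require Import Defs.
From mathcomp Require Import all_boot all_order all_algebra.
From mathcomp Require Import all_classical all_reals all_analysis.
From mathcomp Require Import zify ring lra.

Set Implicit Arguments.
Unset Strict Implicit.
Unset Printing Implicit Defensive.

Import Order.TTheory GRing.Theory Num.Theory.
Import numFieldNormedType.Exports.

Local Open Scope ring_scope.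

(** * Divisor sums, the Moebius and von Mangoldt functions *)

(* [lra] fails to identify inverses of [n.+1%:R] built along different instance
   paths; generalizing them first makes them a single atom. *)
Ltac ilra := repeat match goal with H : is_true _ |- _ => revert H end;
  repeat match goal with |- context [GRing.inv ?x] =>
    match x with context [S ?k] =>
     first [is_var k | match k with S ?l => is_var l end];
     move: (GRing.inv x) end end; intros; lra.

(** The hard frequencies are those with A + B = 0, that is, the ratio n! / p_n#. The increments of f
    are then B ln ln n + o(1). The ordinary mean up to N of cos (d B ln ln n) stays close to cos (d
    B ln ln N), because ln ln n is almost constant on [c N, N], so it shows no decay in d; the
    logarithmic weight spreads n evenly in ln n and produces the decay 1 / d. The prime number
    theorem is needed because Chebyshev's bounds locate ln p_n only up to O(1), whereas both the
    almost linearity of f on blocks and the comparison of g with its model require o(1). The passage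
    from cosines to digits uses the K translates of the Fejer kernel by multiples of 2 pi / K, whose
    sum is constant: the translates centred well inside the arc of a digit add up to a function that
    is at most 1 on the arc and small off it. *)

Lemma sum_multiples (V : nmodType) (G : nat -> V) (d N : nat) : (0 < d)%N ->
  \sum_(1 <= n < N.+1 | (d %| n)%N) G n = \sum_(1 <= m < (N %/ d)%N.+1) G (d * m)%N.
Proof.
move=> d0; elim: N => [|N IH]; first by rewrite div0n !big_geq.
rewrite big_mkcond big_nat_recr//= -big_mkcond IH divnS//.
case: ifPn => [dN|_]; last by rewrite add0n addr0.
rewrite add1n [RHS]big_nat_recr//=; congr (_ + G _).
have := divnK dN; rewrite divnS// dN mulnC; lia.
Qed.

Lemma sum_divisorsE (V : nmodType) (F : nat -> V) (n N : nat) : (0 < n <= N)%N ->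
  \sum_(d <- divisors n) F d = \sum_(1 <= d < N.+1 | (d %| n)%N) F d.
Proof.
move=> /andP[n0 nN]; rewrite -[RHS]big_filter; apply: perm_big.
apply: uniq_perm; rewrite ?divisors_uniq ?filter_uniq ?iota_uniq//.
move=> d; rewrite -dvdn_divisors// mem_filter mem_index_iota.
case dn: (d %| n)%N => //=; have := dvdn_leq n0 dn.
have := dvdn_gt0 n0 dn; lia.
Qed.

Lemma sum_divisors_swap (V : nmodType) (F : nat -> nat -> V) (N : nat) :
  \sum_(1 <= n < N.+1) \sum_(d <- divisors n) F d n =
  \sum_(1 <= d < N.+1) \sum_(1 <= m < (N %/ d)%N.+1) F d (d * m)%N.
Proof.
transitivity (\sum_(1 <= n < N.+1) \sum_(1 <= d < N.+1 | (d %| n)%N) F d n).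
  apply: eq_big_nat => n nN; apply: sum_divisorsE; lia.
rewrite (exchange_big_dep_nat xpredT)//=.
by apply: eq_big_nat => d /andP[d1 _]; rewrite sum_multiples.
Qed.

(* Both sides run over the pairs (d, e) with [d * e %| n]. *)
Lemma sum_divisors_conv (V : nmodType) (F : nat -> nat -> V) (n : nat) :
  (0 < n)%N ->
  \sum_(d <- divisors n) \sum_(e <- divisors (n %/ d)%N) F d e =
  \sum_(e <- divisors n) \sum_(d <- divisors (n %/ e)%N) F d e.
Proof.
move=> n0.
have E (G : nat -> nat -> V) :
    \sum_(d <- divisors n) \sum_(e <- divisors (n %/ d)%N) G d e =
    \sum_(1 <= d < n.+1) \sum_(1 <= e < n.+1 | (d * e %| n)%N) G d e.
  rewrite (@sum_divisorsE _ _ n n) ?n0 ?leqnn// big_mkcond /=.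
  apply: eq_big_nat => d /andP[d0 _].
  case: ifPn => dn.
    rewrite (@sum_divisorsE _ _ _ n) ?leq_div ?divn_gt0 ?(dvdn_leq n0 dn)//.
    apply: eq_bigl => e; rewrite -{2}(divnK dn) [(_ * d)%N]mulnC dvdn_pmul2l//.
  rewrite big1// => e den; move: dn; rewrite (dvdn_trans _ den)//.
  exact: dvdn_mulr.
rewrite E [RHS](E (fun e d => F d e)) (exchange_big_dep_nat xpredT)//=.
by apply: eq_bigr => e _; apply: eq_bigl => d; rewrite mulnC.
Qed.

Section Arithmetic.
Variable R : realType.

(** Squarefreeness is tested by the valuations at the prime divisors. As [primes 0] is empty, the
    value at 0 is the junk 1; all sums start at 1. *)
Definition mobius (n : nat) : R :=
  if all (fun p => logn p n == 1%N) (primes n) then (-1) ^+ size (primes n)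
  else 0.

Lemma mobius1 : mobius 1 = 1.
Proof. by rewrite /mobius. Qed.

Lemma norm_mobius n : `|mobius n| <= 1.
Proof. by rewrite /mobius; case: ifP; rewrite ?normr0// normrX normrN1 expr1n. Qed.

Lemma mobius_primeM p d : prime p -> (0 < d)%N -> ~~ (p %| d)%N ->
  mobius (p * d) = - mobius d.
Proof.
move=> pp d0 pd.
have pm : perm_eq (primes (p * d)) (p :: primes d).
  apply: uniq_perm; rewrite ?primes_uniq//=.
    by rewrite primes_uniq mem_primes pp d0 /= andbT.
  move=> q; rewrite inE (primesM _ (prime_gt0 pp) d0) (primes_prime pp).
  by rewrite inE.
have lp : (logn p (p * d) == 1)%N.
  by rewrite lognM// ?prime_gt0// logn_prime// eqxx lognE pp d0 (negbTE pd).
rewrite /mobius (perm_size pm) (perm_all _ pm) /= lp /=.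
rewrite (_ : all _ (primes d) = all (fun q => logn q d == 1%N) (primes d)).
  by case: ifP => _; rewrite ?oppr0// exprS mulN1r.
apply: eq_in_all => q; rewrite mem_primes => /and3P[qp _ qd].
rewrite lognM ?(prime_gt0 pp)// logn_prime//.
by case: (eqVneq q p) => [qpe|_]; [move: pd; rewrite -qpe qd|rewrite add0n].
Qed.

Lemma mobius_sq p d : (0 < d)%N -> prime p -> (p ^ 2 %| d)%N -> mobius d = 0.
Proof.
move=> d0 pp pd; rewrite /mobius; case: ifPn => // /allP/(_ p).
have p2 : (1 < logn p d)%N by rewrite -pfactor_dvdn.
rewrite mem_primes pp d0 (dvdn_trans _ pd) ?dvdn_mulr// => /(_ isT)/eqP p1.
by rewrite p1 in p2.
Qed.

(** For n > 1 let p be the least prime factor of n: each divisor m prime to p cancels against p * m,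
    and the multiples of p ^ 2 contribute nothing. *)
Lemma sum_mobius n : (0 < n)%N ->
  \sum_(d <- divisors n) mobius d = (n == 1%N)%:R.
Proof.
case: (ltnP 1 n) => [n1 n0|]; last first.
  by case: n => [|[|]]// _ _; rewrite big_seq1 mobius1.
rewrite gtn_eqF// (@sum_divisorsE _ _ n n) ?n0 ?leqnn//.
have pp := pdiv_prime n1; have pn := pdiv_dvd n; move: (pdiv n) pp pn => p pp pn.
have p0 := prime_gt0 pp.
have pmE m : (0 < m)%N -> (if (p * m %| n)%N then mobius (p * m) else 0) =
    if (m %| n)%N && ~~ (p %| m)%N then - mobius m else 0.
  move=> m0; case: (boolP (p %| m)%N) => pm /=.
    rewrite andbF; case: ifP => // _; apply: (mobius_sq _ pp).
      by rewrite muln_gt0 p0.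
    by rewrite expnS expn1 dvdn_pmul2l.
  rewrite andbT Gauss_dvd ?prime_coprime// pn /=; case: ifP => // _.
  exact: mobius_primeM.
(* The two halves of the sum run up to n / p and up to n; beyond n / p there is no divisor prime to
   p. *)
have mnp m : (m %| n)%N -> ~~ (p %| m)%N -> (m <= n %/ p)%N.
  move=> mn pm; rewrite leq_divRL// mulnC; apply: dvdn_leq => //.
  by rewrite Gauss_dvd ?prime_coprime// pn.
rewrite (bigID (fun d => (p %| d)%N))/=.
rewrite (eq_bigl (fun d => (p %| d)%N && (d %| n)%N)); last first.
  by move=> d; rewrite andbC.
rewrite big_mkcondr sum_multiples//.
rewrite (@eq_big_nat _ _ _ _ _ _ (fun m => if (m %| n)%N && ~~ (p %| m)%N
  then - mobius m else 0)); last by move=> m /andP[m0 _]; exact: pmE.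
rewrite -big_mkcond /= sumrN [X in _ + X](big_cat_nat (n := (n %/ p)%N.+1))//=.
  rewrite addKr big_nat_cond big1// => m /andP[/andP[m1 _] /andP[mn pm]].
  by have := mnp _ mn pm; rewrite leqNgt m1.
by rewrite ltnS leq_div.
Qed.

(** A number n > 1 is a prime power exactly when it equals the full power of its least prime factor
    dividing it. *)
Definition mangoldt (n : nat) : R :=
  if (1 < n)%N && (n == pdiv n ^ logn (pdiv n) n)%N then ln (pdiv n)%:R else 0.

Lemma mangoldt_ge0 n : 0 <= mangoldt n.
Proof.
by rewrite /mangoldt; case: ifP => // _; rewrite ln_ge0// ler1n pdiv_gt0.
Qed.

Lemma mangoldtX p k : prime p -> (0 < k)%N -> mangoldt (p ^ k) = ln p%:R.
Proof.
move=> pp; case: k => // k _; rewrite /mangoldt pdiv_pfactor// pfactorK// eqxx.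
rewrite andbT (_ : (1 < _)%N = true)//; apply/idP.
by rewrite -{1}(expn0 p) ltn_exp2l// prime_gt1.
Qed.

Lemma mangoldt_prime p : prime p -> mangoldt p = ln p%:R.
Proof. by move=> pp; rewrite -{1}(expn1 p) mangoldtX. Qed.

Lemma mangoldt_neq0 n : mangoldt n != 0 ->
  exists p k, [/\ prime p, (0 < k)%N & n = (p ^ k)%N].
Proof.
rewrite /mangoldt; case: ifP; last by rewrite eqxx.
move=> /andP[n1 /eqP nE] _; exists (pdiv n), (logn (pdiv n) n).
split => //; first exact: pdiv_prime.
by rewrite logn_gt0 mem_primes pdiv_prime// (ltnW n1) pdiv_dvd.
Qed.

(** Induction on n = p m. The divisors of n that do not divide m carry the full power of p, and the
    only prime power among them is that power itself, of weight ln p. *)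
Lemma sum_mangoldt n : (0 < n)%N ->
  \sum_(d <- divisors n) mangoldt d = ln n%:R.
Proof.
elim/ltn_ind: n => n IH n0; case: (ltnP 1 n) => n1; last first.
  have -> : n = 1%N by lia.
  by rewrite big_seq1 ln1 /mangoldt.
have pp := pdiv_prime n1; have pn := pdiv_dvd n.
move: (pdiv n) pp pn => p pp pn; have p0 := prime_gt0 pp.
have /dvdnP[m nE] := pn.
have m0 : (0 < m)%N by move: n0; rewrite nE muln_gt0 => /andP[].
have mn : (m < n)%N by rewrite nE -{1}(muln1 m) ltn_pmul2l// prime_gt1.
have lE : logn p n = (logn p m).+1 by rewrite nE lognM// (logn_prime _ pp) eqxx addn1.
rewrite (@sum_divisorsE _ _ n n) ?n0 ?leqnn// (bigID (fun d => (d %| m)%N))/=.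
have -> : \sum_(1 <= d < n.+1 | (d %| n)%N && (d %| m)%N) mangoldt d = ln m%:R.
  rewrite -IH// (@sum_divisorsE _ _ m n) ?m0 1?ltnW//; apply: eq_bigl => d.
  by case dm: (d %| m)%N; rewrite ?andbF// nE dvdn_mulr.
rewrite (_ : \sum_(1 <= d < n.+1 | _) _ = ln p%:R).
  by rewrite nE natrM lnM ?posrE ?ltr0n.
have pl : (p ^ logn p n <= n)%N by apply: dvdn_leq => //; exact: pfactor_dvdnn.
rewrite (@big_rem _ _ _ _ _ (p ^ logn p n)%N)/=; last first.
  by rewrite mem_index_iota ltnS pl expn_gt0 p0.
rewrite pfactor_dvdnn pfactor_dvdn// lE ltnn/= mangoldtX// big_seq_cond.
rewrite big1 ?addr0// => d /and3P[]; rewrite (rem_filter _ (iota_uniq _ _)).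
rewrite mem_filter /= => /andP[dE _] dn dm.
apply/eqP/negPn/negP => /mangoldt_neq0[q [k [qp k0 dq]]].
have [qpE|qpN] := eqVneq q p.
  move: dn dm; rewrite dq qpE !pfactor_dvdn// lE -ltnNge => k1 k2.
  by move/eqP: dE; apply; rewrite dq qpE; congr (_ ^ _)%N; lia.
move: dm; rewrite dq; move: dn; rewrite dq nE Gauss_dvdl; first by move->.
by rewrite coprimeXl// prime_coprime// dvdn_prime2// (negbTE qpN).
Qed.

(** Moebius inversion: ln (n / d) is expanded by [sum_mangoldt], and after the exchange of sums
    [sum_mobius] keeps only e = n. *)
Lemma sum_mobius_ln n : (0 < n)%N ->
  \sum_(d <- divisors n) mobius d * ln (n %/ d)%:R = mangoldt n.
Proof.
move=> n0.
transitivity (\sum_(d <- divisors n) \sum_(e <- divisors (n %/ d)%N)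
    mobius d * mangoldt e).
  apply: eq_big_seq => d; rewrite -dvdn_divisors// => dn.
  rewrite -mulr_sumr sum_mangoldt// divn_gt0 ?(dvdn_gt0 n0)//.
  exact: dvdn_leq.
rewrite sum_divisors_conv//.
rewrite (@sum_divisorsE _ _ n n) ?n0 ?leqnn// big_mkcond big_nat_recr//=.
rewrite dvdnn divnn n0 big_seq1 mobius1 mul1r big_nat big1 ?add0r//.
move=> d /andP[d0 dn]; case: ifP => // dvn.
rewrite -mulr_suml sum_mobius ?divn_gt0// 1?ltnW//.
rewrite gtn_eqF ?mul0r//; have := divnK dvn; case: (n %/ d)%N => [|[|]]//; lia.
Qed.

(* The Tatuzawa--Iseki identity, with the function [F (N / k)] of the usual
   statement abstracted to an arbitrary sequence [f k]. *)
Lemma sum_mobius_ln_sum (f : nat -> R) (N : nat) : (0 < N)%N ->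
  \sum_(1 <= n < N.+1) mobius n * ln (N%:R / n%:R) *
     \sum_(1 <= m < (N %/ n)%N.+1) f (n * m)%N =
  f 1%N * ln N%:R + \sum_(1 <= k < N.+1) f k * mangoldt k.
Proof.
move=> N0; under eq_bigr do rewrite mulr_sumr.
rewrite -(sum_divisors_swap (fun n k => mobius n * ln (N%:R / n%:R) * f k)).
(* Since ln (N / d) = ln (N / k) + ln (k / d), the sum over d splits into the indicator of k = 1 and
   [mangoldt k]. *)
transitivity (\sum_(1 <= k < N.+1)
    ((k == 1%N)%:R * ln (N%:R / k%:R) * f k + f k * mangoldt k)).
  apply: eq_big_nat => k /andP[k0 _].
  rewrite -mulr_suml [f k * _]mulrC -mulrDl; congr (_ * _).
  rewrite -sum_mobius_ln// -sum_mobius// mulr_suml -big_split/=.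
  apply: eq_big_seq => d; rewrite -dvdn_divisors// => dk.
  have d0 := dvdn_gt0 k0 dk; rewrite -mulrDr -lnM ?posrE ?divr_gt0 ?ltr0n//.
    congr (_ * ln _).
    have q0 : (k %/ d)%:R != 0 :> R by rewrite pnatr_eq0 -lt0n divn_gt0// dvdn_leq.
    have d1 : d%:R != 0 :> R by rewrite pnatr_eq0 -lt0n.
    have -> : k%:R = (k %/ d)%:R * d%:R :> R by rewrite -natrM divnK.
    by move: (k %/ d)%:R q0 => q q0; field; rewrite q0 d1.
  by rewrite divn_gt0// dvdn_leq.
rewrite big_split/= big_nat_recl//= mul1r divr1 mulrC big_nat big1 ?addr0//.
by case=> [|i]; rewrite ?ltn0// !mul0r.
Qed.

End Arithmetic.

Lemma sum_hyperbola_swap (V : nmodType) (F : nat -> nat -> V) (N : nat) :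
  \sum_(1 <= d < N.+1) \sum_(1 <= m < (N %/ d)%N.+1) F d m =
  \sum_(1 <= m < N.+1) \sum_(1 <= d < (N %/ m)%N.+1) F d m.
Proof.
have E (G : nat -> nat -> V) :
    \sum_(1 <= d < N.+1) \sum_(1 <= m < (N %/ d)%N.+1) G d m =
    \sum_(1 <= d < N.+1) \sum_(1 <= m < N.+1 | (m * d <= N)%N) G d m.
  apply: eq_big_nat => d /andP[d0 _].
  rewrite (big_nat_widen _ _ N.+1) ?ltnS ?leq_div//.
  by apply: eq_bigl => m; rewrite ltnS leq_divRL.
rewrite E (E (fun m d => F d m)) (exchange_big_dep_nat xpredT)//=.
by apply: eq_bigr => m _; apply: eq_bigl => d; rewrite mulnC.
Qed.

(** * Partial summation, ln N!, harmonic sums and Chebyshev's psi *)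

Section FactorialAndChebyshevSums.
Variable R : realType.
Implicit Types (a b f : nat -> R) (x y : R) (n m k N M : nat).

Lemma lnB_le x y : 0 < x -> 0 < y -> ln y - ln x <= (y - x) / x.
Proof.
move=> x0 y0; rewrite -ln_div ?posrE//.
have -> : y / x = 1 + (y - x) / x by field; rewrite gt_eqF.
apply: le_ln1Dx; rewrite -subr_gt0 opprK.
have -> : (y - x) / x + 1 = y / x by field; rewrite gt_eqF.
exact: divr_gt0.
Qed.

Lemma lnB_ge x y : 0 < x -> 0 < y -> (y - x) / y <= ln y - ln x.
Proof. by move=> x0 y0; have := lnB_le y0 x0; rewrite -(opprB x y) mulNr; lra. Qed.

Lemma ler_lnn m n : (0 < m <= n)%N -> ln m%:R <= ln n%:R :> R.
Proof.
move=> /andP[m0 mn]; rewrite ler_ln ?posrE ?ltr0n ?ler_nat//.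
exact: leq_trans mn.
Qed.

Lemma lnn_ge0 n : 0 <= ln n%:R :> R.
Proof. by case: n => [|n]; [rewrite ln0|rewrite ln_ge0// ler1n]. Qed.

Lemma lnSB_le n : (0 < n)%N -> ln n.+1%:R - ln n%:R <= n%:R^-1 :> R.
Proof.
move=> n0; apply: le_trans (lnB_le _ _) _; rewrite ?ltr0n//.
by rewrite -natr1 addrAC subrr add0r mul1r.
Qed.

Lemma lnSB_ge n : (0 < n)%N -> n.+1%:R^-1 <= ln n.+1%:R - ln n%:R :> R.
Proof.
move=> n0; apply: le_trans (lnB_ge _ _); rewrite ?ltr0n//.
by rewrite -[n.+1%:R]natr1 addrAC subrr add0r mul1r.
Qed.

Lemma abel_summation a b N : (0 < N)%N ->
  \sum_(1 <= k < N.+1) a k * b k = (\sum_(1 <= k < N.+1) a k) * b N +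
  \sum_(1 <= k < N) (\sum_(1 <= j < k.+1) a j) * (b k - b k.+1).
Proof.
case: N => // N _; elim: N => [|N IH]; first by rewrite !big_nat1 big_geq ?addr0.
rewrite big_nat_recr//= IH [in RHS]big_nat_recr//= [X in _ = _ + X]big_nat_recr//=.
by set A := \sum_(1 <= k < N.+2) a k; ring.
Qed.

Lemma sum_ln N : \sum_(1 <= k < N.+1) ln k%:R = ln N`!%:R :> R.
Proof.
elim: N => [|N IH]; first by rewrite big_geq// fact0 ln1.
rewrite big_nat_recr//= IH factS natrM lnM ?posrE ?ltr0n ?fact_gt0//.
by rewrite addrC.
Qed.

Lemma ln_fact_ge N : N%:R * ln N%:R - N%:R <= ln N`!%:R :> R.
Proof.
elim: N => [|N IH]; first by rewrite fact0 ln1 mul0r subrr.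
rewrite factS natrM lnM ?posrE ?ltr0n ?fact_gt0//.
case: N IH => [|N] IH; first by rewrite fact0 !ln1; lra.
have := @lnSB_le N.+1 isT; rewrite -[N.+2%:R](natr1 N.+1).
have : 0 < N.+1%:R :> R by rewrite ltr0n.
move: (N.+1%:R) (ln (_ + 1)) (ln (N.+1`!)%:R) (ln _) IH => x u v w IH x0 H.
have : x * (u - w) <= 1 by rewrite -(mulfV (lt0r_neq0 x0)) ler_pM2l.
by nra.
Qed.

Lemma ln_fact_le N : (0 < N)%N ->
  ln N`!%:R <= N%:R * ln N%:R - N%:R + 1 + ln N%:R :> R.
Proof.
case: N => // N _; elim: N => [|N IH]; first by rewrite !ln1; lra.
rewrite factS natrM lnM ?posrE ?ltr0n ?fact_gt0//.
have := @lnSB_ge N.+1 isT.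
have : 0 < N.+2%:R :> R by rewrite ltr0n.
rewrite -[N.+2%:R](natr1 N.+1).
move: (ln (N.+1%:R + 1)) (ln (N.+1`!)%:R) (ln N.+1%:R) IH.
move: (N.+1%:R) => x u v w IH x0 H.
have : 1 <= (x + 1) * (u - w) by rewrite -{1}(mulfV (lt0r_neq0 x0)) ler_pM2l.
by nra.
Qed.

Lemma ln_fact_norm N : (0 < N)%N ->
  `|ln N`!%:R - N%:R * ln N%:R| <= N%:R + 1 + ln N%:R :> R.
Proof.
move=> N0; have := ln_fact_ge N; have := ln_fact_le N0; have := lnn_ge0 N.
have : 0 <= N%:R :> R by [].
by rewrite ler_norml => *; apply/andP; split; lra.
Qed.

Definition harmonic_sum N : R := \sum_(1 <= k < N.+1) k%:R^-1.

Lemma harmonic_sumS N : harmonic_sum N.+1 = harmonic_sum N + N.+1%:R^-1.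
Proof. by rewrite /harmonic_sum big_nat_recr. Qed.

Lemma harmonic_sum_ge N : ln N.+1%:R <= harmonic_sum N.
Proof.
elim: N => [|N IH]; first by rewrite ln1 /harmonic_sum big_geq.
by rewrite harmonic_sumS; have := @lnSB_le N.+1 isT; ilra.
Qed.

Lemma harmonic_sum_le N : harmonic_sum N <= 1 + ln N%:R.
Proof.
elim: N => [|N IH]; first by rewrite ln0// addr0 /harmonic_sum big_geq.
case: N IH => [|N] IH; first by rewrite ln1 /harmonic_sum big_nat1 invr1 addr0.
by rewrite harmonic_sumS; have := @lnSB_ge N.+1 isT; ilra.
Qed.

Lemma harmonic_sum_ge0 N : 0 <= harmonic_sum N.
Proof. by apply: sumr_ge0 => k _; rewrite invr_ge0. Qed.

Local Notation mangoldt := (mangoldt R).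

Definition psi N : R := \sum_(1 <= n < N.+1) mangoldt n.

Lemma psi0 : psi 0 = 0.
Proof. by rewrite /psi big_geq. Qed.

Lemma psiS N : psi N.+1 = psi N + mangoldt N.+1.
Proof. by rewrite /psi big_nat_recr. Qed.

Lemma ler_psi M N : (M <= N)%N -> psi M <= psi N.
Proof.
elim: N => [|N IH]; first by case: M.
rewrite leq_eqVlt => /predU1P[->//|/IH H].
by rewrite psiS; have := mangoldt_ge0 R N.+1; lra.
Qed.

Lemma psi_ge0 N : 0 <= psi N.
Proof. by rewrite -psi0 ler_psi. Qed.

Lemma sum_mangoldt_divn N :
  \sum_(1 <= d < N.+1) mangoldt d * (N %/ d)%:R = ln N`!%:R.
Proof.
rewrite -sum_ln.
transitivity (\sum_(1 <= n < N.+1) \sum_(d <- divisors n) mangoldt d).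
  rewrite (sum_divisors_swap (fun d _ => mangoldt d)).
  by apply: eq_bigr => d _; rewrite sumr_const_nat subn1 /= mulr_natr.
by apply: eq_big_nat => n /andP[n0 _]; rewrite sum_mangoldt.
Qed.

Lemma sum_psi_divn N : \sum_(1 <= k < N.+1) psi (N %/ k) = ln N`!%:R.
Proof.
rewrite -sum_mangoldt_divn /psi (sum_hyperbola_swap (fun _ m => mangoldt m)).
by apply: eq_bigr => d _; rewrite sumr_const_nat subn1 /= mulr_natr.
Qed.

End FactorialAndChebyshevSums.

(** * Chebyshev, Mertens and Selberg estimates *)

Section ChebyshevMertens.
Variable R : realType.
Implicit Types (x y : R) (n m k N M : nat).
Local Notation mangoldt := (mangoldt R).
Local Notation psi := (psi R).
Local Notation harmonic_sum := (harmonic_sum R).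

Lemma lnn_le n : ln n%:R <= n%:R :> R.
Proof. by case: n => [|n]; [rewrite ln0|apply/ltW/ln_sublinear; rewrite ltr0n]. Qed.

(** Chebyshev's argument: with M = N / 2, the coefficient floor (N / d) - 2 floor (M / d) of
    [mangoldt d] on the right is nonnegative, and at least 1 for M < d <= N. *)
Lemma psi_half N :
  psi N - psi (N %/ 2) <= ln N`!%:R - 2 * ln (N %/ 2)`!%:R.
Proof.
set M := (N %/ 2)%N; have MN : (M <= N)%N by rewrite leq_div.
have -> : ln M`!%:R = \sum_(1 <= d < N.+1) mangoldt d * (M %/ d)%:R.
  rewrite -(sum_mangoldt_divn R M) [RHS](big_cat_nat (n := M.+1))//=.
  rewrite [X in _ + X]big_nat [X in _ + X]big1 ?addr0// => d /andP[Md _].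
  by rewrite divn_small// mulr0.
have -> : psi M = \sum_(1 <= d < N.+1) mangoldt d * (d <= M)%:R.
  rewrite [RHS](big_cat_nat (n := M.+1))//= [X in _ = _ + X]big_nat [X in _ = _ + X]big1.
    by rewrite addr0 /psi !big_nat; apply: eq_bigr => d /andP[_];
      rewrite ltnS => ->; rewrite mulr1.
  by move=> d /andP[Md _]; rewrite leqNgt Md mulr0.
rewrite -sum_mangoldt_divn mulr_sumr -!sumrB; apply: ler_sum_nat => d /andP[d0].
rewrite ltnS => dN; rewrite mulrCA -[X in X - _ <= _]mulr1 -!mulrBr.
apply: ler_wpM2l; first exact: mangoldt_ge0.
have : (2 * (M %/ d) + 1 <= N %/ d + (d <= M))%N.
  have NM : (M * 2 <= N)%N by exact: leq_divM.
  case: (leqP d M) => dM; last first.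
    by rewrite (divn_small dM) muln0 !add0n addn0 divn_gt0.
  rewrite leq_add2r leq_divRL// mulnAC -mulnA; have := leq_divM M d.
  move: (M %/ d)%N => q; nia.
move=> H; have : (2 * (M %/ d) + 1)%:R <= (N %/ d + (d <= M))%:R :> R.
  by rewrite ler_nat.
by rewrite natrD natrM [X in _ <= X]natrD; lra.
Qed.

(** Induction by halving: N / 2 contributes about 5 N, and the rest of 10 N absorbs the linear and
    logarithmic terms in ln N! - 2 ln (N / 2)!. *)
Lemma psi_le N : psi N <= 10 * N%:R.
Proof.
elim/ltn_ind: N => -[|[|N]] IH; first by rewrite psi0 mulr0.
  by rewrite psiS psi0 /mangoldt/=; lra.
have := IH (N.+2 %/ 2)%N (ltn_Pdiv _ _); rewrite // => /(_ isT isT).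
have := psi_half N.+2; have M0 : (0 < N.+2 %/ 2)%N by rewrite divn_gt0.
have NM : (N.+2 %/ 2 * 2 <= N.+2)%N by exact: leq_divM.
have MN : (N.+2 <= N.+2 %/ 2 * 2 + 1)%N by lia.
move: (N.+2 %/ 2)%N M0 NM MN => M M0 NM MN.
have := @ln_fact_le R N.+2 isT; have := ln_fact_ge R M.
have n2 : 2 <= N.+2%:R :> R by rewrite ler_nat.
have := lnn_le N.+2; have := lnn_ge0 R N.+2; have := lnn_ge0 R M.
have : ln N.+2%:R - ln M%:R <= 2 :> R.
  apply: le_trans (lnB_le _ _) _; rewrite ?ltr0n// ler_pdivrMr ?ltr0n//.
  by rewrite lerBlDr -natrM -natrD ler_nat; lia.
have : 1 <= M%:R :> R by rewrite ler1n.
move: NM MN; rewrite -!(ler_nat R) natrD natrM.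
move: (N.+2%:R) n2 (ln (N.+2`!)%:R) (ln (M`!)%:R) (M%:R) (psi M) (psi _) => y y2 lf lg x pm pn.
move: (ln y) (ln x) => b a xy yx x1 ba a0 b0 bn fge fle H1 H2.
have : (y - 2 * x) * b <= b by rewrite ler_piMl//; lra.
have : x * (b - a) <= x * 2 by rewrite ler_pM2l//; lra.
by nra.
Qed.

Lemma divn_le_div N k : (0 < k)%N -> (N %/ k)%:R <= N%:R / k%:R :> R.
Proof.
by move=> k0; rewrite ler_pdivlMr ?ltr0n// -natrM ler_nat leq_divM.
Qed.

Lemma div_lt_divnS N k : (0 < k)%N -> N%:R / k%:R < (N %/ k)%:R + 1 :> R.
Proof.
move=> k0; rewrite ltr_pdivrMr ?ltr0n// natr1 -natrM ltr_nat.
by rewrite -ltn_divLR.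
Qed.

Lemma sum_mangoldt_frac N :
  0 <= \sum_(1 <= k < N.+1) mangoldt k * (N%:R / k%:R - (N %/ k)%:R) <= psi N.
Proof.
apply/andP; split.
  rewrite big_nat; apply: sumr_ge0 => k /andP[k0 _].
  by rewrite mulr_ge0 ?mangoldt_ge0// subr_ge0 divn_le_div.
apply: ler_sum_nat => k /andP[k0 _]; rewrite ler_piMr ?mangoldt_ge0//.
by have := div_lt_divnS N k0; lra.
Qed.

(** Replacing floor (N / k) by N / k in the formula for ln N! costs at most psi N <= 10 N; the other
    3 N comes from N + 1 + ln N in [ln_fact_norm]. *)
Lemma mertens N : (0 < N)%N ->
  `|\sum_(1 <= k < N.+1) mangoldt k / k%:R - ln N%:R| <= 13.
Proof.
move=> N0; have N1 : 1 <= N%:R :> R by rewrite ler1n.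
have := sum_mangoldt_frac N.
have -> : \sum_(1 <= k < N.+1) mangoldt k * (N%:R / k%:R - (N %/ k)%:R) =
   N%:R * (\sum_(1 <= k < N.+1) mangoldt k / k%:R) - ln N`!%:R.
  rewrite -sum_mangoldt_divn mulr_sumr -sumrB; apply: eq_bigr => k _.
  by rewrite mulrBr; congr (_ - _); rewrite mulrCA.
have := ln_fact_norm R N0; have := psi_le N; have := lnn_le N.
move: (\sum_(_ <= _ < _) _) => S; move: (ln _) => f; move: (ln _) (psi _) => g p.
move: (N%:R) N1 => y y1; rewrite ler_norml => gy py /andP[h1 h2] /andP[h3 h4].
by rewrite ler_norml; apply/andP; split; nra.
Qed.

(** Nondecreasing in N, with limit Euler's constant. *)
Definition euler_defect N : R := harmonic_sum N - ln N.+1%:R.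

Lemma euler_defectB M N : (M <= N)%N ->
  0 <= euler_defect N - euler_defect M <= M.+1%:R^-1 - N.+1%:R^-1.
Proof.
elim: N => [|N IH]; first by case: M => //; rewrite !subrr lexx.
rewrite leq_eqVlt => /predU1P[->|/IH]; first by rewrite !subrr lexx.
rewrite /euler_defect harmonic_sumS.
have := @lnSB_le R N.+1 isT; have := @lnSB_ge R N.+1 isT.
by move=> h1 h2 /andP[h3 h4]; apply/andP; split; ilra.
Qed.

(* [1 + euler_defect N] plays the role of 1 + gamma: with a constant depending
   on N the bound holds for all M <= N and Euler's constant is not needed. *)
Lemma ln_fact_harmonic M N : (0 < M <= N)%N ->
  0 <= ln M`!%:R - M%:R * harmonic_sum M + (1 + euler_defect N) * M%:R
    <= harmonic_sum M.
Proof.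
elim: M => // M IH /andP[_ MN].
case: M IH MN => [|M] IH MN.
  have := euler_defectB (leq0n N).
  have -> : euler_defect 0 = 0 by rewrite /euler_defect ln1 /harmonic_sum big_geq// subrr.
  rewrite /harmonic_sum big_nat1 (factS 0) fact0 muln1 !ln1 !invr1.
  have : 0 <= N.+1%:R^-1 :> R by rewrite invr_ge0.
  move=> h1 /andP[h2 h3]; apply/andP; split; ilra.
have /IH : (0 < M.+1 <= N)%N by rewrite ltnS leq0n ltnW.
have := euler_defectB (ltnW MN).
have -> : euler_defect M.+1 = harmonic_sum M.+1 - ln M.+2%:R by [].
rewrite (harmonic_sumS _ M.+1) (factS M.+1) natrM lnM ?posrE ?ltr0n ?fact_gt0//.
have : 0 <= N.+1%:R^-1 :> R by rewrite invr_ge0.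
have : 0 < M.+2%:R :> R by rewrite ltr0n.
rewrite -[M.+2%:R](natr1 M.+1).
move: (ln (M.+1%:R + 1)) => l; move: (ln (M.+1)`!%:R) => f.
move: (M.+1%:R) (euler_defect N) (harmonic_sum M.+1) (N.+1%:R^-1).
move=> m E H w m0 w0 /andP[h1 h2] /andP[h3 h4].
have mV : (m + 1) * (m + 1)^-1 = 1 by rewrite mulfV// lt0r_neq0.
move: (m + 1)^-1 mV h2 => v mV h2.
by apply/andP; split; nra.
Qed.

End ChebyshevMertens.

(** * Selberg's symmetry formula *)

Section SelbergFormula.
Variable R : realType.
Implicit Types (x y : R) (n m k N M : nat).
Local Notation mangoldt := (mangoldt R).
Local Notation mobius := (mobius R).
Local Notation psi := (psi R).
Local Notation harmonic_sum := (harmonic_sum R).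
Local Notation euler_defect := (euler_defect R).

Lemma sum_inv_sqrt N :
  \sum_(1 <= n < N.+1) (Num.sqrt n%:R)^-1 <= 2 * Num.sqrt N%:R :> R.
Proof.
elim: N => [|N IH]; first by rewrite big_geq// sqrtr0 mulr0.
rewrite big_nat_recr//=; apply: le_trans (lerD IH (lexx _)) _.
have : Num.sqrt N.+1%:R ^+ 2 = N.+1%:R :> R by rewrite sqr_sqrtr.
have : Num.sqrt N%:R ^+ 2 = N%:R :> R by rewrite sqr_sqrtr.
have : 0 < Num.sqrt N.+1%:R :> R by rewrite sqrtr_gt0.
have : 0 <= Num.sqrt N%:R :> R by rewrite sqrtr_ge0.
move: (Num.sqrt N.+1%:R) (Num.sqrt N%:R) => b a a0 b0; rewrite -natr1 => <- b2.
have bV : b * b^-1 = 1 by rewrite mulfV// lt0r_neq0.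
have v0 : 0 < b^-1 by rewrite invr_gt0.
move: (b^-1) bV v0 => v bV v0.
have ab : a <= b by nra.
have vE : v = b - a * (a * v) by have := congr1 (fun t => t * v) b2; nra.
have av : a * v <= 1 by rewrite -bV ler_pM2r.
have : 0 <= (b - a) * (1 - a * v) by apply: mulr_ge0; lra.
by nra.
Qed.

Lemma ln_sqr_le_sqrt x : 1 <= x -> ln x * (1 + ln x) <= 20 * Num.sqrt x.
Proof.
move=> x1; have x0 : 0 <= x by lra.
set s := Num.sqrt (Num.sqrt x).
have s2 : Num.sqrt x = s ^+ 2 by rewrite sqr_sqrtr ?sqrtr_ge0.
have s0 : 0 <= s by rewrite sqrtr_ge0.
have s1 : 1 <= s by rewrite -sqrtr1 ler_sqrt// -sqrtr1 ler_sqrt.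
have xs : x = s ^+ 4 by rewrite -[LHS]sqr_sqrtr// s2 -exprM.
rewrite s2 xs lnXn; last lra.
have : ln (1 + (s - 1)) <= s - 1 by apply: le_ln1Dx; lra.
rewrite addrC subrK.
have : 0 <= ln s by rewrite ln_ge0.
by rewrite -mulr_natr; move: (ln s) => l l0 ls; nra.
Qed.

(* Arguments are integers throughout: psi (N / k) - N / k becomes
   [psi_err (N %/ k)], which differs from it by less than 1. *)
Definition psi_err N : R := psi N - N%:R.

Lemma euler_defect_bound N : 0 <= euler_defect N <= 1.
Proof.
have /andP[] := euler_defectB R (leq0n N).
have -> : euler_defect 0 = 0 by rewrite /euler_defect ln1 /harmonic_sum big_geq// subrr.
have : 0 <= N.+1%:R^-1 :> R by rewrite invr_ge0.
by rewrite invr1 => h1 h2 h3; apply/andP; split; ilra.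
Qed.

(** With M = N / n, summing psi (N / (n m)) over m gives ln M! and summing N / (n m) gives (N / n)
    H_M; the constant 1 + [euler_defect N] cancels what is left of order M, and only a logarithm
    remains. *)
Lemma selberg_inner N n : (0 < n <= N)%N ->
  `|\sum_(1 <= m < (N %/ n).+1) (psi (N %/ (n * m)) - N%:R / (n * m)%:R
     + (1 + euler_defect N))| <= 1 + ln (N%:R / n%:R).
Proof.
move=> /andP[n0 nN]; set M := (N %/ n)%N.
have M0 : (0 < M)%N by rewrite divn_gt0.
have MN : (0 < M <= N)%N by rewrite M0 leq_div.
have -> : \sum_(1 <= m < M.+1) (psi (N %/ (n * m)) - N%:R / (n * m)%:R
     + (1 + euler_defect N)) =
  ln M`!%:R - N%:R / n%:R * harmonic_sum M + (1 + euler_defect N) * M%:R.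
  rewrite big_split/= sumrB -sum_psi_divn mulr_sumr sumr_const_nat subn1 /=.
  rewrite mulr_natr; congr (_ - _ + _).
    by apply: eq_bigr => m _; rewrite divnMA.
  by apply: eq_bigr => m _; rewrite natrM invfM mulrA.
have := divn_le_div R N n0; have := div_lt_divnS R N n0.
have := ln_fact_harmonic R MN; have := harmonic_sum_ge0 R M.
have := harmonic_sum_le R M; have yM := divn_le_div R N n0.
have : ln M%:R <= ln (N%:R / n%:R) :> R.
  by rewrite ler_ln ?posrE ?divr_gt0 ?ltr0n// (leq_trans n0 nN).
rewrite -/M; move: (N%:R / n%:R) (ln _) (ln _) (ln _) (harmonic_sum M) => y a b c H.
move: (M%:R) (euler_defect N) => m E ab Hb H0 /andP[h1 h2] h3 h4.
have : 0 <= (y - m) * H by apply: mulr_ge0; lra.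
have : (y - m) * H <= H by rewrite ler_piMl//; lra.
by rewrite ler_norml => h5 h6; apply/andP; split; nra.
Qed.

(** The Tatuzawa--Iseki identity is applied to f k = psi (N / k) - N / k + C. By [selberg_inner] its
    Moebius side is at most the sum of ln t (1 + ln t) <= 20 sqrt t over t = N / n, hence at most 40
    N; the rest of 72 N pays for C ln N, C psi N and the rounding of N / k. *)
Lemma selberg N : (0 < N)%N ->
  `|psi_err N * ln N%:R + \sum_(1 <= k < N.+1) mangoldt k * psi_err (N %/ k)|
    <= 72 * N%:R.
Proof.
move=> N0; pose C := 1 + euler_defect N.
pose f k := psi (N %/ k) - N%:R / k%:R + C.
have := sum_mobius_ln_sum f N0.
set T := (X in X = _) => TE.
have : `|T| <= 40 * N%:R.
  apply: (@le_trans _ _ (\sum_(1 <= n < N.+1) 20 * Num.sqrt N%:R * (Num.sqrt n%:R)^-1)).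
    apply: le_trans (ler_norm_sum _ _ _) _; apply: ler_sum_nat => n /andP[n0].
    rewrite ltnS => nN; rewrite normrM [`|mobius n * _|]normrM.
    have t1 : 1 <= N%:R / n%:R :> R by rewrite ler_pdivlMr ?ltr0n// mul1r ler_nat.
    have n1 : 0 <= n%:R^-1 :> R by rewrite invr_ge0.
    rewrite -mulrA -sqrtrV// -sqrtrM//; apply: le_trans (ln_sqr_le_sqrt t1).
    have l0 : 0 <= ln (N%:R / n%:R) :> R by rewrite ln_ge0.
    rewrite (ger0_norm l0) -[leRHS]mul1r -mulrA.
    apply: ler_pM; rewrite ?mulr_ge0// ?norm_mobius//.
    by apply: ler_wpM2l => //; apply: selberg_inner; rewrite n0.
  rewrite -mulr_sumr; apply: le_trans (ler_wpM2l _ (sum_inv_sqrt N)) _.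
    by rewrite mulr_ge0// sqrtr_ge0.
  have := sqr_sqrtr (ler0n R N); set s := Num.sqrt _ => sN.
  by rewrite -sN le_eqVlt; apply/orP; left; apply/eqP; ring.
rewrite TE.
have -> : \sum_(1 <= k < N.+1) f k * mangoldt k =
  \sum_(1 <= k < N.+1) mangoldt k * psi_err (N %/ k)
  - \sum_(1 <= k < N.+1) mangoldt k * (N%:R / k%:R - (N %/ k)%:R)
  + C * psi N.
  rewrite /psi [C * _]mulr_sumr -sumrB -big_split/=; apply: eq_bigr => k _.
  by rewrite /f /psi_err; ring.
have -> : f 1%N = psi_err N + C by rewrite /f /psi_err divn1 divr1.
have := sum_mangoldt_frac R N; have := psi_le R N; have := psi_ge0 R N.
have := lnn_le R N; have := lnn_ge0 R N; have := euler_defect_bound N.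
rewrite -/C; have : 1 <= N%:R :> R by rewrite ler1n.
move: (\sum_(1 <= k < N.+1) _) (\sum_(1 <= k < N.+1) _) => S1 S2.
rewrite (_ : euler_defect N = C - 1); last by rewrite /C; ring.
clear f T TE; move: C (N%:R) (psi N) (ln _) (psi_err N).
move=> C y p l e y1 /andP[c1 c2] l0 ly p0 py /andP[s1 s2].
rewrite !ler_norml => /andP[h1 h2].
have : C * l <= 2 * l by apply: ler_wpM2r => //; lra.
have : C * p <= 2 * p by apply: ler_wpM2r => //; lra.
have : 0 <= C * l by apply: mulr_ge0 => //; lra.
have : 0 <= C * p by apply: mulr_ge0 => //; lra.
move: h1 h2; rewrite (mulrDl e C l).
move: (e * l) (C * l) (C * p) => a b c h1 h2 *; apply/andP; split; lra.
Qed.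

End SelbergFormula.

(** * Selberg's formula applied twice *)

Section SelbergInequality.
Variable R : realType.
Implicit Types (x y : R) (n m k N M : nat).
Local Notation mangoldt := (mangoldt R).
Local Notation psi := (psi R).
Local Notation psi_err := (psi_err R).

Lemma psi_err_norm N : `|psi_err N| <= 10 * N%:R.
Proof.
have := psi_le R N; have := psi_ge0 R N; have : 0 <= N%:R :> R by [].
by rewrite /psi_err ler_norml => *; apply/andP; split; lra.
Qed.

(** Selberg's function Lambda_2 = Lambda ln + Lambda * Lambda, with Dirichlet convolution; its
    average order is 2 ln n. *)
Definition selberg_weight n : R :=
  mangoldt n * ln n%:R + \sum_(d <- divisors n) mangoldt d * mangoldt (n %/ d).

Lemma sum_selberg_weightM (F : nat -> R) N :
  \sum_(1 <= n < N.+1) selberg_weight n * F n =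
  \sum_(1 <= n < N.+1) mangoldt n * ln n%:R * F n +
  \sum_(1 <= d < N.+1) mangoldt d *
    \sum_(1 <= m < (N %/ d).+1) mangoldt m * F (d * m)%N.
Proof.
transitivity (\sum_(1 <= n < N.+1) (mangoldt n * ln n%:R * F n +
   \sum_(d <- divisors n) mangoldt d * mangoldt (n %/ d) * F n)).
  by apply: eq_bigr => n _; rewrite mulrDl mulr_suml.
rewrite big_split/=; congr (_ + _).
rewrite (sum_divisors_swap (fun d n => mangoldt d * mangoldt (n %/ d) * F n)).
apply: eq_big_nat => d /andP[d0 _]; rewrite mulr_sumr; apply: eq_bigr => m _.
by rewrite mulKn// mulrA.
Qed.

Lemma selberg_weight_ge n : mangoldt n * ln n%:R <= selberg_weight n.
Proof.
rewrite /selberg_weight lerDl; apply: sumr_ge0 => d _.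
by rewrite mulr_ge0 ?mangoldt_ge0.
Qed.

Lemma sum_mangoldt_lnB N : (0 < N)%N ->
  0 <= psi N * ln N%:R - \sum_(1 <= k < N.+1) mangoldt k * ln k%:R <= 10 * N%:R.
Proof.
move=> N0.
have -> : psi N * ln N%:R - \sum_(1 <= k < N.+1) mangoldt k * ln k%:R =
    \sum_(1 <= k < N) psi k * (ln k.+1%:R - ln k%:R).
  rewrite abel_summation// opprD addNKr -sumrN; apply: eq_bigr => k _.
  by rewrite -mulrN opprB.
apply/andP; split.
  rewrite big_nat; apply: sumr_ge0 => k /andP[k0 _].
  by rewrite mulr_ge0 ?psi_ge0// subr_ge0 ler_lnn// k0 /=.
apply: (@le_trans _ _ (\sum_(1 <= k < N) 10)); last first.
  by rewrite sumr_const_nat -[leLHS]mulr_natr ler_pM2l// ler_nat leq_subr.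
apply: ler_sum_nat => k /andP[k0 _].
have -> : 10 = 10 * k%:R * k%:R^-1 :> R.
  by rewrite mulfK// pnatr_eq0 -lt0n.
apply: ler_pM; rewrite ?psi_ge0 ?psi_le ?lnSB_le//.
by rewrite subr_ge0 ler_lnn// k0 /=.
Qed.

(** Turning [psi_err] into psi in [selberg] adds N ln N to the first term and ln N!, again about N
    ln N, to the convolution; partial summation exchanges ln N for ln k. *)
Lemma selberg_asymptotic N : (0 < N)%N ->
  `|\sum_(1 <= n < N.+1) selberg_weight n - 2 * N%:R * ln N%:R| <= 85 * N%:R.
Proof.
move=> N0.
have -> : \sum_(1 <= n < N.+1) selberg_weight n =
    \sum_(1 <= k < N.+1) mangoldt k * ln k%:R +
    (\sum_(1 <= k < N.+1) mangoldt k * psi_err (N %/ k) + ln N`!%:R).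
  have := sum_selberg_weightM (fun=> 1) N.
  under eq_bigr do rewrite mulr1; move->; congr (_ + _).
    by apply: eq_bigr => n _; rewrite mulr1.
  rewrite -sum_mangoldt_divn -big_split/=; apply: eq_bigr => d _.
  rewrite -mulrDr /psi_err subrK; congr (_ * _).
  by apply: eq_bigr => m _; rewrite mulr1.
have := sum_mangoldt_lnB N0; have := selberg R N0; have := ln_fact_norm R N0.
rewrite (_ : psi N = psi_err N + N%:R); last by rewrite /psi_err subrK.
have := lnn_le R N; have : 1 <= N%:R :> R by rewrite ler1n.
move: (\sum_(_ <= _ < _) _) (\sum_(_ <= _ < _) _) (ln N`!%:R) => S1 S2 f.
move: (psi_err N) (ln N%:R) => e l; move: (N%:R) => y y1 ly.
rewrite !ler_norml mulrDl => /andP[h1 h2] /andP[h3 h4] /andP[h5 h6].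
by apply/andP; split; lra.
Qed.

Lemma ln_sub_divn N k : (0 < k <= N)%N ->
  0 <= ln (N%:R : R) - ln k%:R - ln (N %/ k)%:R <= 1.
Proof.
move=> /andP[k0 kN]; have M0 : (0 < N %/ k)%N by rewrite divn_gt0.
have N0 : (0 < N)%N by exact: leq_trans kN.
rewrite -ln_div ?posrE ?ltr0n//; have t0 : 0 < N%:R / k%:R :> R.
  by rewrite divr_gt0 ?ltr0n.
apply/andP; split.
  by rewrite subr_ge0 ler_ln ?posrE ?ltr0n// divn_le_div.
apply: le_trans (lnB_le _ t0) _; rewrite ?ltr0n// ler_pdivrMr ?ltr0n// mul1r.
apply: (@le_trans _ _ 1); last by rewrite ler1n.
by have := div_lt_divnS R N k0; lra.
Qed.

(** This is [selberg] at N / k; writing ln N - ln k for the logarithm of the rounded quotient costs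
    a further 10 N / k, whence 82 = 72 + 10. *)
Lemma selberg_iterated N k : (0 < k <= N)%N ->
  `|(ln N%:R - ln k%:R) * psi_err (N %/ k)| <=
    \sum_(1 <= l < (N %/ k).+1) mangoldt l * `|psi_err (N %/ (k * l))|
    + 82 * (N%:R / k%:R).
Proof.
move=> kN; have /andP[k0 kN'] := kN.
have M0 : (0 < N %/ k)%N by rewrite divn_gt0.
have H : `|\sum_(1 <= l < (N %/ k).+1) mangoldt l * psi_err (N %/ k %/ l)| <=
  \sum_(1 <= l < (N %/ k).+1) mangoldt l * `|psi_err (N %/ (k * l))|.
  apply: le_trans (ler_norm_sum _ _ _) _; apply: ler_sum => l _.
  by rewrite normrM ger0_norm ?mangoldt_ge0// divnMA.
move: H (selberg R M0) (ln_sub_divn kN) (psi_err_norm (N %/ k)) (divn_le_div R N k0).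
move: (\sum_(_ <= _ < _) _) (\sum_(_ <= _ < _) _) => S1 S2.
move: (psi_err (N %/ k)) (ln (N %/ k)%:R) (ln N%:R - ln k%:R) (N%:R / k%:R) => r l L t.
move: ((N %/ k)%:R) => m.
rewrite !ler_norml => /andP[h1 h2] /andP[h3 h4] /andP[h5 h6] /andP[h7 h8] h9.
have : 0 <= m by lra.
have : (L - l) * r <= (L - l) * (10 * m) by apply: ler_wpM2l.
have : (L - l) * (- (10 * m)) <= (L - l) * r by apply: ler_wpM2l.
by move=> h10 h11 h12; apply/andP; split; nra.
Qed.

(** In [selberg] times ln N, the weight Lambda (k) ln N splits into Lambda (k) ln k and Lambda (k)
    (ln N - ln k). The second part is treated by [selberg_iterated], and its double sum supplies the
    convolution half of [selberg_weight]. *)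
Lemma psi_err_selberg_weight N : (0 < N)%N ->
  `|psi_err N| * ln N%:R ^+ 2 <=
    \sum_(1 <= n < N.+1) selberg_weight n * `|psi_err (N %/ n)|
    + 1100 * N%:R * (1 + ln N%:R).
Proof.
move=> N0; rewrite sum_selberg_weightM.
have H : `|\sum_(1 <= k < N.+1) mangoldt k * psi_err (N %/ k)| * ln N%:R <=
  \sum_(1 <= n < N.+1) mangoldt n * ln n%:R * `|psi_err (N %/ n)| +
  \sum_(1 <= d < N.+1) mangoldt d *
    (\sum_(1 <= m < (N %/ d).+1) mangoldt m * `|psi_err (N %/ (d * m))|) +
  82 * N%:R * \sum_(1 <= k < N.+1) mangoldt k / k%:R.
  apply: le_trans (ler_wpM2r (lnn_ge0 R N) (ler_norm_sum _ _ _)) _.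
  rewrite mulr_suml mulr_sumr -!big_split/=.
  apply: ler_sum_nat => k /andP[k0]; rewrite ltnS => kN.
  rewrite normrM ger0_norm ?mangoldt_ge0//.
  have -> : forall a b c d e f : R, a * b * c + a * d + e * (a / f) =
      a * (b * c + (d + e / f)) by move=> *; ring.
  rewrite -mulrA; apply: ler_wpM2l; first exact: mangoldt_ge0.
  have := @selberg_iterated N k; rewrite k0 kN normrM => /(_ isT).
  rewrite ger0_norm; last by rewrite subr_ge0 ler_lnn// k0.
  by rewrite mulrA; lra.
have := selberg R N0; have := mertens R N0; have := lnn_ge0 R N.
have : 0 <= N%:R :> R by [].
move: H; rewrite !ler_norml.
move: (\sum_(1 <= n < N.+1) _) (\sum_(1 <= n < N.+1) _) => S2 S1.
move: (\sum_(1 <= n < N.+1) _) (\sum_(1 <= n < N.+1) _) => S4 S3.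
move: (psi_err N) (ln N%:R) => e l; move: (N%:R) => y H y0 l0 /andP[h1 h2] h3.
have : `|e * l| <= 72 * y + `|S1|.
  rewrite (_ : e * l = (e * l + S1) - S1); last by ring.
  by apply: le_trans (ler_normB _ _) _; rewrite lerD2r ler_norml; exact: h3.
rewrite normrM (ger0_norm l0); move: (`|e|) (`|S1|) H => E A H h4.
have : E * l * l <= (72 * y + A) * l by apply: ler_wpM2r.
have : y * S4 <= y * (13 + l) by apply: ler_wpM2l => //; lra.
have : 0 <= y * l by apply: mulr_ge0.
by rewrite expr2 => *; nra.
Qed.

End SelbergInequality.

(** * Recurrence, slow variation and bounded logarithmic sums of the error term *)

Section ErrorTerm.
Variable R : realType.
Implicit Types (x y : R) (n m k N M : nat).
Local Notation mangoldt := (mangoldt R).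
Local Notation psi := (psi R).
Local Notation psi_err := (psi_err R).
Local Notation harmonic_sum := (harmonic_sum R).

Lemma sum_abel_drop (s : nat -> R) N : (0 < N)%N ->
  \sum_(1 <= k < N) k%:R * (s k - s k.+1) =
  \sum_(1 <= k < N.+1) s k - N%:R * s N.
Proof.
move=> N0; have := abel_summation (fun=> 1) s N0.
under eq_bigr do rewrite mul1r.
under [in X in _ = _ + X]eq_bigr do rewrite sumr_const_nat subn1 /=.
by rewrite sumr_const_nat subn1 /= => ->; rewrite addrAC subrr add0r.
Qed.

(* Selberg's formula applied twice bounds the error by an average against
   [selberg_weight]; as the latter has summatory function 2 x ln x + O(x), partial
   summation replaces it by 2 ln n. *)
Lemma psi_err_recurrence N : (0 < N)%N ->
  `|psi_err N| * ln N%:R ^+ 2 <=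
    2 * \sum_(1 <= n < N.+1) ln n%:R * `|psi_err (N %/ n)|
    + 1400 * N%:R * (1 + ln N%:R).
Proof.
move=> N0; apply: le_trans (psi_err_selberg_weight R N0) _.
(* [s] is nonincreasing in k and its decrements dominate the variation of [rho], so that the sum by
   parts can be bounded and then summed back to ln N! and harmonic sums. *)
pose rho k := `|psi_err (N %/ k)|; pose s k := psi (N %/ k) + (N %/ k)%:R.
pose E n := \sum_(1 <= j < n.+1) (selberg_weight R j - 2 * ln j%:R).
have EB n : (0 < n)%N -> `|E n| <= 91 * n%:R.
  move=> n0; rewrite /E sumrB -mulr_sumr sum_ln.
  have := selberg_asymptotic R n0; have := ln_fact_norm R n0.
  have := lnn_le R n; have : 1 <= n%:R :> R by rewrite ler1n.
  move: (\sum_(_ <= _ < _) _) (ln n`!%:R) (ln n%:R) => S f l.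
  rewrite !ler_norml => h1 h2 /andP[h3 h4] /andP[h5 h6].
  by apply/andP; split; lra.
have H : \sum_(1 <= n < N.+1) (selberg_weight R n - 2 * ln n%:R) * rho n <=
    91 * N%:R + 91 * \sum_(1 <= k < N) k%:R * (s k - s k.+1).
  rewrite abel_summation//; apply: lerD.
    apply: le_trans (ler_norm _) _; rewrite normrM -[leRHS]mulr1.
    apply: ler_pM; rewrite ?EB// /rho divnn N0 normr_id /psi_err psiS psi0.
    by rewrite /mangoldt/= !add0r normrN normr1.
  rewrite mulr_sumr; apply: ler_sum_nat => k /andP[k0 _].
  apply: le_trans (ler_norm _) _; rewrite normrM mulrA.
  apply: ler_pM; rewrite ?EB//.
  apply: le_trans (ler_dist_dist _ _) _.
  have dN : (N %/ k.+1 <= N %/ k)%N by exact: leq_div2l.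
  have := ler_psi R dN; have : (N %/ k.+1)%:R <= (N %/ k)%:R :> R by rewrite ler_nat.
  by rewrite /psi_err /s ler_norml => h1 h2; apply/andP; split; lra.
have Hs : \sum_(1 <= k < N) k%:R * (s k - s k.+1) <= N%:R * (2 + 2 * ln N%:R).
  rewrite sum_abel_drop// /s big_split/= sum_psi_divn.
  have : \sum_(1 <= k < N.+1) (N %/ k)%:R <= N%:R * harmonic_sum N.
    by rewrite mulr_sumr; apply: ler_sum_nat => k /andP[k0 _]; exact: divn_le_div.
  have : N%:R * harmonic_sum N <= N%:R * (1 + ln N%:R).
    by apply: ler_wpM2l => //; exact: harmonic_sum_le.
  have : 0 <= N%:R * (psi (N %/ N) + (N %/ N)%:R) by rewrite mulr_ge0// addr_ge0// psi_ge0.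
  have := ln_fact_le R N0; have := lnn_le R N; have : 1 <= N%:R :> R by rewrite ler1n.
  by move: (N%:R * harmonic_sum N) (N%:R * (psi _ + _)) (\sum_(_ <= _ < _) _) => *; nra.
have -> : \sum_(1 <= n < N.+1) selberg_weight R n * `|psi_err (N %/ n)| =
  \sum_(1 <= n < N.+1) (selberg_weight R n - 2 * ln n%:R) * rho n +
  2 * \sum_(1 <= n < N.+1) ln n%:R * `|psi_err (N %/ n)|.
  rewrite mulr_sumr -big_split/=; apply: eq_bigr => n _.
  by rewrite mulrBl mulrA subrK.
have : 0 <= N%:R * ln N%:R :> R by rewrite mulr_ge0// lnn_ge0.
by have : 0 <= N%:R :> R by []; nra.
Qed.

(** A Brun--Titchmarsh type bound: Lambda ln is dominated by [selberg_weight], whose sum over ]m, n]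
    comes from [selberg_asymptotic]. The constant is 85 + 85 + 2, the 2 paying for ln n - ln m <=
    1. *)
Lemma psi_short_interval m n : (0 < m <= n)%N -> (n <= 2 * m)%N ->
  (psi n - psi m) * ln m%:R <= 2 * (n%:R - m%:R) * ln m%:R + 172 * n%:R.
Proof.
move=> /andP[m0 mn] nm; have n0 := leq_trans m0 mn.
have := selberg_asymptotic R m0; have := selberg_asymptotic R n0.
have -> : \sum_(1 <= k < n.+1) selberg_weight R k =
  \sum_(1 <= k < m.+1) selberg_weight R k + \sum_(m.+1 <= k < n.+1) selberg_weight R k.
  by rewrite -big_cat_nat.
have : (psi n - psi m) * ln m%:R <= \sum_(m.+1 <= k < n.+1) selberg_weight R k.
  rewrite /psi (big_cat_nat (n := m.+1) (p := n.+1))//= addrAC subrr add0r.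
  rewrite mulr_suml; apply: ler_sum_nat => k /andP[mk _].
  apply: le_trans (selberg_weight_ge _ _); apply: ler_wpM2l.
    exact: mangoldt_ge0.
  by rewrite ler_lnn// m0 ltnW.
have : ln n%:R - ln m%:R <= 1 :> R.
  apply: le_trans (lnB_le _ _) _; rewrite ?ltr0n// ler_pdivrMr ?ltr0n//.
  by rewrite mul1r lerBlDr -natrD ler_nat; lia.
have : 1 <= m%:R :> R by rewrite ler1n.
have : m%:R <= n%:R :> R by rewrite ler_nat.
move: (\sum_(m.+1 <= _ < _) _) => S1; move: (\sum_(_ <= _ < _) _) (psi n - psi m) => S2 p.
move: (ln n%:R) (ln m%:R) => b a; move: (n%:R) (m%:R) => y x xy x1 ba h.
rewrite !ler_norml => /andP[h1 h2] /andP[h3 h4].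
by have : y * (b - a) <= y * 1 by [apply: ler_wpM2l => //; lra]; nra.
Qed.

(** Up to the remainder, psi grows by between 0 and 2 (n - m); subtracting n - m centres this range,
    so the factor 2 becomes 1. *)
Lemma psi_err_short_interval m n : (0 < m <= n)%N -> (n <= 2 * m)%N ->
  `|psi_err n - psi_err m| * ln m%:R <= (n%:R - m%:R) * ln m%:R + 172 * n%:R.
Proof.
move=> mn nm; have := psi_short_interval mn nm; case/andP: mn => m0 mn.
have := ler_psi R mn; have := lnn_ge0 R m; have : 0 <= n%:R :> R by [].
have : m%:R <= n%:R :> R by rewrite ler_nat.
rewrite /psi_err; move: (ln m%:R) (psi n) (psi m) => l p q; move: (n%:R) (m%:R) => y x *.
have [] := ler0P (p - y - (q - x)) => _; last by nra.
by have : (y - x) * l >= (q - p + y - x) * l by [apply: ler_wpM2r => //; lra]; nra.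
Qed.

(** By partial summation this compares the sum of Lambda (k) / k with the harmonic sum, and both are
    ln N + O(1). *)
Lemma sum_psi_err N : (0 < N)%N ->
  `|\sum_(1 <= k < N) psi_err k * (k%:R^-1 - k.+1%:R^-1)| <= 25.
Proof.
move=> N0.
have -> : \sum_(1 <= k < N) psi_err k * (k%:R^-1 - k.+1%:R^-1) =
    (\sum_(1 <= k < N.+1) mangoldt k / k%:R - psi N / N%:R) - (harmonic_sum N - 1).
  rewrite abel_summation// -/(psi N) [X in X - (_ - 1)]addrAC subrr add0r.
  rewrite /harmonic_sum; have := sum_abel_drop (fun k => k%:R^-1) N0.
  rewrite mulfV ?pnatr_eq0 -?lt0n// => <-; rewrite -sumrB.
  by apply: eq_bigr => k _; rewrite mulrBl.
have := mertens R N0; have := harmonic_sum_le R N; have := harmonic_sum_ge R N.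
have : ln N%:R <= ln N.+1%:R :> R by rewrite ler_lnn// N0 /=.
have : 0 <= psi N / N%:R by rewrite divr_ge0// psi_ge0.
have : psi N / N%:R <= 10 by rewrite ler_pdivrMr ?ltr0n// psi_le.
move: (\sum_(_ <= _ < _) _) (psi _ / _) (ln N%:R) (ln N.+1%:R) (harmonic_sum N).
move=> S p a b h h1 h2 h3 h4 h5; rewrite !ler_norml => /andP[h6 h7].
by apply/andP; split; lra.
Qed.

End ErrorTerm.

(** * The prime number theorem *)

Section SmallErrorIntervals.
Variable R : realType.
Implicit Types (x e : R) (n m k y z N M : nat).
Local Notation psi_err := (psi_err R).

Lemma ln_unbounded (c : R) : exists2 n, (0 < n)%N &
  forall m, (n <= m)%N -> c <= ln m%:R.
Proof.
exists (Num.truncn (expR c)).+1 => // m nm.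
have m0 : (0 < m)%N by exact: leq_trans nm.
rewrite -(expRK c) ler_ln ?posrE ?expR_gt0 ?ltr0n//; apply/ltW.
apply: lt_le_trans (truncnS_gt _) _; by rewrite ler_nat.
Qed.

Lemma psi_err_jump e z : 0 < e <= 1 -> (0 < z)%N -> 2000 / e <= ln z%:R ->
  `|psi_err z.+1 - psi_err z| <= e / 2 * z%:R.
Proof.
move=> /andP[e0 e1] z0 Lz.
have z2 : (z.+1 <= 2 * z)%N by lia.
have := @psi_err_short_interval R z z.+1; rewrite z0 leqnSn => /(_ isT z2).
rewrite -(natr1 z) [_ + 1 - _]addrAC subrr add0r mul1r.
have z1 : 1 <= z%:R :> R by rewrite ler1n.
have Le : 2000 <= ln z%:R * e by rewrite -ler_pdivrMr.
have := lnn_le R z; move: Le; move: (ln _) (`|_|) => L D Le Ls H.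
move: (z%:R) z1 H Ls => s s1 H Ls.
have L0 : 0 < L by nra.
rewrite -(ler_pM2r L0); apply: le_trans H _.
have : 2000 * s <= L * e * s by apply: ler_wpM2r => //; lra.
by nra.
Qed.

(* Otherwise [psi_err] keeps its sign on [y, K y], since its jumps are too small
   to cross the forbidden zone, and the sum in [sum_psi_err] is unbounded. *)
Lemma psi_err_small_point e : 0 < e <= 1 -> exists2 K, (1 < K)%N &
  exists M, forall y, (M <= y)%N -> exists2 z, (y <= z <= K * y)%N &
   `|psi_err z| <= e / 4 * z%:R.
Proof.
(* 201 / 4 exceeds 50 = 2 * 25: the sum over [y, K y[ is a difference of two sums bounded by 25 in
   [sum_psi_err]. *)
move=> /andP[e0 e1]; have [K0 K00 HK0] := ln_unbounded (201 / e + 1).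
have [M M0 HM] := ln_unbounded (2000 / e).
exists K0.+2 => //; exists M => y My; have y0 : (0 < y)%N by exact: leq_trans My.
apply: contrapT => H0.
set K := K0.+2 in H0 *.
have {}H0 z : (y <= z <= K * y)%N -> e / 4 * z%:R < `|psi_err z|.
  by move=> yz; rewrite ltNge; apply/negP => h; apply: H0; exists z.
have [s s2 sy] : exists2 s : R, s ^+ 2 = 1 & 0 < s * psi_err y.
  have : psi_err y != 0.
    rewrite -normr_gt0; apply: le_lt_trans (H0 y _); last by rewrite leqnn leq_pmull.
    by rewrite mulr_ge0//; lra.
  rewrite neq_lt => /orP[h|h]; [exists (-1)|exists 1]; rewrite ?expr1n ?sqrrN ?expr1n//.
    by rewrite mulN1r oppr_gt0.
  by rewrite mul1r.
have s1 : `|s| = 1.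
  by have /eqP := s2; rewrite sqrf_eq1 => /orP[]/eqP ->; rewrite ?normrN normr1.
have Hs z : (y <= z <= K * y)%N -> e / 4 * z%:R < s * psi_err z.
  elim: z => [|z IH] /andP[yz zK]; first by move: yz; rewrite leqNgt y0.
  move: yz; rewrite leq_eqVlt => /predU1P[yE|yz].
    by rewrite -yE -[s * _]gtr0_norm// normrM s1 mul1r H0// leqnn leq_pmull.
  have := H0 z.+1; rewrite ltnW// zK => /(_ isT).
  have := IH; rewrite -(ltnS y) yz ltnW// => /(_ isT).
  have {}yz : (y <= z)%N by exact: yz.
  have z0 := leq_trans y0 yz.
  have := @psi_err_jump e z; rewrite e0 e1 z0 HM ?(leq_trans My yz)// => /(_ isT isT isT).
  have -> : `|psi_err z.+1 - psi_err z| = `|s * psi_err z.+1 - s * psi_err z|.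
    by rewrite -mulrBr normrM s1 mul1r.
  have -> : `|psi_err z.+1| = `|s * psi_err z.+1| by rewrite normrM s1 mul1r.
  rewrite -(natr1 z); have : 0 <= z%:R :> R by [].
  move: (s * _) (s * _) (z%:R) => a b t t0; rewrite ler_norml => /andP[h1 h2] h3.
  by have [] := ler0P b; nra.
have B N : (0 < N)%N -> `|\sum_(1 <= k < N) (s * psi_err k) * (k%:R^-1 - k.+1%:R^-1)| <= 25.
  move=> N0; under eq_bigr do rewrite -mulrA.
  by rewrite -mulr_sumr normrM s1 mul1r sum_psi_err.
have yKy : (y <= K * y)%N by rewrite leq_pmull.
have := B _ y0; have := B _ (leq_trans y0 yKy).
rewrite (big_cat_nat (n := y))//=.
have : e / 4 * (ln (K * y).+1%:R - ln y.+1%:R) <=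
  \sum_(y <= k < K * y) (s * psi_err k) * (k%:R^-1 - k.+1%:R^-1).
  rewrite -(telescope_sumr (fun k => ln k.+1%:R : R) yKy) mulr_sumr.
  apply: ler_sum_nat => k /andP[yk kK]; have k0 := leq_trans y0 yk.
  have := Hs k; rewrite yk ltnW// => /(_ isT) /ltW h.
  have k1 : 0 <= k%:R^-1 - k.+1%:R^-1 :> R.
    by rewrite subr_ge0 lef_pV2 ?posrE ?ltr0n// ler_nat.
  apply: le_trans (ler_wpM2r k1 h).
  rewrite -[leRHS]mulrA; apply: ler_wpM2l; first lra.
  rewrite mulrBr mulfV ?pnatr_eq0 -?lt0n//; apply: le_trans (lnSB_le R _) _ => //.
  have : k.+1%:R * k.+1%:R^-1 = 1 :> R by rewrite mulfV.
  by rewrite -{1}(natr1 k) mulrDl mul1r; move: (k.+1%:R^-1) => v h'; lra.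
have : ln (K0%:R : R) - 1 <= ln (K * y).+1%:R - ln y.+1%:R.
  rewrite lerBrDr; apply: (@le_trans _ _ (ln K0%:R + ln y%:R)).
    have := @lnSB_le R y y0; have : y%:R^-1 <= 1 :> R by rewrite invf_le1 ?ler1n ?ltr0n.
    by move=> h1 h2; lra.
  rewrite -lnM ?posrE ?ltr0n// -natrM ler_lnn// muln_gt0 K00 y0 /= /K; lia.
have := HK0 _ (leqnn K0) => h1 h2.
have : e / 4 * (201 / e) <= e / 4 * (ln (K * y).+1%:R - ln y.+1%:R).
  by apply: ler_wpM2l; lra.
have -> : e / 4 * (201 / e) = 201 / 4 by field; rewrite gt_eqF.
move: (\sum_(_ <= _ < _) _) (\sum_(_ <= _ < _) _) => a b h3 h4.
by rewrite !ler_norml => /andP[h5 h6] /andP[h7 h8]; lra.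
Qed.

(** Three contributions of e / 4: the error at the small point z, the length of the interval, and
    the remainder 172 n / ln z. K is doubled so that [z, 2 z], which contains the interval, ends
    below K y. *)
Lemma psi_err_small_interval e : 0 < e <= 1 -> exists2 K, (1 < K)%N &
  exists M, forall y, (M <= y)%N -> exists2 z, (y <= z)%N /\ (2 * z <= K * y)%N &
   forall n, (z <= n)%N -> n%:R <= z%:R * (1 + e / 4) ->
    `|psi_err n| <= 3 / 4 * e * n%:R.
Proof.
move=> e01; have /andP[e0 e1] := e01.
have [K K1 [M1 H]] := psi_err_small_point e01.
have [M2 M20 HM2] := ln_unbounded (2000 / e).
exists (2 * K)%N; first lia.
exists (maxn M1 M2) => y; rewrite geq_max => /andP[y1 y2].
have [z /andP[yz zK] rz] := H _ y1; exists z; first by split => //; rewrite -mulnA leq_pmul2l.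
move=> n zn nz; have z0 : (0 < z)%N by lia.
have Lz : 2000 <= ln z%:R * e by rewrite -ler_pdivrMr// HM2// (leq_trans y2).
have n2z : (n <= 2 * z)%N.
  rewrite -(ler_nat R) natrM; apply: le_trans nz _.
  by rewrite mulrC ler_wpM2r//; lra.
have := @psi_err_short_interval R z n; rewrite z0 zn => /(_ isT n2z).
have : z%:R <= n%:R :> R by rewrite ler_nat.
have : `|psi_err n| <= `|psi_err n - psi_err z| + `|psi_err z|.
  by rewrite -{1}(subrK (psi_err z) (psi_err n)) ler_normD.
have : 1 <= z%:R :> R by rewrite ler1n.
move: rz nz Lz; move: (`|_|) (`|_|) (`|_|) (ln _) => c d b L.
move: (z%:R) (n%:R) => t u h1 h2 h3 t1 h4 h5 h6.
have L0 : 0 < L by nra.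
have : c * L <= (e / 4 * t + e / 4 * u) * L.
  apply: le_trans h6 _.
  have : (u - t) * L <= (e / 4 * t) * L by apply: ler_wpM2r; lra.
  have : 2000 * u <= L * e * u by apply: ler_wpM2r => //; lra.
  by nra.
by rewrite ler_pM2r// => h7; nra.
Qed.

End SmallErrorIntervals.

(** * Logarithmic weight of the places where the error is small *)

Section SmallErrorWindow.
Variable R : realType.
Implicit Types (x e : R) (n m k y z N M J : nat).

(** N / n falls in the good interval for n in ]N / (z (1 + d)), N / z]: about d N / (z (1 + d))
    integers, each of weight at least z / N. The condition 4 K y <= d N keeps the rounding below the
    gap between d / (1 + d) and d / 4. *)
Lemma sum_inv_good (good : pred nat) (d : R) z y K N : 0 < d <= 1 ->
  (0 < y <= z)%N -> (2 * z <= K * y)%N ->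
  (forall n, (z <= n)%N -> n%:R <= z%:R * (1 + d) -> good n) ->
  4 * (K * y)%:R <= d * N%:R ->
  d / 4 <= \sum_((N %/ (K * y)).+1 <= n < (N %/ y).+1)
     (good (N %/ n)%N)%:R / n%:R.
Proof.
move=> /andP[d0 d1] /andP[y0 yz] zK good_z NK.
have z0 : (0 < z)%N by exact: leq_trans yz.
have Ky0 : (0 < K * y)%N by lia.
have zR : 0 < z%:R :> R by rewrite ltr0n.
have w0 : 0 < z%:R * (1 + d) by rewrite mulr_gt0//; lra.
have N0 : 0 < N%:R :> R.
  by rewrite -(pmulr_rgt0 _ d0); apply: lt_le_trans NK; rewrite mulr_gt0// ltr0n.
pose a := Num.truncn (N%:R / (z%:R * (1 + d))); pose b := (N %/ z)%N.
have t0 : 0 <= N%:R / (z%:R * (1 + d)) by rewrite divr_ge0 ?ltW.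
have aN : a%:R <= N%:R / (z%:R * (1 + d)) by rewrite truncn_le.
have Na : N%:R / (z%:R * (1 + d)) < a.+1%:R by exact: truncnS_gt.
have Ka : (N %/ (K * y) <= a)%N.
  rewrite truncn_ge_nat//; apply: le_trans (divn_le_div R _ Ky0) _.
  rewrite ler_pM2l// lef_pV2 ?posrE ?ltr0n//.
  apply: (@le_trans _ _ (2 * z)%:R); last by rewrite ler_nat.
  by rewrite natrM; nra.
have ab : (a <= b)%N.
  rewrite leq_divRL// -(ler_nat R) natrM.
  apply: (@le_trans _ _ (N%:R / (z%:R * (1 + d)) * z%:R)); first by rewrite ler_pM2r.
  rewrite mulrAC ler_pdivrMr// ler_pM2l//; nra.
have bN : (b <= N %/ y)%N by exact: leq_div2l.
have g0 n : 0 <= (good (N %/ n)%N)%:R / n%:R :> R by rewrite divr_ge0.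
rewrite (big_cat_nat (n := a.+1)) ?ltnS//=; last exact: leq_trans bN.
rewrite [X in _ + X](big_cat_nat (n := b.+1))//= addrCA.
apply: (@le_trans _ _ (\sum_(a.+1 <= n < b.+1) (good (N %/ n)%N)%:R / n%:R));
  last by rewrite lerDl addr_ge0// sumr_ge0.
apply: (@le_trans _ _ (\sum_(a.+1 <= n < b.+1) z%:R / N%:R)); last first.
  apply: ler_sum_nat => n /andP[an]; rewrite ltnS => nb.
  have n0 : (0 < n)%N by exact: leq_trans an.
  have nzN : (n * z <= N)%N by rewrite -leq_divRL.
  rewrite good_z.
  - by rewrite mul1r ler_pdivrMr// ler_pdivlMl ?ltr0n// -natrM ler_nat.
  - by rewrite leq_divRL// mulnC.
  - apply: le_trans (divn_le_div R _ n0) _; rewrite ler_pdivrMr ?ltr0n//.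
    rewrite mulrC -ler_pdivrMr//; apply/ltW/(lt_le_trans Na).
    by rewrite ler_nat.
rewrite sumr_const_nat subSS -[leRHS]mulr_natr natrB//.
have Nb : N%:R < (b%:R + 1) * z%:R :> R.
  by rewrite -ltr_pdivrMr//; exact: div_lt_divnS.
have zN : 4 * z%:R <= d * N%:R.
  by apply: le_trans NK; rewrite ler_pM2l// ler_nat (leq_trans _ zK)// leq_pmull.
rewrite mulrAC ler_pdivlMr//.
move: aN; rewrite ler_pdivlMr// => aN.
have w1 : 0 <= a%:R * z%:R * (d * (1 - d)) by rewrite !mulr_ge0//; lra.
have : 0 <= (N%:R - a%:R * (z%:R * (1 + d))) * (1 - d / 2).
  by apply: mulr_ge0; lra.
move: w1 Nb zN; move: (a%:R) (b%:R) (z%:R) (N%:R) => A B Z X.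
by lra.
Qed.

End SmallErrorWindow.

Section SmallErrorWeight.
Variable R : realType.
Implicit Types (x e : R) (n m k y z N M J : nat).

Lemma sum_inv_good_windows (good : pred nat) (d : R) K M : 0 < d <= 1 ->
  (1 < K)%N -> (0 < M)%N ->
  (forall y, (M <= y)%N -> exists2 z, (y <= z)%N /\ (2 * z <= K * y)%N &
    forall n, (z <= n)%N -> n%:R <= z%:R * (1 + d) -> good n) ->
  forall N J, 4 * (M * K ^ J)%:R <= d * N%:R ->
  J%:R * (d / 4) <= \sum_((N %/ (M * K ^ J)).+1 <= n < (N %/ M).+1)
     (good (N %/ n)%N)%:R / n%:R.
Proof.
move=> d01 K1 M0 H N; elim=> [|J IH] NJ.
  by rewrite mul0r expn0 muln1 big_geq.
have K0 : (0 < K)%N by exact: ltnW.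
have MK0 : (0 < M * K ^ J)%N by rewrite muln_gt0 M0 expn_gt0 K0.
have MKJ : (M <= M * K ^ J)%N by rewrite leq_pmulr// expn_gt0 K0.
have KE : (M * K ^ J.+1 = K * (M * K ^ J))%N by rewrite expnS mulnCA.
have MKS : (M * K ^ J <= M * K ^ J.+1)%N by rewrite KE leq_pmull.
rewrite (big_cat_nat (n := (N %/ (M * K ^ J)).+1))//=; last first.
- by rewrite ltnS leq_div2l.
- by rewrite ltnS leq_div2l// KE muln_gt0 K0.
rewrite -natr1 mulrDl mul1r [leLHS]addrC; apply: lerD; last first.
  by apply: IH; apply: le_trans NJ; rewrite ler_pM2l// ler_nat.
have [z [yz zK] Hz] := H _ MKJ.
have yz' : (0 < M * K ^ J <= z)%N by rewrite MK0.
rewrite KE in NJ *; exact: sum_inv_good yz' zK Hz NJ.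
Qed.

(* The windows ]N / (M K^(j+1)), N / (M K^j)] with M K^j <= sqrt N are about
   ln N / (2 ln K) in number; each carries a fixed amount of [sum 1 / n] over good
   n, and all these n satisfy ln n >= ln N / 2. *)
Lemma sum_ln_good (good : pred nat) (d : R) K M : 0 < d <= 1 ->
  (1 < K)%N -> (0 < M)%N ->
  (forall y, (M <= y)%N -> exists2 z, (y <= z)%N /\ (2 * z <= K * y)%N &
    forall n, (z <= n)%N -> n%:R <= z%:R * (1 + d) -> good n) ->
  exists N0, forall N, (N0 <= N)%N ->
   d / (64 * ln K%:R) * (N%:R * ln N%:R ^+ 2) <=
   \sum_(1 <= n < N.+1) ln n%:R * ((good (N %/ n)%N)%:R * (N %/ n)%:R).
Proof.
move=> d01 K1 M0 H; have /andP[d0 d1] := d01.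
have [N1 N10 HN1] := ln_unbounded (4 * ln M%:R + 4 * ln K%:R : R).
have [N2 N20 HN2] := ln_unbounded (ln ((4 / d) ^+ 2) : R).
exists (maxn N1 (maxn N2 (M ^ 2))) => N; rewrite !geq_max => /and3P[NN1 NN2 NM].
have N0 := leq_trans N10 NN1.
have lK : 0 < ln K%:R :> R by rewrite ln_gt0// ltr1n.
(* The largest exponent with (M K ^ J) ^ 2 <= N; squaring avoids the square root of N. *)
pose J := trunc_log (K ^ 2) (N %/ M ^ 2).
have K2 : (1 < K ^ 2)%N by rewrite -{1}(exp1n 2) ltn_exp2r.
have NM0 : (0 < N %/ M ^ 2)%N by rewrite divn_gt0// expn_gt0 M0.
have [J1 J2] : ((M * K ^ J) ^ 2 <= N)%N /\ (N < (M * K ^ J.+1) ^ 2)%N.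
  have E j : ((M * K ^ j) ^ 2 = (K ^ 2) ^ j * M ^ 2)%N.
    by rewrite expnMn -!expnM mulnC (mulnC 2%N).
  have /andP[h1 h2] := trunc_log_bounds K2 NM0.
  by split; rewrite E; [rewrite -leq_divRL|rewrite -ltn_divLR]; rewrite ?expn_gt0 ?M0.
have K0 : (0 < K)%N by exact: ltnW.
have X0 : (0 < M * K ^ J)%N by rewrite muln_gt0 M0 expn_gt0 K0.
have NX : 4 * (M * K ^ J)%:R <= d * N%:R :> R.
  have hd : 4 ^+ 2 <= d ^+ 2 * N%:R.
    have : (4 / d) ^+ 2 <= N%:R.
      by rewrite -ler_ln ?posrE ?exprn_gt0 ?divr_gt0 ?ltr0n//; exact: HN2.
    by rewrite expr_div_n ler_pdivrMr ?exprn_gt0// mulrC.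
  have hX : (M * K ^ J)%:R ^+ 2 <= N%:R :> R by rewrite -natrX ler_nat.
  have dN : 0 <= d * N%:R by rewrite mulr_ge0// ltW.
  suff : (4 * (M * K ^ J)%:R) ^+ 2 <= (d * N%:R) ^+ 2.
    by rewrite ler_pXn2r// nnegrE mulr_ge0.
  rewrite !exprMn.
  rewrite [N%:R ^+ 2]expr2 mulrA.
  by apply: ler_pM; rewrite ?exprn_ge0.
have LJ : ln N%:R <= 4 * ln K%:R * J%:R :> R.
  have : ln N%:R <= ln ((M * K ^ J.+1) ^ 2)%:R :> R by rewrite ler_lnn// N0 ltnW.
  have KR : 0 < K%:R ^+ J.+1 :> R by rewrite exprn_gt0 ?ltr0n.
  rewrite natrX lnXn ?ltr0n ?muln_gt0 ?M0 ?expn_gt0 ?K0// natrM natrX.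
  rewrite lnM ?posrE ?ltr0n// lnXn ?ltr0n// -[ln K%:R *+ _]mulr_natr -(natr1 J).
  by have := HN1 _ NN1; move: (ln _) (ln _) (ln _) => *; nra.
have L0 := lnn_ge0 R N.
apply: (@le_trans _ _ (\sum_((N %/ (M * K ^ J)).+1 <= n < (N %/ M).+1)
   (ln N%:R * N%:R / 4) * ((good (N %/ n)%N)%:R / n%:R))); last first.
  rewrite [leRHS](big_cat_nat (n := (N %/ (M * K ^ J)).+1))//=; last first.
    by rewrite ltnS leq_div.
  rewrite [X in _ <= _ + X](big_cat_nat (n := (N %/ M).+1))//=; last first.
  - by rewrite ltnS leq_div.
  - by rewrite ltnS leq_div2l// leq_pmulr// expn_gt0 K0.
  rewrite addrCA; apply: (@le_trans _ _ (\sum_((N %/ (M * K ^ J)).+1 <= n < (N %/ M).+1)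
     ln n%:R * ((good (N %/ n)%N)%:R * (N %/ n)%:R))); last first.
    by rewrite lerDl addr_ge0// sumr_ge0// => n _; rewrite !mulr_ge0// lnn_ge0.
  apply: ler_sum_nat => n /andP[n1]; rewrite ltnS => n2.
  have n0 : (0 < n)%N by exact: leq_trans n1.
  rewrite [leLHS]mulrCA [leRHS]mulrCA; apply: ler_wpM2l => //.
  have nN : (n <= N)%N by apply: leq_trans n2 _; rewrite leq_div.
  have h1 : ln N%:R <= 2 * ln n%:R :> R.
    rewrite mulr_natl -lnXn ?ltr0n// -natrX ler_lnn// N0 /=.
    have h : (N < n * (M * K ^ J))%N by rewrite -ltn_divLR.
    rewrite -(leq_pmul2r N0); apply: leq_trans (leq_mul (ltnW h) (ltnW h)) _.
    by rewrite mulnACA leq_mul2l J1 orbT.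
  have h2 : N%:R / n%:R <= 2 * (N %/ n)%:R :> R.
    have := div_lt_divnS R N n0.
    have : 1 <= (N %/ n)%:R :> R by rewrite ler1n divn_gt0.
    by move: (_ / _) => q; lra.
  have h3 : 0 <= N%:R / n%:R :> R by rewrite divr_ge0.
  rewrite (_ : ln N%:R * N%:R / 4 / n%:R = (ln N%:R / 2) * ((N%:R / n%:R) / 2)); last first.
    by field; rewrite pnatr_eq0 -lt0n.
  by apply: ler_pM; lra.
rewrite -mulr_sumr.
apply: (@le_trans _ _ (ln N%:R * N%:R / 4 * (J%:R * (d / 4)))); last first.
  apply: ler_wpM2l; first by rewrite !mulr_ge0.
  exact: sum_inv_good_windows d01 K1 M0 H _ _ NX.
have lKJ : ln N%:R / (4 * ln K%:R) <= J%:R :> R.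
  by rewrite ler_pdivrMr ?mulr_gt0// mulrC.
(* One factor 4 comes from halving both ln N and N / n, one from the number J of windows, one from
   the weight d / 4 of a window. *)
have -> : d / (64 * ln K%:R) * (N%:R * ln N%:R ^+ 2) =
   ln N%:R * N%:R / 4 * (ln N%:R / (4 * ln K%:R) * (d / 4)).
  by field; rewrite gt_eqF.
apply: ler_wpM2l; first by rewrite !mulr_ge0.
by apply: ler_wpM2r => //; lra.
Qed.

End SmallErrorWeight.

Section PrimeNumberTheorem.
Variable R : realType.
Implicit Types (x e : R) (n m k y z N M J : nat).
Local Notation psi_err := (psi_err R).

Lemma sum_ln_div N : (0 < N)%N ->
  \sum_(1 <= n < N.+1) ln n%:R / n%:R <= (ln N%:R ^+ 2 + ln N%:R) / 2 :> R.
Proof.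
case: N => // N _; elim: N => [|N IH].
  by rewrite big_nat1 ln1 mul0r expr0n addr0 mul0r.
rewrite big_nat_recr//=; apply: le_trans (lerD IH (lexx _)) _.
have := @lnSB_le R N.+1 isT; have := @lnSB_ge R N.+1 isT; have := lnn_ge0 R N.+2.
have : N.+1%:R^-1 <= 1 :> R by rewrite invf_le1 ?ler1n ?ltr0n.
have : 0 <= N.+2%:R^-1 :> R by rewrite invr_ge0.
move: (N.+2%:R^-1) (N.+1%:R^-1) (ln N.+2%:R) (ln N.+1%:R) => v w b a v0 w1 b0 h1 h2.
have : b * v <= b * (b - a) by apply: ler_wpM2l.
have : (b - a) * (b - a) <= (b - a) * 1 by apply: ler_wpM2l; lra.
by lra.
Qed.

Lemma ln_fact_le_mul N : (0 < N)%N -> ln N`!%:R <= N%:R * ln N%:R :> R.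
Proof.
move=> N0; rewrite -sum_ln mulr_natl; apply: le_trans (_ : \sum_(1 <= k < N.+1) ln N%:R <= _).
  by apply: ler_sum_nat => k kN; rewrite ler_lnn.
by rewrite sumr_const_nat subn1.
Qed.

(* [c] depends only on [e], so finitely many improvements bring any initial
   bound down to [e]. *)
Lemma psi_err_improve e : 0 < e <= 1 -> exists2 c : R, 0 < c & forall a, e <= a ->
  (exists n0, forall n, (n0 <= n)%N -> `|psi_err n| <= a * n%:R) ->
  exists n1, forall n, (n1 <= n)%N -> `|psi_err n| <= (a - c) * n%:R.
Proof.
move=> e01; have /andP[e0 e1] := e01.
have [K K1 [M HM]] := psi_err_small_interval e01.
have lK : 0 < ln K%:R :> R by rewrite ln_gt0// ltr1n.
have d01 : 0 < e / 4 <= 1 by lra.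
pose g : R := e / 4 / (64 * ln K%:R).
have g0 : 0 < g by rewrite !divr_gt0// mulr_gt0.
(* The recurrence turns the weight g of the good n into a gain e g / 2; half of it is spent on the
   terms of order N ln N. *)
exists (e * g / 4); first by rewrite divr_gt0// mulr_gt0.
move=> a ea [n0 Hn0].
pose good m := (n0 <= m)%N && (`|psi_err m| <= 3 / 4 * e * m%:R).
have Hg y : (maxn 1 (maxn M n0) <= y)%N -> exists2 z, (y <= z)%N /\ (2 * z <= K * y)%N &
    forall n, (z <= n)%N -> n%:R <= z%:R * (1 + e / 4) -> good n.
  rewrite !geq_max => /and3P[_ My ny]; have [z [yz zK] Hz] := HM _ My.
  exists z => // n zn nz; rewrite /good Hz// andbT.
  exact: leq_trans ny (leq_trans yz zn).
have M1 : (0 < maxn 1 (maxn M n0))%N by rewrite leq_max.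
have [N0 HN0] := sum_ln_good d01 K1 M1 Hg.
have [N1 N10 HN1] := ln_unbounded ((a + 20 * n0%:R + 2800) * 4 / (e * g)).
have [N2 N20 HN2] := ln_unbounded (1 : R).
exists (maxn N0 (maxn N1 N2)) => N; rewrite !geq_max => /and3P[NN0 NN1 NN2].
have Np : (0 < N)%N by exact: leq_trans N10 NN1.
have NR : 0 < N%:R :> R by rewrite ltr0n.
have a0 : 0 <= a by exact: le_trans (ltW e0) ea.
(* Three cases for N / n: below [n0] the crude bound 10 n0 applies; good values gain e / 4, because
   3 e / 4 <= a - e / 4; all others use the assumed bound. *)
have T n : (0 < n)%N -> ln n%:R * `|psi_err (N %/ n)| <=
    a * N%:R * (ln n%:R / n%:R) + 10 * n0%:R * ln n%:R
    - e / 4 * (ln n%:R * ((good (N %/ n)%N)%:R * (N %/ n)%:R)).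
  move=> np; rewrite [leRHS](_ : _ = ln n%:R * (a * (N%:R / n%:R) + 10 * n0%:R
    - e / 4 * ((good (N %/ n)%N)%:R * (N %/ n)%:R))); last by ring.
  apply: ler_wpM2l; first exact: lnn_ge0.
  clear Hg HN0 HN1 HN2 d01 g0 lK HM e01.
  have h1 : a * (N %/ n)%:R <= a * (N%:R / n%:R) by rewrite ler_wpM2l// divn_le_div.
  have h2 : 0 <= a * (N %/ n)%:R by rewrite mulr_ge0.
  have h3 : 0 <= n0%:R :> R by [].
  rewrite /good; case: leqP => [h4|h4] /=; last first.
    rewrite mul0r mulr0 subr0.
    have := psi_err_norm R (N %/ n); have : (N %/ n)%:R <= n0%:R :> R by rewrite ler_nat ltnW.
    by clear - h1 h2 h3; lra.
  have h5 := Hn0 _ h4.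
  case: (lerP `|psi_err (N %/ n)| (3 / 4 * e * (N %/ n)%:R)) => h6 /=; last first.
    by rewrite mul0r mulr0 subr0; lra.
  rewrite mul1r.
  have : e * (N %/ n)%:R <= a * (N %/ n)%:R by rewrite ler_wpM2r.
  by lra.
have S : \sum_(1 <= n < N.+1) ln n%:R * `|psi_err (N %/ n)| <=
   a * N%:R * ((ln N%:R ^+ 2 + ln N%:R) / 2) + 10 * n0%:R * (N%:R * ln N%:R)
   - e / 4 * (g * (N%:R * ln N%:R ^+ 2)).
  apply: (@le_trans _ _ (\sum_(1 <= n < N.+1) (a * N%:R * (ln n%:R / n%:R) +
    10 * n0%:R * ln n%:R - e / 4 * (ln n%:R * ((good (N %/ n)%N)%:R * (N %/ n)%:R))))).
    by apply: ler_sum_nat => n /andP[np _]; exact: T.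
  rewrite sumrB big_split/= -!mulr_sumr; apply: lerB; [apply: lerD|].
  - by rewrite ler_wpM2l ?mulr_ge0// sum_ln_div.
  - rewrite ler_wpM2l ?mulr_ge0// sum_ln.
    exact: ln_fact_le_mul.
  - by rewrite ler_wpM2l ?HN0// divr_ge0// ltW.
have eg : 0 < e * g by exact: mulr_gt0.
have L1 := HN2 _ NN2; rewrite -(ler_pM2r (exprn_gt0 2 (lt_le_trans ltr01 L1))).
have := HN1 _ NN1; rewrite ler_pdivrMr//.
have := psi_err_recurrence R Np.
move: S; move: (\sum_(_ <= _ < _) _) (`|_|) (ln _) L1 => S r L L1.
move: (n0%:R) (ler0n R n0) NR a0 g0; move: (N%:R) => y t t0 y0 a0 g0 h1 h2 h3.
have yL : 0 <= y * L by rewrite mulr_ge0// ltW// (lt_le_trans ltr01).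
have h5 : y * 1 <= y * L by rewrite ler_pM2l.
have h4 : y * L * ((a + 20 * t + 2800) * 4) <= y * L * (L * (e * g)).
  by rewrite ler_wpM2l.
clear - h1 h2 h4 h5; lra.
Qed.

Theorem prime_number_theorem_psi e : 0 < e <= 1 ->
  exists n0, forall n, (n0 <= n)%N -> `|psi_err n| <= e * n%:R.
Proof.
move=> e01; have [c c0 H] := psi_err_improve e01; have /andP[e0 e1] := e01.
have K k : (exists n0, forall n, (n0 <= n)%N -> `|psi_err n| <= (10 - k%:R * c) * n%:R)
  \/ (exists n0, forall n, (n0 <= n)%N -> `|psi_err n| <= e * n%:R).
  elim: k => [|k [IH|]]; last by right.
    by left; exists 0%N => n _; rewrite mul0r subr0; exact: psi_err_norm.
  have [ek|ke] := lerP e (10 - k%:R * c).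
    left; have [n1 Hn1] := H _ ek IH; exists n1 => n /Hn1.
    by have -> : 10 - k.+1%:R * c = 10 - k%:R * c - c by rewrite -(natr1 k); ring.
  right; have [n1 Hn1] := IH; exists n1 => n /Hn1 h; apply: le_trans h _.
  by rewrite ler_wpM2r// ltW.
have [[n1 Hn1]|//] := K (Num.truncn (10 / c)).+1.
exists n1 => n /Hn1 h; apply: le_trans h _; apply: ler_wpM2r => //.
have := truncnS_gt (10 / c); rewrite ltr_pdivrMr//; move: (_%:R * c) => u; lra.
Qed.

End PrimeNumberTheorem.

(** * Size of the n-th prime *)

Section NthPrime.
Variable R : realType.
Implicit Types (x e : R) (n m k p N M : nat).
Local Notation mangoldt := (mangoldt R).
Local Notation psi := (psi R).

Lemma next_primeP m : [/\ (m < next_prime m)%N, prime (next_prime m) &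
  forall q, prime q -> (m < q)%N -> (next_prime m <= q)%N].
Proof.
rewrite /next_prime; case: ex_minnP => p /andP[mp pp] H; split => // q qp mq.
by apply: H; rewrite mq.
Qed.

Lemma nth_primeS n : nth_prime n.+1 = next_prime (nth_prime n).
Proof. by []. Qed.

Lemma ltn_nth_prime n : (n < nth_prime n)%N.
Proof.
elim: n => // n IH; rewrite nth_primeS; case: (next_primeP (nth_prime n)) => h _ _.
exact: leq_ltn_trans IH h.
Qed.

Definition prime_count N : nat := \sum_(1 <= k < N.+1) prime k.

Lemma prime_count_next m : prime_count (next_prime m) = (prime_count m).+1.
Proof.
have [h1 h2 h3] := next_primeP m; rewrite /prime_count.
rewrite big_nat_recr/= ?h2 ?addn1; last exact: leq_trans h1.
congr _.+1; case: m h1 h2 h3 => [|m] h1 h2 h3.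
  rewrite [RHS]big_geq// big_nat big1// => k /andP[k0 kp]; apply/eqP; rewrite eqb0.
  by apply/negP => pk; have := h3 _ pk k0; rewrite leqNgt kp.
rewrite (big_cat_nat (n := m.+2))//= [X in (_ + X)%N]big_nat [X in (_ + X)%N]big1.
  by rewrite addn0.
move=> k /andP[k0 kp]; apply/eqP; rewrite eqb0.
by apply/negP => pk; have := h3 _ pk k0; rewrite leqNgt kp.
Qed.

Lemma prime_count_nth_prime n : prime_count (nth_prime n) = n.
Proof.
elim: n => [|n IH]; first by rewrite /prime_count big_nat1.
by rewrite nth_primeS prime_count_next IH.
Qed.

(** Each prime p <= N contributes ln p once for every power p ^ k <= N, in all the logarithm of the
    largest such power, at most ln N. *)
Lemma psi_le_prime_count N : psi N <= (prime_count N)%:R * ln N%:R.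
Proof.
case: N => [|N]; first by rewrite psi0 ln0// mulr0.
set n := N.+1.
pose F m p k : R := ((m == p ^ k)%N)%:R * ln p%:R.
have F0 m p k : 0 <= F m p k by rewrite mulr_ge0// lnn_ge0.
apply: (@le_trans _ _ (\sum_(1 <= m < n.+1) \sum_(1 <= p < n.+1 | prime p)
   \sum_(1 <= k < (trunc_log p n).+1) F m p k)).
  apply: ler_sum_nat => m /andP[m0]; rewrite ltnS => mn.
  have [->|] := eqVneq (mangoldt m) 0.
    by apply: sumr_ge0 => p _; apply: sumr_ge0.
  move=> /mangoldt_neq0[p [k [pp k0 mE]]].
  have pn : (p <= n)%N.
    by apply: leq_trans mn; rewrite mE -{1}(expn1 p) leq_exp2l// prime_gt1.
  have kn : (k <= trunc_log p n)%N by rewrite trunc_log_max// ?prime_gt1// -mE.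
  rewrite (big_rem p)/= ?mem_index_iota ?ltnS ?prime_gt0// pp.
  rewrite (big_rem k)/= ?mem_index_iota ?ltnS ?k0// {1}/F -mE eqxx mul1r.
  rewrite mE mangoldtX// -addrA lerDl addr_ge0//; first exact: sumr_ge0.
  by apply: sumr_ge0 => q _; apply: sumr_ge0.
rewrite exchange_big_nat/=.
rewrite /prime_count natr_sum mulr_suml big_mkcond/=.
apply: ler_sum_nat => p /andP[p0 _]; case: ifPn => pp; last by rewrite mul0r.
rewrite mul1r exchange_big_nat/=.
apply: (@le_trans _ _ (\sum_(1 <= k < (trunc_log p n).+1) ln p%:R)).
  apply: ler_sum_nat => k _; rewrite /F -mulr_suml -[leRHS]mul1r.
  apply: ler_wpM2r; first exact: lnn_ge0.
  rewrite -natr_sum lern1 -big_mkcond /= sum1_count.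
  apply: (@leq_trans (count_mem (p ^ k)%N (index_iota 1 n.+1))) => //.
  by rewrite count_uniq_mem ?iota_uniq// leq_b1.
rewrite sumr_const_nat subn1 /= -lnXn ?ltr0n// -natrX ler_lnn// expn_gt0 p0 /=.
exact: trunc_logP (prime_gt1 pp) _.
Qed.

(** The primes in ]M, N] weigh at least ln M each, and at most M primes are discarded. *)
Lemma prime_count_le_psi M N : (0 < M <= N)%N ->
  ((prime_count N)%:R - M%:R) * ln M%:R <= psi N.
Proof.
move=> /andP[M0 MN].
rewrite /prime_count (big_cat_nat (n := M.+1))//= natrD.
apply: (@le_trans _ _ ((\sum_(M.+1 <= k < N.+1) prime k)%:R * ln M%:R)).
  apply: ler_wpM2r; first exact: lnn_ge0.
  rewrite addrAC gerDr subr_le0 ler_nat.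
  apply: (@leq_trans (\sum_(1 <= k < M.+1) 1)); last first.
    by rewrite sum_nat_const_nat subn1 muln1.
  by apply: leq_sum => k _; exact: leq_b1.
rewrite natr_sum mulr_suml /psi [leRHS](big_cat_nat (n := M.+1))//=.
rewrite -[leLHS]add0r; apply: lerD; first by apply: sumr_ge0 => k _; exact: mangoldt_ge0.
apply: ler_sum_nat => k /andP[Mk _]; case: (boolP (prime k)) => pk; last first.
  by rewrite mul0r mangoldt_ge0.
by rewrite mul1r mangoldt_prime// ler_lnn// M0 ltnW.
Qed.

End NthPrime.

Section NthPrimeAsymptotics.
Variable R : realType.
Implicit Types (x e : R) (n m k p N M : nat).
Local Notation psi := (psi R).
Local Notation psi_err := (psi_err R).

Lemma ln_le_sqrt x : 0 < x -> ln x <= 2 * Num.sqrt x.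
Proof.
move=> x0; have s0 : 0 < Num.sqrt x by rewrite sqrtr_gt0.
have {1}-> : x = Num.sqrt x ^+ 2 by rewrite sqr_sqrtr// ltW.
by rewrite lnXn// -[leLHS]mulr_natl ler_pM2l// ltW// ln_sublinear.
Qed.

(** The threshold comes from 2 ln x + 1 <= 5 sqrt x and 5 <= e sqrt x. *)
Lemma ln_small x e : 0 < e <= 1 -> 25 / e ^+ 2 <= x -> 2 * ln x + 1 <= e * x.
Proof.
move=> /andP[e0 e1]; rewrite ler_pdivrMr ?exprn_gt0// => xe.
have x0 : 0 < x by rewrite -(pmulr_lgt0 _ (exprn_gt0 2 e0)); lra.
have x25 : 25 <= x.
  by apply: le_trans xe _; rewrite ler_piMr ?exprn_ile1 ?(ltW e0) ?(ltW x0).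
have := ln_le_sqrt x0; have := sqr_sqrtr (ltW x0); have := sqrtr_ge0 x.
move: (Num.sqrt x) (ln x) => s l s0 sx ls.
have s1 : 1 <= s by rewrite -(@ler_pXn2r _ 2) ?nnegrE// expr1n sx; lra.
have se : 5 <= s * e.
  have se0 : 0 <= s * e by rewrite mulr_ge0// ltW.
  by rewrite -(@ler_pXn2r _ 2) ?nnegrE// exprMn sx; lra.
have : s * 5 <= s * (s * e) by rewrite ler_wpM2l.
by rewrite -sx; lra.
Qed.

Lemma ln1B_ge e : 0 <= e <= 1 / 2 -> - (2 * e) <= ln (1 - e).
Proof.
move=> /andP[e0 e1].
have h : 0 < 1 - e by lra.
have := lnB_le h ltr01; rewrite ln1 (_ : 1 - (1 - e) = e); last by ring.
move=> H.
have : e / (1 - e) <= 2 * e by rewrite ler_pdivrMr//; nra.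
by lra.
Qed.

(* [prime_count_le_psi] is used with M = P / (ln P)^2, negligible compared to
   P / ln P while ln M ~ ln P. *)
Lemma nth_prime_ln_bound e : 0 < e <= 1 / 5 -> exists n0, forall n, (n0 <= n)%N ->
  `|ln n%:R + ln (ln (nth_prime n)%:R) - ln (nth_prime n)%:R| <= 5 * e.
Proof.
move=> /andP[e0 e5]; have e01 : 0 < e <= 1 by lra.
have [n1 Hn1] := prime_number_theorem_psi e01.
have [n2 n20 Hn2] := ln_unbounded (25 / e ^+ 2).
exists (maxn n1 n2) => n; rewrite geq_max => /andP[h1 h2].
have n0 : (0 < n)%N by exact: leq_trans h2.
have nP := ltn_nth_prime n.
have := psi_le_prime_count R (nth_prime n); rewrite prime_count_nth_prime.
have := Hn1 _ (leq_trans h1 (ltnW nP)); have := Hn2 _ (leq_trans h2 (ltnW nP)).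
have := fun M => @prime_count_le_psi R M (nth_prime n); rewrite prime_count_nth_prime.
have : (0 < nth_prime n)%N by exact: leq_trans nP.
rewrite /psi_err; move: (nth_prime n) {nP} => P P0 H2 L25 Hpsi H1.
have PR : 0 < P%:R :> R by rewrite ltr0n.
have nR : 0 < n%:R :> R by rewrite ltr0n.
have Ls := ln_small e01 L25.
set L := ln P%:R in L25 Ls H1 *.
have L25' : 25 <= L.
  apply: le_trans L25; rewrite ler_pdivlMr ?exprn_gt0// ler_piMr//.
  by rewrite exprn_ile1//; lra.
have L0 : 0 < L by lra.
have LL0 : 0 <= ln L by rewrite ln_ge0//; lra.
have eL : 1 <= e * L by lra.
have psi1 : (1 - e) * P%:R <= n%:R * L.
  by move: Hpsi; rewrite ler_norml => /andP[h3 h4]; lra.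
(* Together with [psi1] this is p_n ~ n ln p_n. The 5 e comes from 1 + 2 e <= (1 - e) (1 + 5 e). *)
have psi2 : n%:R * L <= (1 + 5 * e) * P%:R.
  have P2 : 2 <= P%:R / L ^+ 2.
    have -> : P%:R / L ^+ 2 = expR (L - 2 * ln L).
      rewrite expRB (_ : 2 * ln L = ln (L ^+ 2)); last by rewrite lnXn// mulr_natl.
      by rewrite !lnK ?posrE ?exprn_gt0.
    apply: le_trans (expR_ge1Dx _).
    have : e * L <= 1 / 5 * L by rewrite ler_wpM2r// ltW.
    by lra.
  pose M := Num.truncn (P%:R / L ^+ 2).
  have q0 : 0 <= P%:R / L ^+ 2 by lra.
  have M1 : M%:R <= P%:R / L ^+ 2 by rewrite truncn_le.
  have M2 : P%:R / L ^+ 2 < M%:R + 1 by rewrite natr1 truncnS_gt.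
  have M0 : (0 < M)%N by rewrite truncn_gt0; lra.
  have MP : (M <= P)%N.
    rewrite -(ler_nat R); apply: le_trans M1 _; rewrite ler_pdivrMr ?exprn_gt0//.
    by rewrite ler_peMr ?(ltW PR)// exprn_ege1//; lra.
  have := H2 M; rewrite M0 MP => /(_ isT) {}H2.
  have lM : (1 - e) * L <= ln M%:R.
    have : ln (P%:R / L ^+ 2) - ln M%:R <= 1 :> R.
      apply: le_trans (lnB_le _ _) _; rewrite ?ltr0n//; first lra.
      rewrite ler_pdivrMr ?ltr0n// mul1r.
      have : 1 <= M%:R :> R by rewrite ler1n.
      by lra.
    rewrite ln_div ?posrE ?exprn_gt0// lnXn// -/L.
    by lra.
  have psiu : psi P <= (1 + e) * P%:R.
    by move: Hpsi; rewrite ler_norml => /andP[h3 h4]; lra.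
  have [nM|Mn] := lerP (n%:R : R) M%:R.
    apply: (@le_trans _ _ (P%:R / L ^+ 2 * L)).
      by rewrite ler_pM2r//; exact: le_trans nM M1.
    rewrite (_ : P%:R / L ^+ 2 * L = P%:R * L^-1); last by field; rewrite gt_eqF.
    rewrite [leLHS]mulrC ler_wpM2r//; apply: (@le_trans _ _ 1); last lra.
    by rewrite invf_le1//; lra.
  have h5 : (n%:R - M%:R) * ((1 - e) * L) <= (1 + e) * P%:R.
    apply: le_trans psiu; apply: le_trans H2; apply: ler_wpM2l => //.
    by rewrite subr_ge0 ltW.
  have h6 : M%:R * L * L <= P%:R.
    by rewrite -mulrA -expr2 -ler_pdivlMr// exprn_gt0.
  have h7 : M%:R * L <= e * P%:R.
    have : 0 <= M%:R * L :> R by rewrite mulr_ge0// ltW.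
    move: h6; move: (M%:R * L) => u h6 u0.
    have : u * 1 <= u * (e * L) by rewrite ler_wpM2l.
    have : e * (u * L) <= e * P%:R by rewrite ler_wpM2l// ltW.
    by lra.
  have h8 : (1 - e) * (n%:R * L) <= (1 + e) * P%:R + e * P%:R by nra.
  rewrite -(ler_pM2l (_ : 0 < 1 - e)); last lra.
  apply: le_trans h8 _; rewrite -mulrDl mulrA ler_wpM2r//.
  nra.
have h1e : 0 < 1 - e by lra.
have h5e : 0 < 1 + 5 * e by lra.
have : ln ((1 - e) * P%:R) <= ln (n%:R * L) by rewrite ler_ln ?posrE ?mulr_gt0.
have : ln (n%:R * L) <= ln ((1 + 5 * e) * P%:R) by rewrite ler_ln ?posrE ?mulr_gt0.
rewrite !lnM ?posrE//; have : ln (1 + 5 * e) <= 5 * e by apply: le_ln1Dx; lra.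
have := @ln1B_ge e; rewrite -/L => h9 h10 h11 h12.
have : - (2 * e) <= ln (1 - e) by apply: h9; lra.
by rewrite ler_norml => h13; apply/andP; split; lra.
Qed.

(** Only ln ln p_n has to be exchanged for ln ln n: the previous bound gives ln n >= (1 - d) ln p_n,
    which costs 2 d, whence e / 7 with 7 = 5 + 2. *)
Lemma nth_prime_ln_asymptotic e : 0 < e -> exists n0, forall n, (n0 <= n)%N ->
  `|ln (nth_prime n)%:R - (ln n%:R + ln (ln n%:R))| <= e.
Proof.
move=> e0; pose d := Num.min (1 / 5) (e / 7).
have d0 : 0 < d by rewrite lt_min; apply/andP; split; lra.
have d5 : d <= 1 / 5 by rewrite ge_min lexx.
have de : 7 * d <= e by rewrite mulrC -ler_pdivlMr// ge_min lexx orbT.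
have d01 : 0 < d <= 1 / 5 by rewrite d0.
have d1 : 0 < d <= 1 by lra.
have [n1 Hn1] := nth_prime_ln_bound d01.
have [n2 n20 Hn2] := ln_unbounded (25 / d ^+ 2).
exists (maxn n1 n2) => n; rewrite geq_max => /andP[h1 h2].
have n0 : (0 < n)%N by exact: leq_trans h2.
have nP := ltn_nth_prime n; have := Hn1 _ h1.
have := Hn2 _ h2; have := ln_small d1 (Hn2 _ (leq_trans h2 (ltnW nP))).
have := Hn2 _ (leq_trans h2 (ltnW nP)).
have : ln n%:R <= ln (nth_prime n)%:R :> R by rewrite ler_lnn// n0 ltnW.
move: (ln n%:R) (ln (nth_prime n)%:R) => l L lL L25 Ls l25.
have d25 : 25 <= 25 / d ^+ 2.
  by rewrite ler_pdivlMr ?exprn_gt0// ler_piMr// exprn_ile1//; lra.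
have L0 : 0 < L by lra. have l0 : 0 < l by lra.
have LL0 : 0 <= ln L by rewrite ln_ge0//; lra.
rewrite ler_norml => /andP[h3 h4].
have h5 : (1 - d) * L <= l by lra.
have h6 : ln l <= ln L by rewrite ler_ln ?posrE.
have h7 : ln ((1 - d) * L) <= ln l by rewrite ler_ln ?posrE ?mulr_gt0//; lra.
have h8 : - (2 * d) <= ln (1 - d) by apply: ln1B_ge; lra.
move: h7; rewrite lnM ?posrE//; last lra.
by rewrite ler_norml => h7; apply/andP; split; lra.
Qed.

End NthPrimeAsymptotics.

(** * Logarithmic means and exponential sums *)

Section LogMeans.
Variable R : realType.
Implicit Types (u v f g : nat -> R) (x d e C : R) (n m k N K : nat).

Definition logsum u N : R := \sum_(1 <= n < N.+1) u n / n%:R.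

(** A quantitative form of [lognull]: when A + B = 0 the means of cos (d g n) are only O(1 / d), so
    the constant must be tracked. *)
Definition logsmall d u : Prop := exists N0, forall N, (N0 <= N)%N ->
  `|logsum u N| <= d * ln N%:R.

Definition lognull u : Prop := forall d, 0 < d -> logsmall d u.

Definition vanishing u : Prop := forall d, 0 < d -> exists N0, forall n, (N0 <= n)%N ->
  `|u n| <= d.

Lemma eq_logsmall d u v : u =1 v -> logsmall d u -> logsmall d v.
Proof.
move=> uv [N0 H]; exists N0 => N /H; rewrite /logsum.
by under eq_bigr do rewrite uv.
Qed.

Lemma logsmall_le d d' u : d <= d' -> logsmall d u -> logsmall d' u.
Proof.
move=> dd' [N0 H]; exists N0 => N NN0; apply: le_trans (H _ NN0) _.
by apply: ler_wpM2r => //; exact: lnn_ge0.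
Qed.

Lemma logsmallD d d' u v : logsmall d u -> logsmall d' v ->
  logsmall (d + d') (fun n => u n + v n).
Proof.
move=> [N1 H1] [N2 H2]; exists (maxn N1 N2) => N; rewrite geq_max => /andP[h1 h2].
rewrite /logsum; under eq_bigr do rewrite mulrDl.
rewrite big_split/= mulrDl; apply: le_trans (ler_normD _ _) _.
by apply: lerD; [exact: H1|exact: H2].
Qed.

Lemma logsmallZ c d u : logsmall d u -> logsmall (`|c| * d) (fun n => c * u n).
Proof.
move=> [N1 H1]; exists N1 => N h1; rewrite /logsum.
under eq_bigr do rewrite -mulrA.
by rewrite -mulr_sumr normrM -mulrA ler_wpM2l// H1.
Qed.

Lemma le_logsmall d u v : (forall n, `|u n| <= v n) -> logsmall d v -> logsmall d u.
Proof.
move=> uv [N0 H]; exists N0 => N /H; apply: le_trans.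
apply: le_trans (ler_norm _); apply: le_trans (ler_norm_sum _ _ _) _.
apply: ler_sum => n _; rewrite normrM normfV normr_nat.
by apply: ler_wpM2r; rewrite ?invr_ge0.
Qed.

Lemma eq_lognull u v : u =1 v -> lognull u -> lognull v.
Proof. by move=> uv H d d0; apply: eq_logsmall uv _; exact: H. Qed.

Lemma lognull0 : lognull (fun=> 0).
Proof.
move=> d d0; exists 0%N => N _; rewrite /logsum big1 ?normr0.
  by rewrite mulr_ge0 ?(ltW d0) ?lnn_ge0.
by move=> n _; rewrite mul0r.
Qed.

Lemma lognullD u v : lognull u -> lognull v -> lognull (fun n => u n + v n).
Proof.
move=> H1 H2 d d0; have d2 : 0 < d / 2 by rewrite divr_gt0.
by rewrite [d](splitr); apply: logsmallD; [exact: H1|exact: H2].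
Qed.

Lemma lognullZ c u : lognull u -> lognull (fun n => c * u n).
Proof.
move=> H d d0; have c0 : 0 < `|c| + 1 by rewrite ltr_wpDl.
apply: logsmall_le (logsmallZ c (H (d / (`|c| + 1)) _)); last by rewrite divr_gt0.
rewrite mulrA ler_pdivrMr// mulrC; apply: ler_wpM2l; first exact: ltW.
by rewrite lerDl.
Qed.

Lemma lognull_sum (F : nat -> nat -> R) a b :
  (forall j, (a <= j < b)%N -> lognull (F j)) ->
  lognull (fun n => \sum_(a <= j < b) F j n).
Proof.
elim: b => [|b IH] H.
  by apply: eq_lognull lognull0 => n; rewrite big_geq.
have [ab|ba] := leqP a b; last by apply: eq_lognull lognull0 => n; rewrite big_geq.
have Hb : lognull (F b) by apply: H; rewrite ab /=.
have /IH Hs : forall j, (a <= j < b)%N -> lognull (F j).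
  by move=> j /andP[aj jb]; apply: H; rewrite aj ltnW.
by apply: eq_lognull (lognullD Hs Hb) => n; rewrite big_nat_recr.
Qed.

Lemma lognull_bounded C u : (forall N, `|logsum u N| <= C) -> lognull u.
Proof.
move=> H d d0; have [N0 N00 HN0] := ln_unbounded (C / d).
exists N0 => N NN0; apply: le_trans (H N) _.
by have := HN0 _ NN0; rewrite ler_pdivrMr// mulrC.
Qed.

Lemma vanishing_lognull u : vanishing u -> lognull u.
Proof.
move=> H d d0; have d2 : 0 < d / 4 by rewrite divr_gt0.
have [N0 HN0] := H _ d2.
pose C := \sum_(1 <= n < N0.+1) `|u n / n%:R|.
have [N1 N10 HN1] := ln_unbounded (C * 2 / d + 1).
exists (maxn N0 N1) => N; rewrite geq_max => /andP[h0 h1].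
have L := HN1 _ h1.
have C0 : 0 <= C by apply: sumr_ge0.
have L1 : 1 <= ln N%:R :> R by apply: le_trans L; rewrite lerDr divr_ge0 ?mulr_ge0 ?(ltW d0).
have CL : C <= d / 2 * ln N%:R.
  have : C * 2 / d <= ln N%:R by lra.
  by rewrite ler_pdivrMr//; lra.
rewrite /logsum (big_cat_nat (n := N0.+1))//=.
apply: le_trans (ler_normD _ _) _.
have -> : d * ln N%:R = d / 2 * ln N%:R + d / 4 * (2 * ln N%:R) by field.
apply: lerD.
  by apply: le_trans CL; exact: ler_norm_sum.
apply: (@le_trans _ _ (d / 4 * harmonic_sum R N)); last first.
  by apply: ler_wpM2l; [exact: ltW|]; have := harmonic_sum_le R N; lra.
apply: le_trans (ler_norm_sum _ _ _) _.
rewrite /harmonic_sum mulr_sumr [leRHS](big_cat_nat (n := N0.+1))//=.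
rewrite -[leLHS]add0r; apply: lerD.
  by apply: sumr_ge0 => n _; rewrite mulr_ge0 ?(ltW d2)// invr_ge0.
apply: ler_sum_nat => n /andP[hn _]; rewrite normrM normfV normr_nat.
by apply: ler_wpM2r; rewrite ?invr_ge0// HN0// ltnW.
Qed.

Lemma vanishing_le u v : (forall n, `|u n| <= `|v n|) -> vanishing v -> vanishing u.
Proof.
move=> uv H d /H[N0 HN]; exists N0 => n /HN; exact: le_trans.
Qed.

Lemma vanishingD u v : vanishing u -> vanishing v -> vanishing (fun n => u n + v n).
Proof.
move=> H1 H2 d d0; have d2 : 0 < d / 2 by rewrite divr_gt0.
have [N1 HN1] := H1 _ d2; have [N2 HN2] := H2 _ d2.
exists (maxn N1 N2) => N; rewrite geq_max => /andP[h1 h2].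
apply: le_trans (ler_normD _ _) _; rewrite [d]splitr; apply: lerD; [exact: HN1|exact: HN2].
Qed.

Lemma vanishingZ c u : vanishing u -> vanishing (fun n => c * u n).
Proof.
move=> H d d0; have c0 : 0 < `|c| + 1 by rewrite ltr_wpDl.
have [|N0 HN0] := H (d / (`|c| + 1)); first by rewrite divr_gt0.
exists N0 => n /HN0; rewrite normrM ler_pdivlMr// mulrC => h.
by apply: le_trans h; apply: ler_wpM2r => //; rewrite lerDl.
Qed.

Lemma vanishing_shift u m : vanishing u -> vanishing (fun n => u (n + m)%N).
Proof.
move=> H d /H[N0 HN]; exists N0 => n nN; apply: HN; exact: leq_trans (leq_addr _ _).
Qed.

Lemma eq_vanishing u v : u =1 v -> vanishing u -> vanishing v.
Proof. by move=> uv H d /H[N0 HN]; exists N0 => n /HN; rewrite uv. Qed.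

(** Summation by parts: the weights 1 / n decrease, so the logarithmic sums are bounded by 3 C. *)
Lemma lognull_diff C u : (forall n, `|u n| <= C) -> lognull (fun n => u n.+1 - u n).
Proof.
move=> H; have C0 : 0 <= C by exact: le_trans (H 0%N).
have E N : logsum (fun n => u n.+1 - u n) N = u N.+1 / N.+1%:R - u 1%N +
    \sum_(1 <= n < N.+1) u n.+1 * (n%:R^-1 - n.+1%:R^-1).
  rewrite /logsum; elim: N => [|N IH].
    by rewrite !big_geq// invr1 mulr1 subrr addr0.
  rewrite big_nat_recr//= IH [in RHS]big_nat_recr//=; ring.
have T N : \sum_(1 <= n < N.+1) C * (n%:R^-1 - n.+1%:R^-1) <= C.
  rewrite -mulr_sumr (eq_bigr (fun n => - (n.+1%:R^-1) - (- n%:R^-1) : R)).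
    rewrite telescope_sumr// opprK invr1 -[leRHS]mulr1; apply: ler_wpM2l => //.
  by move=> n _; rewrite opprK addrC.
apply: (@lognull_bounded (3 * C)) => N; rewrite E.
apply: le_trans (ler_normD _ _) _; apply: (@le_trans _ _ ((C + C) + C)); last lra.
apply: lerD.
  apply: le_trans (ler_normB _ _) _; apply: lerD => //.
  rewrite normrM -[leRHS]mulr1; apply: ler_pM => //.
  by rewrite normfV normr_nat invf_le1 ?ltr0n// ler1n.
apply: le_trans (ler_norm_sum _ _ _) _; apply: le_trans (T N).
apply: ler_sum_nat => n /andP[n0 _]; rewrite normrM; apply: ler_pM => //.
by rewrite ger0_norm// subr_ge0 lef_pV2 ?posrE ?ltr0n// ler_nat.
Qed.

Lemma lognull_shift C u j : (forall n, `|u n| <= C) ->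
  lognull (fun n => u (n + j)%N - u n).
Proof.
move=> H; elim: j => [|j IH].
  by apply: eq_lognull lognull0 => n; rewrite addn0 subrr.
have := @lognull_diff C (fun n => u (n + j)%N) (fun n => H _).
move=> /lognullD/(_ IH); apply: eq_lognull => n /=.
by rewrite addSnnS addrA subrK.
Qed.

End LogMeans.

(** * The Fejer kernel and van der Corput's inequality for logarithmic means *)

Section VanDerCorput.
Variable R : realType.
Implicit Types (u v f g : nat -> R) (x y t d e C : R) (n m k N K : nat).

Lemma cos_lipschitz x y : `|cos x - cos y| <= `|x - y|.
Proof.
wlog xy : x y / x <= y => [H|].
  by have [/H//|/ltW/H] := leP x y; rewrite distrC [leRHS]distrC.
have D z : z \in `]x, y[%R -> is_derive z 1 (@cos R) (- sin z).
  by move=> _; exact: is_derive_cos.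
have Cc : {within `[x, y], continuous (@cos R)}%classic.
  by apply: continuous_subspaceT => z; exact: continuous_cos.
have [z _ E] := MVT_segment xy D Cc.
rewrite distrC E [leRHS]distrC normrM normrN -[leRHS]mul1r.
by apply: ler_wpM2r => //; exact: sin_max.
Qed.

(* |sum_(j < K) exp (i j t)|^2 *)
Definition dirichlet_sq K t : R :=
  (\sum_(0 <= j < K) cos (j%:R * t)) ^+ 2 + (\sum_(0 <= j < K) sin (j%:R * t)) ^+ 2.

Lemma dirichlet_sqS K t : dirichlet_sq K.+1 t =
  dirichlet_sq K t + 1 + 2 * \sum_(1 <= d < K.+1) cos (d%:R * t).
Proof.
rewrite /dirichlet_sq big_nat_recr//= [X in _ + X ^+ 2 = _]big_nat_recr//=.
have := cos2Dsin2 (K%:R * t).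
have -> : \sum_(1 <= d < K.+1) cos (d%:R * t) =
   (\sum_(0 <= j < K) cos (j%:R * t)) * cos (K%:R * t) +
   (\sum_(0 <= j < K) sin (j%:R * t)) * sin (K%:R * t).
  rewrite !mulr_suml -big_split/= big_add1/= big_nat_rev/= add0n.
  apply: eq_big_nat => j /andP[_ jK].
  have -> : (K - j.+1).+1%:R = K%:R - j%:R :> R by rewrite subnSK// natrB// ltnW.
  by rewrite -cosB -cosN; congr cos; ring.
move: (\sum_(_ <= _ < _) _) (\sum_(_ <= _ < _) _) (cos _) (sin _) => A B c s H.
by lra.
Qed.

(** K times the Fejer kernel; K - d counts the pairs of indices below K at distance d in a given
    order. *)
Lemma dirichlet_sqE K t : dirichlet_sq K t =
  K%:R + 2 * \sum_(1 <= d < K) (K%:R - d%:R) * cos (d%:R * t).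
Proof.
elim: K => [|K IH]; first by rewrite /dirichlet_sq !big_geq// expr0n/= mulr0 addr0.
have E : \sum_(1 <= d < K) (K%:R - d%:R) * cos (d%:R * t) =
    \sum_(1 <= d < K.+1) (K%:R - d%:R) * cos (d%:R * t).
  case: K {IH} => [|K]; first by rewrite !big_geq.
  by rewrite [RHS]big_nat_recr//= subrr mul0r addr0.
rewrite dirichlet_sqS IH E -(natr1 K).
have -> : \sum_(1 <= d < K.+1) (K%:R + 1 - d%:R) * cos (d%:R * t) =
   \sum_(1 <= d < K.+1) (K%:R - d%:R) * cos (d%:R * t) +
   \sum_(1 <= d < K.+1) cos (d%:R * t).
  by rewrite -big_split; apply: eq_bigr => d _ /=; ring.
by ring.
Qed.

Lemma dirichlet_sq_ge0 K t : 0 <= dirichlet_sq K t.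
Proof. by rewrite addr_ge0// sqr_ge0. Qed.

Lemma logsmall_cst C : 0 < C -> logsmall (2 * C) (fun=> C).
Proof.
move=> C0; have [N0 N00 HN0] := ln_unbounded (1 : R).
exists N0 => N /HN0 L1.
have -> : logsum (fun=> C) N = C * harmonic_sum R N by rewrite /logsum /harmonic_sum mulr_sumr.
rewrite normrM gtr0_norm// ger0_norm ?harmonic_sum_ge0//.
rewrite [2 * C]mulrC -mulrA ler_pM2l//.
by have := harmonic_sum_le R N; lra.
Qed.

Lemma logsmall_sum (F : nat -> nat -> R) (D : nat -> R) a b :
  (forall j, (a <= j < b)%N -> logsmall (D j) (F j)) ->
  logsmall (\sum_(a <= j < b) D j) (fun n => \sum_(a <= j < b) F j n).
Proof.
elim: b => [|b IH] H.
  rewrite big_geq//; exists 0%N => N _; rewrite /logsum big1 ?normr0 ?mul0r// => n _.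
  by rewrite big_geq// mul0r.
have [ab|ba] := leqP a b; last first.
  rewrite big_geq//; exists 0%N => N _; rewrite /logsum big1 ?normr0 ?mul0r// => n _.
  by rewrite big_geq// mul0r.
rewrite big_nat_recr//=.
apply: eq_logsmall (logsmallD (IH _) (H b _)) => [n||]; first by rewrite big_nat_recr.
  by move=> j /andP[aj jb]; apply: H; rewrite aj ltnW.
by rewrite ab ltnS leqnn.
Qed.

(** Inserting the bounds C / d into [dirichlet_sqE] gives O(K ln K), which is o(K ^ 2); [ln_small]
    supplies the K. *)
Lemma logsmall_dirichlet_sq g C : 0 <= C ->
  (forall d : nat, (0 < d)%N -> logsmall (C / d%:R) (fun n => cos (d%:R * g n))) ->
  forall t, 0 < t -> exists2 K, (0 < K)%N &
    logsmall (K%:R ^+ 2 * t) (fun n => dirichlet_sq K (g n)).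
Proof.
move=> C0 H t t0; pose e := Num.min 1 (t / (2 + 2 * C)).
have c0 : 0 < 2 + 2 * C by lra.
have e0 : 0 < e by rewrite lt_min ltr01 divr_gt0.
have e1 : e <= 1 by rewrite ge_min lexx.
have et : e * (2 + 2 * C) <= t by rewrite -ler_pdivlMr// ge_min lexx orbT.
pose K := (Num.truncn (25 / e ^+ 2)).+1; exists K => //.
have Kb : 25 / e ^+ 2 <= K%:R by exact/ltW/truncnS_gt.
have KR : 0 < K%:R :> R by rewrite ltr0n.
have := @ln_small R K%:R e; rewrite e0 e1 => /(_ isT Kb) lnK.
have S : logsmall (2 * K%:R + `|2| * \sum_(1 <= d < K) `|K%:R - d%:R| * (C / d%:R))
    (fun n => dirichlet_sq K (g n)).
  apply: eq_logsmall (logsmallD (logsmall_cst KR) (logsmallZ 2 (logsmall_sum _))) => [n|].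
    by rewrite dirichlet_sqE.
  by move=> d /andP[d0 _]; apply: logsmallZ; exact: H.
apply: logsmall_le S; rewrite ger0_norm//.
have : \sum_(1 <= d < K) `|K%:R - d%:R| * (C / d%:R) <= K%:R * (C * (1 + ln K%:R)).
  apply: (@le_trans _ _ (K%:R * (C * harmonic_sum R K))); last first.
    by rewrite ler_wpM2l// ler_wpM2l// harmonic_sum_le.
  rewrite /harmonic_sum mulr_sumr mulr_sumr [leRHS]big_nat_recr//=.
  rewrite -[leLHS]addr0; apply: lerD; last by rewrite !mulr_ge0// invr_ge0.
  apply: ler_sum_nat => d /andP[d0 dK]; apply: ler_wpM2r; first by rewrite divr_ge0.
  rewrite ger0_norm ?subr_ge0 ?ler_nat 1?ltnW//.
  by have : 0 <= d%:R :> R by []; lra.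
move: (\sum_(_ <= _ < _) _) => s h; have l0 := lnn_ge0 R K.
apply: (@le_trans _ _ (K%:R * ((2 + 2 * C) * (2 * ln K%:R + 1)))).
  move: (K%:R) (ln _) KR l0 h => k l k0 l0 h.
  have : 0 <= k * l by rewrite mulr_ge0// ltW.
  have : 0 <= k * C * l by rewrite !mulr_ge0// ltW.
  by lra.
rewrite expr2 -mulrA ler_pM2l//.
apply: (@le_trans _ _ ((2 + 2 * C) * (e * K%:R))); first by rewrite ler_pM2l.
by rewrite mulrA [_ * e]mulrC [leRHS]mulrC ler_wpM2r.
Qed.

Lemma vanishing_drift g j : vanishing (fun n => g n.+1 - g n) ->
  vanishing (fun n => g (n + j)%N - g n).
Proof.
move=> H; elim: j => [|j IH].
  by move=> d d0; exists 0%N => n _; rewrite addn0 subrr normr0 ltW.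
apply: eq_vanishing (vanishingD (vanishing_shift j H) IH) => n /=.
by rewrite addnS addrA subrK.
Qed.

Lemma vanishing_linear f j :
  vanishing (fun n => (f n.+2 - f n.+1) - (f n.+1 - f n)) ->
  vanishing (fun n => f (n + j)%N - (f n + j%:R * (f n.+1 - f n))).
Proof.
move=> H; elim: j => [|j IH].
  by move=> d d0; exists 0%N => n _; rewrite addn0 mul0r addr0 subrr normr0 ltW.
have := vanishingD IH (@vanishing_drift (fun n => f n.+1 - f n) j H).
by apply: eq_vanishing => n /=; rewrite addnS -(natr1 j); ring.
Qed.

(* Averaging over K consecutive n, on which f is almost linear, bounds the mean
   of [cos (f n)] by that of the square root of the normalized Fejer kernel at the
   slope; the O(1 / d) bounds make the latter O(ln K / K). *)
Theorem van_der_corput_log f C : 0 <= C ->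
  vanishing (fun n => (f n.+2 - f n.+1) - (f n.+1 - f n)) ->
  (forall d : nat, (0 < d)%N ->
    logsmall (C / d%:R) (fun n => cos (d%:R * (f n.+1 - f n)))) ->
  lognull (fun n => cos (f n)).
Proof.
move=> C0 Hf Hg d d0; pose g n := f n.+1 - f n.
pose t := d / 4; have t0 : 0 < t by rewrite divr_gt0.
have [K K0 HK] := logsmall_dirichlet_sq C0 Hg (exprn_gt0 2 t0).
have KR : 0 < K%:R :> R by rewrite ltr0n.
pose v n := K%:R^-1 * \sum_(0 <= j < K) cos (f n + j%:R * g n).
(* In place of the Cauchy--Schwarz inequality for means, |w| <= (t ^ 2 + w ^ 2) / (2 t) is used
   pointwise. *)
have Hv : logsmall (t + `|(2 * t * K%:R ^+ 2)^-1| * (K%:R ^+ 2 * t ^+ 2)) v.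
  have HG := logsmallZ (2 * t * K%:R ^+ 2)^-1 HK.
  have Ht : logsmall t (fun=> t / 2).
    rewrite {1}(_ : t = 2 * (t / 2)); last by field.
    by apply: logsmall_cst; rewrite divr_gt0.
  apply: le_logsmall (logsmallD Ht HG) => n.
  have -> : v n = (cos (f n) * (\sum_(0 <= j < K) cos (j%:R * g n)) -
      sin (f n) * \sum_(0 <= j < K) sin (j%:R * g n)) / K%:R.
    rewrite /v mulrC; congr (_ / _); rewrite !mulr_sumr -sumrB.
    by apply: eq_bigr => j _; rewrite cosD.
  rewrite /dirichlet_sq; move: (\sum_(_ <= _ < _) _) (\sum_(_ <= _ < _) _) => B A.
  have := cos2Dsin2 (f n); move: (cos _) (sin _) => c s cs.
  set w := (_ / _).
  have w2 : w ^+ 2 * K%:R ^+ 2 <= A ^+ 2 + B ^+ 2.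
    rewrite -exprMn /w mulfVK ?gt_eqF// -[leRHS]mul1r -cs.
    by have := sqr_ge0 (c * B + s * A); lra.
  rewrite [leRHS](_ : _ = (t ^+ 2 + (A ^+ 2 + B ^+ 2) / K%:R ^+ 2) / (2 * t)); last first.
    by field; rewrite !gt_eqF.
  have t2 : 0 < 2 * t by rewrite mulr_gt0.
  have wq : w ^+ 2 <= (A ^+ 2 + B ^+ 2) / K%:R ^+ 2.
    by rewrite ler_pdivlMr// exprn_gt0.
  rewrite ler_norml -mulNr ler_pdivrMr// ler_pdivlMr//.
  have := sqr_ge0 (w - t); have := sqr_ge0 (w + t).
  move: w (_ / K%:R ^+ 2) wq {w2 HK} => w q h3 h1 h2.
  by apply/andP; split; lra.
(* Two null errors: shifting n by j inside a logarithmic mean, then replacing f (n + j) by its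
   linear model. *)
have Hr j : lognull (fun n => cos (f n) - cos (f n + j%:R * g n)).
  have h1 := lognullZ (-1)
    (@lognull_shift R 1 (fun n => cos (f n)) j (fun n => cos_max (f n))).
  have h2 : lognull (fun n => cos (f (n + j)%N) - cos (f n + j%:R * g n)).
    apply: vanishing_lognull; apply: vanishing_le (vanishing_linear j Hf) => n.
    exact: cos_lipschitz.
  by apply: eq_lognull (lognullD h1 h2) => n /=; ring.
have HR : lognull (fun n => K%:R^-1 * \sum_(0 <= j < K) (cos (f n) - cos (f n + j%:R * g n))).
  by apply: lognullZ; apply: lognull_sum => j _; exact: Hr.
have := logsmallD Hv (HR _ t0).
have -> : `|(2 * t * K%:R ^+ 2)^-1| * (K%:R ^+ 2 * t ^+ 2) = t / 2.
  rewrite gtr0_norm ?invr_gt0 ?mulr_gt0 ?exprn_gt0//.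
  by field; rewrite !gt_eqF.
move=> /(logsmall_le (_ : _ <= d)) H.
apply: eq_logsmall (H _) => [n|]; last by rewrite /t; lra.
rewrite /v -mulrDr -big_split/= (eq_bigr (fun=> cos (f n))); last first.
  by move=> j _; rewrite addrC subrK.
by rewrite sumr_const_nat subn0 -[cos _ *+ K]mulr_natl mulKf// gt_eqF.
Qed.

End VanDerCorput.

(** * Logarithmic means through explicit primitives *)

Section LogMeanMVT.
Variable R : realType.
Implicit Types (x y d e C A B : R) (n m k N K : nat).

(** An approximate primitive of cos (A x + B ln x): the excess B / (A x) tends to 0. *)
Lemma is_derive_sin_linear_ln A B x : A != 0 -> 0 < x ->
  is_derive x 1 (fun x => A^-1 * sin (A * x + B * ln x))
    (cos (A * x + B * ln x) * (1 + B / (A * x))).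
Proof.
move=> A0 x0; have dl := is_derive1_ln x0.
have dt : is_derive x 1 (fun x : R => A * x + B * ln x) (A + B / x).
  by apply: is_derive_eq; rewrite /GRing.scale/= mulr1.
have ds := @is_derive1_comp R sin (fun x => A * x + B * ln x) x _ _ (is_derive_sin _) dt.
have := @is_deriveZ R _ _ _ A^-1 x 1 _ ds.
move=> h; apply: (is_derive_eq h); rewrite /GRing.scale/=.
by field; rewrite A0 gt_eqF.
Qed.

(* The primitive is the real part of x^(1 + i B) / (1 + i B). *)
Lemma is_derive_osc_ln B x : 0 < x ->
  is_derive x 1 (fun x => (1 + B ^+ 2)^-1 * (x * (cos (B * ln x) + B * sin (B * ln x))))
    (cos (B * ln x)).
Proof.
move=> x0; have dl := is_derive1_ln x0.
have dt : is_derive x 1 (fun x : R => B * ln x) (B / x).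
  by apply: is_derive_eq; rewrite /GRing.scale.
have ds := @is_derive1_comp R sin (fun x => B * ln x) x _ _ (is_derive_sin _) dt.
have dc := @is_derive1_comp R cos (fun x => B * ln x) x _ _ (is_derive_cos _) dt.
have d1 : is_derive x 1 (fun x => cos (B * ln x) + B * sin (B * ln x))
   (- sin (B * ln x) * (B / x) + B * (cos (B * ln x) * (B / x))).
  exact: (is_deriveD dc (@is_deriveZ R _ _ _ B x 1 _ ds)).
have d2 := @is_deriveM R _ id _ x 1 _ _ (is_derive_id x 1) d1.
have := @is_deriveZ R _ _ _ (1 + B ^+ 2)^-1 x 1 _ d2.
move=> h; apply: (is_derive_eq h); rewrite /GRing.scale/=.
have B2 : 1 + B ^+ 2 != 0 by rewrite gt_eqF// ltr_pwDl// sqr_ge0.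
by field; rewrite B2 gt_eqF.
Qed.

(** In the variable x = ln n, the step from ln n to ln (n + 1) has length close to 1 / n and D is
    almost c n on it; the mean value theorem compares c n / n with the increment of F. *)
Lemma lognull_mvt (F D : R -> R) (c : nat -> R) :
  (forall x, 0 < x -> is_derive x 1 F (D x)) -> (forall n, `|c n| <= 1) ->
  (forall e, 0 < e -> exists n0, forall n, (n0 <= n)%N ->
    forall x, ln n%:R <= x <= ln n.+1%:R -> `|D x - c n| <= e) ->
  lognull (fun n => c n - n%:R * (F (ln n.+1%:R) - F (ln n%:R))).
Proof.
move=> dF c1 HD; apply: vanishing_lognull => e e0.
have e2 : 0 < e / 2 by rewrite divr_gt0.
have [n0 Hn0] := HD _ e2.
pose n1 := (Num.truncn (2 / e)).+1.
exists (maxn n0 (maxn 2 n1)) => n; rewrite !geq_max => /and3P[h0 h2 h1].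
have np : (0 < n)%N by exact: leq_trans h2.
have n1R : 1 / n%:R <= e / 2.
  rewrite ler_pdivrMr ?ltr0n//.
  have : 2 / e <= n%:R.
    by apply: le_trans (ltW (truncnS_gt _)) _; rewrite ler_nat.
  by rewrite ler_pdivrMr//; lra.
have l0 : 0 < ln n%:R :> R by rewrite ln_gt0// ltr1n.
have ll : ln n%:R <= ln n.+1%:R :> R by rewrite ler_lnn// np /=.
have dFin x : x \in `]ln n%:R, ln n.+1%:R[%R -> is_derive x 1 F (D x).
  by rewrite in_itv/= => /andP[h _]; apply: dF; exact: lt_trans h.
have cF : {within `[ln n%:R, ln n.+1%:R], continuous F}%classic.
  apply: derivable_within_continuous => x; rewrite in_itv/= => /andP[h _].
  by have := dF x (lt_le_trans l0 h); case.
have [x xin ->] := MVT_segment ll dFin cF.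
rewrite in_itv/= in xin; have := Hn0 _ h0 x xin.
have := @lnSB_le R n np; have := @lnSB_ge R n np; have := c1 n.
have nR : 0 < n%:R :> R by rewrite ltr0n.
move: (ln n.+1%:R - _) => dl; rewrite -natr1.
have v0 : 0 < (n%:R + 1)^-1 :> R by rewrite invr_gt0; lra.
have vE : n%:R * (n%:R + 1)^-1 = 1 - (n%:R + 1)^-1 :> R by field; rewrite gt_eqF//; lra.
have vw : (n%:R + 1)^-1 <= 1 / n%:R :> R by rewrite mul1r lef_pV2 ?posrE//; lra.
move: (n%:R) nR ((n%:R + 1)^-1) v0 vE vw n1R => t t0 v v0 vE vw n1R hc h3 h4 hD.
have tl1 : t * dl <= 1 by rewrite -(mulfV (lt0r_neq0 t0)) ler_pM2l.
have tl2 : 1 - v <= t * dl by rewrite -vE ler_pM2l.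
have -> : c n - t * (D x * dl) = c n * (1 - t * dl) - (t * dl) * (D x - c n) by ring.
apply: le_trans (ler_normB _ _) _; rewrite (normrM (c n)) (normrM (t * dl)).
have v1 : v <= 1 by have : 0 <= t * v by [rewrite mulr_ge0// ltW]; lra.
rewrite (@ger0_norm _ (1 - _)) ?(@ger0_norm _ (t * dl)); try lra.
have : `|c n| * (1 - t * dl) <= 1 * v by apply: ler_pM => //; lra.
have : t * dl * `|D x - c n| <= 1 * (e / 2) by apply: ler_pM => //; lra.
have := le_trans vw n1R; clear; move: (t * dl * _) (`|c n| * _) => a b; lra.
Qed.

(** The increments of F telescope to F (ln (N + 1)) - F (ln 1), so linear growth of F bounds the
    means of c. *)
Lemma logsmall_mvt (F D : R -> R) (c : nat -> R) C :
  (forall x, 0 < x -> is_derive x 1 F (D x)) -> (forall n, `|c n| <= 1) ->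
  (forall e, 0 < e -> exists n0, forall n, (n0 <= n)%N ->
    forall x, ln n%:R <= x <= ln n.+1%:R -> `|D x - c n| <= e) ->
  0 < C -> F 0 = 0 -> (forall x, 1 <= x -> `|F x| <= C * x) ->
  logsmall (3 * C) c.
Proof.
move=> dF c1 HD C0 F0 FC; have H := lognull_mvt dF c1 HD.
have S : logsmall (2 * C) (fun n => n%:R * (F (ln n.+1%:R) - F (ln n%:R))).
  have [N0 N00 HN0] := ln_unbounded (1 : R).
  exists (maxn N0 1) => N; rewrite geq_max => /andP[h0 h1].
  have -> : logsum (fun n => n%:R * (F (ln n.+1%:R) - F (ln n%:R))) N = F (ln N.+1%:R).
    rewrite /logsum big_nat (eq_bigr (fun n => F (ln n.+1%:R) - F (ln n%:R))); last first.
      by move=> n /andP[n0 _]; rewrite mulrC mulKf// pnatr_eq0 -lt0n.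
    by rewrite -big_nat (telescope_sumr (fun n => F (ln n%:R)))// ln1 F0 subr0.
  have LS : ln N%:R <= ln N.+1%:R :> R by rewrite ler_lnn// h1 /=.
  apply: le_trans (FC _ (le_trans (HN0 _ h0) LS)) _.
  rewrite [2 * C]mulrC -mulrA ler_pM2l//.
  have := @lnSB_le R N h1; have := HN0 _ h0.
  have : N%:R^-1 <= 1 :> R by rewrite invf_le1 ?ltr0n ?ler1n.
  by lra.
rewrite (_ : 3 * C = 2 * C + C); last by ring.
by apply: eq_logsmall (logsmallD S (H _ C0)) => n; rewrite addrC subrK.
Qed.

End LogMeanMVT.

(** * Cosine means for factorials and primorials *)

Section WeylSums.
Variable R : realType.
Implicit Types (x y d e C A B : R) (n m k N K : nat).

Lemma ln_window n x : 1 <= ln n%:R :> R -> ln n%:R <= x <= ln n.+1%:R ->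
  0 <= x - ln n%:R <= (ln n%:R)^-1 /\ 0 <= ln x - ln (ln n%:R) <= (ln n%:R)^-1.
Proof.
move=> l1 /andP[x1 x2].
have np : (0 < n)%N by case: n l1 {x1 x2} => // ; rewrite ln0//; lra.
have l0 : 0 < ln n%:R :> R by lra.
have h : x - ln n%:R <= (ln n%:R)^-1.
  have : n%:R^-1 <= (ln n%:R)^-1 :> R by rewrite lef_pV2 ?posrE ?ltr0n// lnn_le.
  by have := @lnSB_le R n np; lra.
split; apply/andP; split => //; first lra.
  by rewrite subr_ge0 ler_ln ?posrE//; lra.
apply: le_trans (lnB_le l0 _) _; first lra.
rewrite ler_pdivrMr//; apply: le_trans h _.
by rewrite mulVf ?gt_eqF// invf_le1.
Qed.

Lemma ln_ge_large C e : 0 < e -> exists n0, forall n, (n0 <= n)%N ->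
  1 <= ln n%:R :> R /\ C * (ln n%:R)^-1 <= e.
Proof.
move=> e0; have [n0 _ H] := ln_unbounded (Num.max 1 (C / e)).
exists n0 => n /H; rewrite ge_max => /andP[l1]; rewrite ler_pdivrMr// => h.
have l0 : 0 < ln n%:R :> R by lra.
by split => //; rewrite ler_pdivrMr// mulrC.
Qed.

(** The approximate primitive is bounded by 1 / |A|. The resulting estimate is uniform in B, which
    is multiplied by d together with A when it is applied. *)
Lemma logsmall_cos_ln A B : A != 0 ->
  logsmall (3 * `|A|^-1) (fun n => cos (A * ln n%:R + B * ln (ln n%:R))).
Proof.
move=> A0; have An : 0 < `|A| by rewrite normr_gt0.
apply: (@logsmall_mvt R _ _ _ _ (fun x => is_derive_sin_linear_ln B A0)).
- by move=> n; exact: cos_max.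
- move=> e e0; have [n0 H] := ln_ge_large (`|A| + `|B| + `|B / A|) e0.
  exists n0 => n /H[l1 le] x xin; have [/andP[h1 h2] /andP[h3 h4]] := ln_window l1 xin.
  apply: le_trans le; move/andP: xin => [lx _]; have x0 : 0 < x by lra.
  have -> : cos (A * x + B * ln x) * (1 + B / (A * x)) -
      cos (A * ln n%:R + B * ln (ln n%:R)) =
    (cos (A * x + B * ln x) - cos (A * ln n%:R + B * ln (ln n%:R))) +
    cos (A * x + B * ln x) * (B / A / x) by field; rewrite A0 gt_eqF.
  apply: le_trans (ler_normD _ _) _; rewrite [leRHS]mulrDl; apply: lerD.
    apply: le_trans (cos_lipschitz _ _) _.
    have -> : A * x + B * ln x - (A * ln n%:R + B * ln (ln n%:R)) =
      A * (x - ln n%:R) + B * (ln x - ln (ln n%:R)) by ring.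
    apply: le_trans (ler_normD _ _) _; rewrite mulrDl !normrM.
    by apply: lerD; apply: ler_wpM2l => //; rewrite ger0_norm.
  rewrite normrM -[leRHS]mul1r; apply: ler_pM => //; first exact: cos_max.
  rewrite normrM; apply: ler_wpM2l => //; rewrite normfV gtr0_norm//.
  by rewrite lef_pV2 ?posrE//; lra.
- by rewrite invr_gt0.
- by rewrite ln0// !mulr0 addr0 sin0 mulr0.
- move=> x x1; rewrite normrM normfV; apply: ler_wpM2l; first by rewrite invr_ge0.
  exact: le_trans (sin_max _) x1.
Qed.

(** The primitive is at most x (1 + |B|) / (1 + B ^ 2) <= 2 x / |B|. The means do oscillate, with
    amplitude of order 1 / |B| for large |B|. *)
Lemma logsmall_cos_lnln B : B != 0 ->
  logsmall (6 * `|B|^-1) (fun n => cos (B * ln (ln n%:R))).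
Proof.
move=> B0; have Bn : 0 < `|B| by rewrite normr_gt0.
have B2 : 0 < 1 + B ^+ 2 by rewrite ltr_pwDl// sqr_ge0.
rewrite (_ : 6 * `|B|^-1 = 3 * (2 * `|B|^-1)); last by ring.
apply: (@logsmall_mvt R _ _ _ _ (is_derive_osc_ln B)).
- by move=> n; exact: cos_max.
- move=> e e0; have [n0 H] := ln_ge_large `|B| e0.
  exists n0 => n /H[l1 le] x xin; have [_ /andP[h3 h4]] := ln_window l1 xin.
  apply: le_trans le; apply: le_trans (cos_lipschitz _ _) _.
  by rewrite -mulrBr normrM; apply: ler_wpM2l => //; rewrite ger0_norm.
- by rewrite mulr_gt0// invr_gt0.
- by rewrite mul0r mulr0.
- move=> x x1; have x0 : 0 < x by lra.
  rewrite normrM normrM (gtr0_norm x0) gtr0_norm ?invr_gt0//.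
  rewrite mulrCA mulrC [_^-1 * _]mulrC; apply: ler_wpM2r; first exact: ltW.
  rewrite ler_pdivrMr//; apply: (@le_trans _ _ (1 + `|B|)).
    apply: le_trans (ler_normD _ _) _; apply: lerD; first exact: cos_max.
    by rewrite normrM ler_piMr// sin_max.
  rewrite mulrAC ler_pdivlMr// -(real_normK (num_real B)).
  by have := sqr_ge0 (`|B| - 1); nra.
Qed.

Lemma vanishing_lnS : vanishing (fun n => ln n.+1%:R - ln n%:R : R).
Proof.
move=> e e0; have [n0 H] := ln_ge_large 1 e0; exists n0 => n /H[l1 le].
have h : ln (n%:R : R) <= ln (n.+1%:R : R) <= ln (n.+1%:R : R).
  apply/andP; split => //; case: n {l1 le} => [|n]; first by rewrite ln0// ln1.
  by apply: ler_lnn; rewrite leqnSn.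
have [/andP[h1 h2] _] := ln_window l1 h.
by rewrite ger0_norm//; lra.
Qed.

Lemma vanishing_lnlnS : vanishing (fun n => ln (ln n.+1%:R) - ln (ln n%:R) : R).
Proof.
move=> e e0; have [n0 H] := ln_ge_large 1 e0; exists n0 => n /H[l1 le].
have h : ln (n%:R : R) <= ln (n.+1%:R : R) <= ln (n.+1%:R : R).
  apply/andP; split => //; case: n {l1 le} => [|n]; first by rewrite ln0// ln1.
  by apply: ler_lnn; rewrite leqnSn.
have [_ /andP[h1 h2]] := ln_window l1 h.
by rewrite ger0_norm//; lra.
Qed.

Lemma primorialS n : primorial n.+1 = (primorial n * nth_prime n.+1)%N.
Proof. by rewrite /primorial big_nat_recr. Qed.

Lemma nth_prime_gt0 n : (0 < nth_prime n)%N.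
Proof. exact: leq_trans (ltn_nth_prime n). Qed.

Lemma primorial_gt0 n : (0 < primorial n)%N.
Proof. by rewrite prodn_gt0// => i; exact: nth_prime_gt0. Qed.

Theorem weyl_factorial_primorial A B c : (A != 0) || (B != 0) ->
  lognull (fun n => cos (A * ln n`!%:R + B * ln (primorial n)%:R + c)).
Proof.
move=> AB; pose f n := A * ln n`!%:R + B * ln (primorial n)%:R + c.
pose G n : R := (A + B) * ln n%:R + B * ln (ln n%:R).
have fE n : f n.+1 - f n = A * ln n.+1%:R + B * ln (nth_prime n.+1)%:R.
  rewrite /f factS primorialS !natrM.
  rewrite !lnM ?posrE ?ltr0n ?fact_gt0 ?primorial_gt0 ?nth_prime_gt0//.
  by ring.
have vP : vanishing (fun n => ln (nth_prime n)%:R - (ln n%:R + ln (ln n%:R)) : R).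
  by move=> e /nth_prime_ln_asymptotic.
have vr : vanishing (fun n => (f n.+1 - f n) - G n).
  have h1 := vanishingZ B (vanishing_shift 1 vP).
  have h2 := vanishingZ (A + B) vanishing_lnS.
  have h3 := vanishingZ B vanishing_lnlnS.
  apply: eq_vanishing (vanishingD h1 (vanishingD h2 h3)) => n /=.
  by rewrite fE /G addn1; ring.
have vG : vanishing (fun n => G n.+1 - G n).
  apply: eq_vanishing (vanishingD (vanishingZ (A + B) vanishing_lnS)
    (vanishingZ B vanishing_lnlnS)) => n /=.
  by rewrite /G; ring.
have vf : vanishing (fun n => (f n.+2 - f n.+1) - (f n.+1 - f n)).
  have h1 := vanishingD (vanishing_shift 1 vr) (vanishingZ (-1) vr).
  apply: eq_vanishing (vanishingD h1 vG) => n /=.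
  by rewrite addn1; ring.
have [C C0 HC] : exists2 C, 0 <= C & forall d : nat, (0 < d)%N ->
    logsmall (C / d%:R) (fun n => cos (d%:R * G n)).
  have [AB0|AB0] := eqVneq (A + B) 0.
    have B0 : B != 0.
      by apply/negP => /eqP B0; move: AB AB0; rewrite B0 eqxx orbF addr0 => /negP h /eqP.
    exists (6 * `|B|^-1); first by rewrite mulr_ge0// invr_ge0.
    move=> d d0; have dB : d%:R * B != 0 by rewrite mulf_neq0// pnatr_eq0 -lt0n.
    apply: logsmall_le (eq_logsmall _ (logsmall_cos_lnln dB)).
      by rewrite normrM normr_nat invfM mulrCA [leRHS]mulrC.
    by move=> n; rewrite /G AB0 mul0r add0r mulrA.
  exists (3 * `|A + B|^-1); first by rewrite mulr_ge0// invr_ge0.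
  move=> d d0; have dB : d%:R * (A + B) != 0 by rewrite mulf_neq0// pnatr_eq0 -lt0n.
  apply: logsmall_le (eq_logsmall _ (logsmall_cos_ln (d%:R * B) dB)).
    by rewrite normrM normr_nat invfM mulrCA [leRHS]mulrC.
  by move=> n; rewrite /G; congr cos; ring.
(* The additional 1 / d absorbs the passage from [G n] to the true increment of f, a null error for
   each d. *)
apply: (@van_der_corput_log R f (C + 1)) => //; first by rewrite addr_ge0.
move=> d d0; have dR : 0 < d%:R^-1 :> R by rewrite invr_gt0 ltr0n.
have v : lognull (fun n => cos (d%:R * (f n.+1 - f n)) - cos (d%:R * G n)).
  apply: vanishing_lognull; apply: vanishing_le (vanishingZ d%:R vr) => n /=.
  by have := cos_lipschitz (d%:R * (f n.+1 - f n)) (d%:R * G n); rewrite -mulrBr.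
rewrite mulrDl mul1r.
by apply: eq_logsmall (logsmallD (HC d d0) (v _ dR)) => n; rewrite addrC subrK.
Qed.

End WeylSums.

(** * From exponential sums to leading digits *)

Section FejerPartition.
Variable R : realType.
Implicit Types (x y z t d e c C A B : R) (n m k l N K : nat).

(** The phase phi serves twice: phi = 0 gives the cosine sum of the kernel and phi = - pi / 2 its
    sine sum. *)
Lemma telescope_cos_sum (phi h : R) K :
  2 * sin h * \sum_(0 <= j < K) cos (phi + j%:R * (2 * h)) =
  sin (phi + (2 * K%:R - 1) * h) - sin (phi - h).
Proof.
have sub : phi - h = phi + (2 * 0%:R - 1) * h by ring.
rewrite sub mulr_sumr.
rewrite -(telescope_sumr (fun j => sin (phi + (2 * j%:R - 1) * h)) (leq0n K)).
apply: eq_bigr => j _; rewrite -(natr1 j).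
have -> : phi + (2 * (j%:R + 1) - 1) * h = (phi + j%:R * (2 * h)) + h by ring.
have -> : phi + (2 * j%:R - 1) * h = (phi + j%:R * (2 * h)) - h by ring.
by rewrite sinD sinB; ring.
Qed.

(** The product equals sin (K t / 2) ^ 2; bounding the cosine and sine sums separately gives 2,
    which is enough. *)
Lemma dirichlet_sq_far K t : dirichlet_sq K t * sin (t / 2) ^+ 2 <= 2.
Proof.
have E1 := telescope_cos_sum 0 (t / 2) K.
have E2 := telescope_cos_sum (- (pi / 2)) (t / 2) K.
have tE : 2 * (t / 2) = t by field.
rewrite tE in E1 E2.
have E3 : \sum_(0 <= j < K) cos (- (pi / 2) + j%:R * t) = \sum_(0 <= j < K) sin (j%:R * t).
  by apply: eq_bigr => j _; rewrite addrC cosBpihalf.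
have E0 : \sum_(0 <= j < K) cos (0 + j%:R * t) = \sum_(0 <= j < K) cos (j%:R * t).
  by apply: eq_bigr => j _; rewrite add0r.
rewrite E3 in E2; rewrite E0 in E1; move: E1 E2.
have H (u v : R) : -2 <= sin u - sin v <= 2.
  have := sin_le1 u; have := sin_le1 v; have := sin_geN1 u; have := sin_geN1 v.
  by move=> *; apply/andP; split; lra.
set p := (sin _ - _); set q := (sin _ - sin (- (pi / 2) - _)).
have p2 : -2 <= p <= 2 by exact: H.
have q2 : -2 <= q <= 2 by exact: H.
rewrite /dirichlet_sq; move: (\sum_(_ <= _ < _) _) (\sum_(_ <= _ < _) _) => B A.
move: (sin (t / 2)) p q p2 q2 => s p q /andP[p1 p2] /andP[q1 q2] h1 h2.
have p3 : p ^+ 2 <= 4 by nra.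
have q3 : q ^+ 2 <= 4 by nra.
by rewrite -h1 in p3; rewrite -h2 in q3; lra.
Qed.

(** Over K equally spaced nodes each frequency 0 < d < K sums to zero, so only the constant term K
    survives, K times. *)
Lemma sum_dirichlet_sq_shift K t : (0 < K)%N ->
  \sum_(0 <= m < K) dirichlet_sq K (t - m%:R * (2 * (pi / K%:R))) = K%:R ^+ 2.
Proof.
move=> K0; have KR : K%:R != 0 :> R by rewrite pnatr_eq0 -lt0n.
under eq_bigr do rewrite dirichlet_sqE.
rewrite big_split/= sumr_const_nat subn0 -[K%:R *+ K]mulr_natr -expr2.
rewrite -mulr_sumr exchange_big/= big_nat big1 ?mulr0 ?addr0// => d /andP[d0 dK].
rewrite -mulr_sumr.
pose h : R := - (d%:R * (pi / K%:R)).
rewrite (eq_bigr (fun m => cos (d%:R * t + m%:R * (2 * h)))); last first.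
  by move=> m _; congr cos; rewrite /h; ring.
have := telescope_cos_sum (d%:R * t) h K.
have -> : sin (d%:R * t + (2 * K%:R - 1) * h) = sin (d%:R * t - h).
  rewrite -(periodicn (@sinD2pi R) d); congr sin.
  by rewrite /h; field.
rewrite subrr => /eqP; rewrite mulf_eq0 => /orP[|/eqP ->]; last by rewrite mulr0.
have : 0 < sin (- h).
  apply: sin_gt0_pi; rewrite /h opprK; apply/andP; split.
    by rewrite mulr_gt0 ?divr_gt0 ?pi_gt0 ?ltr0n.
  rewrite mulrCA gtr_pMr ?pi_gt0// ltr_pdivrMr ?ltr0n// mul1r ltr_nat//.
by rewrite sinN oppr_gt0 => h0; rewrite mulf_eq0 pnatr_eq0/= lt_eqF.
Qed.

End FejerPartition.

(** * Lower logarithmic densities and the joint kernel *)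

Section BoxLowerBound.
Variable R : realType.
Implicit Types (x y z t d e c C A B : R) (n m k l N K : nat) (u v : nat -> R).

Lemma sin_sq_far z d : 0 < d <= 1 / 2 -> 0 <= z ->
  (forall k, d <= `|z - k%:R|) -> sin (pi * d) ^+ 2 <= sin (pi * z) ^+ 2.
Proof.
move=> /andP[d0 d1] z0 H; pose k := Num.truncn z; pose r := z - k%:R.
have kz : k%:R <= z by rewrite truncn_le.
have zk : z < k%:R + 1 by rewrite natr1 truncnS_gt.
have dr : d <= r by have := H k; rewrite ger0_norm// subr_ge0.
have dr1 : r <= 1 - d.
  have := H k.+1; rewrite -(natr1 k) ltr0_norm; last by rewrite subr_lt0.
  by rewrite /r; lra.
have -> : sin (pi * z) ^+ 2 = sin (pi * r) ^+ 2.
  have -> : pi * z = pi * r + pi *+ k by rewrite /r -mulr_natr; ring.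
  by rewrite (alternatingn (@sinDpi R)) exprMn sqrr_sign mul1r.
rewrite !sin2cos2 lerD2l lerN2.
have pi0 := @pi_gt0 R.
have h1 : cos (pi * r) <= cos (pi * d).
  move: dr; rewrite le_eqVlt => /predU1P[->//|dr]; apply/ltW.
  by rewrite ltr_cos ?ltr_pM2l// in_itv/=; apply/andP; split; nra.
have h2 : - cos (pi * d) <= cos (pi * r).
  have -> : - cos (pi * d) = cos (pi * (1 - d)).
    by rewrite mulrBr mulr1 cosB cospi sinpi mul0r addr0 mulN1r.
  move: dr1; rewrite le_eqVlt => /predU1P[->//|dr1]; apply/ltW.
  by rewrite ltr_cos ?ltr_pM2l// in_itv/=; apply/andP; split; nra.
by nra.
Qed.

(* Only lower densities are estimated: the 81 pairs of digits are disjoint events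
   whose expected densities add up to 1, so lower bounds force equality. *)
Definition loglower d u : Prop := forall e, 0 < e -> exists N0, forall N, (N0 <= N)%N ->
  (d - e) * ln N%:R <= logsum u N.

Lemma loglower_lognull d u : lognull (fun n => u n - d) -> loglower d u.
Proof.
move=> H e e0; have e2 : 0 < e / 2 by rewrite divr_gt0.
have [N0 HN0] := H _ e2; have [N1 N10 HN1] := ln_unbounded (2 * `|d| / e).
exists (maxn N0 N1) => N; rewrite geq_max => /andP[/HN0 h0 /HN1 h1].
have E : logsum u N = logsum (fun n => u n - d) N + d * harmonic_sum R N.
  rewrite /logsum /harmonic_sum mulr_sumr -big_split/=; apply: eq_bigr => n _.
  by rewrite mulrBl subrK.
rewrite E; move: h0 h1; rewrite ler_norml ler_pdivrMr// => /andP[h0 _] h1.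
have H1 := harmonic_sum_le R N.
have H2 : ln N%:R <= harmonic_sum R N.
  apply: le_trans (harmonic_sum_ge _ _); case: N {E h0 h1 H1} => [|N].
    by rewrite ln0// ln1.
  by apply: ler_lnn; rewrite leqnSn.
have : - `|d| <= d * (harmonic_sum R N - ln N%:R).
  rewrite lerNl -mulNr; apply: le_trans (ler_norm _) _; rewrite normrM normrN.
  by rewrite ler_piMr// ger0_norm; lra.
by lra.
Qed.

Lemma le_loglower d u v : (forall n, (0 < n)%N -> u n <= v n) ->
  loglower d u -> loglower d v.
Proof.
move=> uv H e /H[N0 HN0]; exists N0 => N /HN0 h; apply: le_trans h _.
apply: ler_sum_nat => n /andP[n0 _]; apply: ler_wpM2r; first by rewrite invr_ge0.
exact: uv.
Qed.

Lemma loglower_approx d u : (forall e, 0 < e -> loglower (d - e) u) -> loglower d u.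
Proof.
move=> H e e0; have e2 : 0 < e / 2 by rewrite divr_gt0.
have [N0 HN0] := H _ e2 _ e2; exists N0 => N /HN0; apply: le_trans.
by apply: ler_wpM2r; rewrite ?lnn_ge0//; lra.
Qed.

Lemma loglower_monotone d d' u : d <= d' -> loglower d' u -> loglower d u.
Proof.
move=> dd' H e /H[N0 HN0]; exists N0 => N /HN0; apply: le_trans.
by apply: ler_wpM2r; rewrite ?lnn_ge0// lerD2r.
Qed.

Lemma loglowerD d d' u v : loglower d u -> loglower d' v ->
  loglower (d + d') (fun n => u n + v n).
Proof.
move=> H1 H2 e e0; have e2 : 0 < e / 2 by rewrite divr_gt0.
have [N1 HN1] := H1 _ e2; have [N2 HN2] := H2 _ e2.
exists (maxn N1 N2) => N; rewrite geq_max => /andP[/HN1 h1 /HN2 h2].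
have -> : logsum (fun n => u n + v n) N = logsum u N + logsum v N.
  by rewrite /logsum -big_split/=; apply: eq_bigr => n _; rewrite mulrDl.
by lra.
Qed.

Lemma loglower_sum (I : Type) (r : seq I) (P : pred I) (D : I -> R) (F : I -> nat -> R) :
  (forall i, P i -> loglower (D i) (F i)) ->
  loglower (\sum_(i <- r | P i) D i) (fun n => \sum_(i <- r | P i) F i n).
Proof.
move=> H; elim: r => [|i r IH].
  rewrite big_nil; apply: loglower_lognull; apply: eq_lognull (@lognull0 R) => n.
  by rewrite big_nil subrr.
rewrite big_cons; case: ifP => Pi.
  apply: le_loglower (loglowerD (H _ Pi) IH) => n _.
  by rewrite big_cons Pi.
by apply: le_loglower IH => n _; rewrite big_cons Pi.
Qed.

(** The product of this constant with ln x is 2 pi log10 x, an angle that determines the leading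
    digit of x. *)
Definition two_pi_log10 : R := 2 * pi / ln 10.
Local Notation W := two_pi_log10.

Lemma two_pi_log10_neq0 : W != 0.
Proof. by rewrite gt_eqF// divr_gt0 ?mulr_gt0 ?pi_gt0 ?ln_gt0// ltr1n. Qed.

(** The constant terms multiply to K ^ 2. Every other term is a cosine of d a, of l b, or a product
    that splits into cosines of d a + l b and d a - l b; the difference with d = l is the case A + B
    = 0. *)
Lemma lognull_dirichlet_sqM K x y : lognull (fun n =>
  dirichlet_sq K (W * ln n`!%:R - x) * dirichlet_sq K (W * ln (primorial n)%:R - y)
  - K%:R ^+ 2).
Proof.
pose a n := W * ln n`!%:R - x; pose b n := W * ln (primorial n)%:R - y.
have nz (d : nat) : (1 <= d < K)%N -> d%:R * W != 0.
  by move=> /andP[d0 _]; rewrite mulf_neq0 ?two_pi_log10_neq0// pnatr_eq0 -lt0n.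
have Ha (d : nat) : (1 <= d < K)%N -> lognull (fun n => cos (d%:R * a n)).
  move=> /nz dW.
  have : lognull (fun n => cos (d%:R * W * ln n`!%:R + 0 * ln (primorial n)%:R - d%:R * x)).
    by apply: weyl_factorial_primorial; rewrite dW.
  by apply: eq_lognull => n; congr cos; rewrite /a; ring.
have Hb (d : nat) : (1 <= d < K)%N -> lognull (fun n => cos (d%:R * b n)).
  move=> /nz dW.
  have : lognull (fun n => cos (0 * ln n`!%:R + d%:R * W * ln (primorial n)%:R - d%:R * y)).
    by apply: weyl_factorial_primorial; rewrite dW orbT.
  by apply: eq_lognull => n; congr cos; rewrite /b; ring.
have Hab (d l : nat) : (1 <= d < K)%N -> (1 <= l < K)%N ->
    lognull (fun n => cos (d%:R * a n) * cos (l%:R * b n)).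
  move=> /nz dW /nz lW.
  have h1 : lognull (fun n => cos (d%:R * W * ln n`!%:R + l%:R * W * ln (primorial n)%:R
     + (- d%:R * x - l%:R * y))).
    by apply: weyl_factorial_primorial; rewrite dW.
  have h2 : lognull (fun n => cos (d%:R * W * ln n`!%:R + (- (l%:R * W)) * ln (primorial n)%:R
     + (- d%:R * x + l%:R * y))).
    by apply: weyl_factorial_primorial; rewrite dW.
  apply: eq_lognull (lognullZ 2^-1 (lognullD h1 h2)) => n.
  have -> : d%:R * W * ln n`!%:R + l%:R * W * ln (primorial n)%:R
     + (- d%:R * x - l%:R * y) = d%:R * a n + l%:R * b n by rewrite /a /b; ring.
  have -> : d%:R * W * ln n`!%:R + (- (l%:R * W)) * ln (primorial n)%:R
     + (- d%:R * x + l%:R * y) = d%:R * a n - l%:R * b n by rewrite /a /b; ring.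
  by rewrite cosD cosB; field.
have S1 : lognull (fun n => \sum_(1 <= d < K) (K%:R - d%:R) * cos (d%:R * a n)).
  by apply: lognull_sum => d dK; apply: lognullZ; exact: Ha.
have S2 : lognull (fun n => \sum_(1 <= d < K) (K%:R - d%:R) * cos (d%:R * b n)).
  by apply: lognull_sum => d dK; apply: lognullZ; exact: Hb.
have S3 : lognull (fun n => (\sum_(1 <= d < K) (K%:R - d%:R) * cos (d%:R * a n)) *
    (\sum_(1 <= l < K) (K%:R - l%:R) * cos (l%:R * b n))).
  have : lognull (fun n => \sum_(1 <= d < K) \sum_(1 <= l < K)
      ((K%:R - d%:R) * (K%:R - l%:R)) * (cos (d%:R * a n) * cos (l%:R * b n))).
    apply: lognull_sum => d dK; apply: lognull_sum => l lK.
    by apply: lognullZ; exact: Hab.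
  apply: eq_lognull => n; rewrite mulr_suml; apply: eq_bigr => d _.
  by rewrite mulr_sumr; apply: eq_bigr => l _; ring.
have := lognullD (lognullD (lognullZ (2 * K%:R) S1) (lognullZ (2 * K%:R) S2)) (lognullZ 4 S3).
by apply: eq_lognull => n; rewrite !dirichlet_sqE -/(a n) -/(b n); ring.
Qed.

End BoxLowerBound.

Section BoxDensity.
Variable R : realType.
Implicit Types (x y z t d e c s : R) (n m k l N K lo hi : nat) (u v : nat -> R).
Local Notation W := (two_pi_log10 R).

(** A smoothed indicator of the arc [lo / K, hi / K[ for t / (2 pi) modulo 1. *)
Definition fejer_sum K lo hi t : R :=
  (\sum_(lo <= m < hi) dirichlet_sq K (t - m%:R * (2 * (pi / K%:R)))) / K%:R ^+ 2.

Lemma fejer_sum_bounds K lo hi t : (0 < K)%N -> (hi <= K)%N ->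
  0 <= fejer_sum K lo hi t <= 1.
Proof.
move=> K0 hiK; have KR : 0 < K%:R ^+ 2 :> R by rewrite exprn_gt0 ?ltr0n.
have G0 m : 0 <= dirichlet_sq K (t - m%:R * (2 * (pi / K%:R))) by exact: dirichlet_sq_ge0.
apply/andP; split; first by rewrite divr_ge0 ?sumr_ge0// ltW.
rewrite ler_pdivrMr// mul1r -(sum_dirichlet_sq_shift t K0).
have [lohi|hilo] := leqP lo hi; last by rewrite big_geq ?sumr_ge0// ltnW.
rewrite [leRHS](big_cat_nat (n := lo))//=; last exact: leq_trans hiK.
rewrite [X in _ <= _ + X](big_cat_nat (n := hi))//= addrCA lerDl.
by rewrite addr_ge0// sumr_ge0.
Qed.

Lemma fejer_sum_far K lo hi x s : (0 < K)%N -> (hi <= K)%N -> 0 < s ->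
  (forall m, (lo <= m < hi)%N -> s <= sin (pi * (x - m%:R / K%:R)) ^+ 2) ->
  fejer_sum K lo hi (2 * pi * x) <= 2 / (s * K%:R).
Proof.
move=> K0 hiK s0 H; have KR : 0 < K%:R :> R by rewrite ltr0n.
rewrite /fejer_sum ler_pdivrMr ?exprn_gt0//.
apply: (@le_trans _ _ (\sum_(lo <= m < hi) 2 / s)); last first.
  rewrite sumr_const_nat -[leLHS]mulr_natr.
  have -> : 2 / (s * K%:R) * K%:R ^+ 2 = 2 / s * K%:R by field; rewrite !gt_eqF.
  apply: ler_wpM2l; first by rewrite divr_ge0// ltW.
  by rewrite ler_nat; exact: leq_trans (leq_subr _ _) hiK.
apply: ler_sum_nat => m mh; rewrite ler_pdivlMr//.
apply: le_trans (dirichlet_sq_far K (2 * pi * x - m%:R * (2 * (pi / K%:R)))).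
apply: ler_wpM2l; first exact: dirichlet_sq_ge0.
apply: le_trans (H m mh) _; rewrite le_eqVlt; apply/orP; left; apply/eqP.
by congr (sin _ ^+ 2); field; rewrite gt_eqF.
Qed.

(* The nodes [m / K] lie well inside the interval defining P (resp. Q), so the
   truncated Fejer sums are at most 1 on P and tiny off P. *)
Lemma loglower_box (P Q : pred nat) K lo hi lo' hi' s :
  (0 < K)%N -> (hi <= K)%N -> (hi' <= K)%N -> 0 < s ->
  (forall n m, ~~ P n -> (lo <= m < hi)%N ->
     s <= sin (pi * (ln n`!%:R / ln 10 - m%:R / K%:R)) ^+ 2) ->
  (forall n m, ~~ Q n -> (lo' <= m < hi')%N ->
     s <= sin (pi * (ln (primorial n)%:R / ln 10 - m%:R / K%:R)) ^+ 2) ->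
  loglower ((hi - lo)%:R / K%:R * ((hi' - lo')%:R / K%:R) - 2 / (s * K%:R))
    (fun n => (P n && Q n)%:R).
Proof.
move=> K0 hiK hiK' s0 HP HQ; have KR : 0 < K%:R :> R by rewrite ltr0n.
have l10 : ln 10 != 0 :> R by rewrite gt_eqF// ln_gt0// ltr1n.
pose S n := fejer_sum K lo hi (W * ln n`!%:R).
pose T n := fejer_sum K lo' hi' (W * ln (primorial n)%:R).
pose err : R := 2 / (s * K%:R).
have err0 : 0 <= err by rewrite divr_ge0 ?mulr_ge0// ltW.
have Sfar n : ~~ P n -> S n <= err.
  move=> Pn; rewrite /S (_ : W * _ = 2 * pi * (ln n`!%:R / ln 10)).
    by apply: fejer_sum_far => // m; exact: HP.
  by rewrite /two_pi_log10; field.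
have Tfar n : ~~ Q n -> T n <= err.
  move=> Qn; rewrite /T (_ : W * _ = 2 * pi * (ln (primorial n)%:R / ln 10)).
    by apply: fejer_sum_far => // m; exact: HQ.
  by rewrite /two_pi_log10; field.
have N : lognull (fun n => S n * T n - (hi - lo)%:R / K%:R * ((hi' - lo')%:R / K%:R)).
  have : lognull (fun n => \sum_(lo <= m < hi) \sum_(lo' <= l < hi') (K%:R ^+ 4)^-1 *
     (dirichlet_sq K (W * ln n`!%:R - m%:R * (2 * (pi / K%:R))) *
      dirichlet_sq K (W * ln (primorial n)%:R - l%:R * (2 * (pi / K%:R))) - K%:R ^+ 2)).
    apply: lognull_sum => m _; apply: lognull_sum => l _; apply: lognullZ.
    exact: lognull_dirichlet_sqM.
  apply: eq_lognull => n; rewrite /S /T /fejer_sum.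
  have -> : (hi - lo)%:R / K%:R * ((hi' - lo')%:R / K%:R) =
     \sum_(lo <= m < hi) \sum_(lo' <= l < hi') (K%:R ^+ 4)^-1 * K%:R ^+ 2 :> R.
    rewrite !sumr_const_nat -mulr_natl -[_ *+ (hi - lo)]mulr_natl.
    by field; rewrite gt_eqF.
  rewrite mulf_div mulr_suml mulr_suml -sumrB; apply: eq_bigr => m _.
  rewrite mulr_sumr mulr_suml -sumrB; apply: eq_bigr => l _.
  by field; rewrite gt_eqF.
have : loglower ((hi - lo)%:R / K%:R * ((hi' - lo')%:R / K%:R) - err)
    (fun n => S n * T n - err).
  by apply: loglower_lognull; apply: eq_lognull N => n; ring.
apply: le_loglower => n _.
have /andP[S0 S1] : 0 <= S n <= 1 by exact: fejer_sum_bounds.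
have /andP[T0 T1] : 0 <= T n <= 1 by exact: fejer_sum_bounds.
have st1 : S n * T n <= S n by rewrite ler_piMr.
have st2 : S n * T n <= T n by rewrite ler_piMl.
case: (boolP (P n)) => [Pn|/Sfar]; last by move=> h /=; lra.
by case: (boolP (Q n)) => [Qn|/Tfar h] /=; lra.
Qed.

Lemma leading_digitE M a j : (0 < a <= 9)%N ->
  (a * 10 ^ j <= M < a.+1 * 10 ^ j)%N -> leading_digit M = a.
Proof.
move=> /andP[a0 a9] /andP[h1 h2].
have p0 : (0 < 10 ^ j)%N by rewrite expn_gt0.
have M0 : (0 < M)%N by apply: leq_trans h1; rewrite muln_gt0 a0.
have tj : trunc_log 10 M = j.
  have /andP[t1 t2] := @trunc_log_bounds 10 M isT M0.
  apply/eqP; rewrite eqn_leq; apply/andP; split.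
    rewrite -ltnS -(@ltn_exp2l 10)//; apply: leq_ltn_trans t1 _.
    by apply: leq_trans h2 _; rewrite expnS leq_mul2r ltnS a9 orbT.
  rewrite -ltnS -(@ltn_exp2l 10)//; apply: leq_ltn_trans t2.
  by apply: leq_trans h1; rewrite leq_pmull.
rewrite /leading_digit tj; apply/eqP.
by rewrite eqn_leq -ltnS ltn_divLR// leq_divRL// h1 h2.
Qed.

(** Contrapositive: if log10 M were within d of m / K modulo 1, then a 10 ^ j <= M < (a + 1) 10 ^ j
    for some j, and the leading digit would be a. *)
Lemma sin_sq_digit M a K m d : (0 < a <= 9)%N -> (0 < M)%N -> 0 < d <= 1 / 2 ->
  (m < K)%N -> leading_digit M != a ->
  ln a%:R / ln 10 + d <= m%:R / K%:R <= ln a.+1%:R / ln 10 - d ->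
  sin (pi * d) ^+ 2 <= sin (pi * (ln M%:R / ln 10 - m%:R / K%:R)) ^+ 2.
Proof.
move=> a9 M0 d12 mK La /andP[h1 h2]; have /andP[a0 a9'] := a9.
have KR : 0 < K%:R :> R by rewrite ltr0n (leq_trans _ mK).
have l10 : 0 < ln 10 :> R by rewrite ln_gt0// ltr1n.
have x0 : 0 <= ln M%:R / ln 10 :> R by rewrite divr_ge0 ?lnn_ge0// ltW.
have mK1 : m%:R / K%:R < 1 :> R by rewrite ltr_pdivrMr// mul1r ltr_nat.
(* Adding 1 makes the argument nonnegative, as [sin_sq_far] requires, and only flips the sign of the
   sine; hence the exponent j = k - 1 below. *)
have -> : sin (pi * (ln M%:R / ln 10 - m%:R / K%:R)) ^+ 2 =
    sin (pi * (ln M%:R / ln 10 - m%:R / K%:R + 1)) ^+ 2 :> R.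
  by rewrite [in RHS]mulrDr mulr1 sinDpi sqrrN.
apply: sin_sq_far => //; first by lra.
move=> k; rewrite leNgt; apply/negP => hk; move/negP: La; apply; apply/eqP.
have b1 : ln a.+1%:R / ln 10 <= 1 :> R.
  by rewrite ler_pdivrMr// mul1r ler_lnn//= ltnS.
move: hk; rewrite ltr_norml; case: k => [|j] /andP[k1 k2].
  by exfalso; lra.
rewrite -(natr1 j) in k1 k2.
have lp : ln (10 ^ j)%:R = j%:R * ln 10 :> R by rewrite natrX lnXn ?ltr0n// mulr_natl.
have p0 : (0 < 10 ^ j)%N by rewrite expn_gt0.
have q1 : ln a%:R / ln 10 + j%:R <= ln M%:R / ln 10 :> R by lra.
have q2 : ln M%:R / ln 10 < ln a.+1%:R / ln 10 + j%:R :> R by lra.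
rewrite -(ler_pM2r l10) mulrDl !divfK ?gt_eqF// -lp -lnM ?posrE ?ltr0n// in q1.
rewrite -(ltr_pM2r l10) mulrDl !divfK ?gt_eqF// -lp -lnM ?posrE ?ltr0n// in q2.
rewrite -natrM ler_ln ?posrE ?ltr0n ?muln_gt0 ?a0// ler_nat in q1.
rewrite -natrM ltr_ln ?posrE ?ltr0n ?muln_gt0// ltr_nat in q2.
by apply: (@leading_digitE M a j) => //; rewrite q1.
Qed.

Definition digit_weight a : R := ln (1 + 1 / a%:R) / ln 10.

Lemma digit_weightE a : (0 < a)%N ->
  digit_weight a = ln a.+1%:R / ln 10 - ln a%:R / ln 10.
Proof.
move=> a0; rewrite /digit_weight -mulrBl -ln_div ?posrE ?ltr0n//.
congr (ln _ / _); rewrite -(natr1 a); field; by rewrite pnatr_eq0 -lt0n.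
Qed.

Lemma digit_weight_bounds a : (0 < a <= 9)%N -> 0 <= digit_weight a <= 1.
Proof.
move=> /andP[a0 a9]; rewrite digit_weightE//.
have l10 : 0 < ln 10 :> R by rewrite ln_gt0// ltr1n.
have h1 : ln a%:R / ln 10 <= ln a.+1%:R / ln 10 :> R.
  by rewrite ler_pM2r ?invr_gt0// ler_lnn// a0 /=.
have h2 : ln a.+1%:R / ln 10 <= 1 :> R.
  by rewrite ler_pdivrMr// mul1r ler_lnn//= ltnS.
have h3 : 0 <= ln a%:R / ln 10 :> R by rewrite divr_ge0 ?lnn_ge0// ltW.
by apply/andP; split; lra.
Qed.

Lemma digit_window a K d : (0 < a <= 9)%N -> (0 < K)%N -> 0 < d ->
  exists lo hi, [/\ (hi <= K)%N,
    digit_weight a - 2 * d - 1 / K%:R <= (hi - lo)%:R / K%:R &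
    forall m, (lo <= m < hi)%N -> (m < K)%N /\
      ln a%:R / ln 10 + d <= m%:R / K%:R <= ln a.+1%:R / ln 10 - d].
Proof.
move=> /andP[a0 a9] K0 d0; rewrite digit_weightE//.
have KR : 0 < K%:R :> R by rewrite ltr0n.
have l10 : 0 < ln 10 :> R by rewrite ln_gt0// ltr1n.
have h2 : ln a.+1%:R / ln 10 <= 1 :> R.
  by rewrite ler_pdivrMr// mul1r ler_lnn//= ltnS.
have h3 : 0 <= ln a%:R / ln 10 :> R by rewrite divr_ge0 ?lnn_ge0// ltW.
move: (ln a%:R / ln 10) (ln a.+1%:R / ln 10) h2 h3 => al be be1 al0.
pose u := K%:R * (al + d); pose v := K%:R * (be - d).
have u0 : 0 <= u by rewrite mulr_ge0//; lra.
have vK : v < K%:R by rewrite gtr_pMr//; lra.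
exists (Num.truncn u).+1, (Num.truncn v).+1.
have hiK : (Num.truncn v < K)%N.
  by case: K K0 @u @v KR u0 vK => // K _ u v *; rewrite ltnS truncn_le_nat.
have uT : (Num.truncn u)%:R <= u by rewrite truncn_le.
have vT : v < (Num.truncn v)%:R + 1 by rewrite natr1 truncnS_gt.
split => //.
  rewrite ler_pdivlMr// subSS mulrBl divfK ?gt_eqF// mulrBl.
  have : (Num.truncn v)%:R - (Num.truncn u)%:R <= (Num.truncn v - Num.truncn u)%:R :> R.
    have [uv|vu] := leqP (Num.truncn u) (Num.truncn v); first by rewrite natrB.
    by apply: (@le_trans _ _ 0); rewrite // subr_le0 ler_nat ltnW.
  by rewrite /u /v in uT vT *; lra.
move=> m /andP[um]; rewrite ltnS => mv; split; first exact: leq_ltn_trans mv hiK.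
rewrite ler_pdivlMr// ler_pdivrMr// [_ * K%:R]mulrC -/u [_ * K%:R]mulrC -/v.
apply/andP; split.
  by apply/ltW; apply: lt_le_trans (truncnS_gt u) _; rewrite ler_nat.
(* If v is negative its truncation is 0, but m > 0 because [lo] is a successor. *)
case: m um mv => // m _; by rewrite truncn_gt_nat.
Qed.

Lemma loglower_digits a b : (0 < a <= 9)%N -> (0 < b <= 9)%N ->
  loglower (digit_weight a * digit_weight b)
    (fun n => ((leading_digit n`! == a) && (leading_digit (primorial n) == b))%:R).
Proof.
move=> ha hb; apply: loglower_approx => e e0.
(* Each factor loses 2 d + 1 / K <= e / 4 and the kernel off its arc loses e / 2, in all e. *)
pose d : R := Num.min (1 / 4) (e / 16).
have d0 : 0 < d by rewrite lt_min; apply/andP; split; lra.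
have d4 : d <= 1 / 4 by rewrite ge_min lexx.
have de : d <= e / 16 by rewrite ge_min lexx orbT.
have d2 : 0 < d <= 1 / 2 by lra.
have [s s0 sE] : exists2 s, 0 < s & s = sin (pi * d) ^+ 2.
  exists (sin (pi * d) ^+ 2) => //; have pi0 := @pi_gt0 R.
  rewrite exprn_gt0// sin_gt0_pi// mulr_gt0//= gtr_pMr//; lra.
have [K [K0 K1 K2]] : exists K, [/\ (0 < K)%N, 8 / e <= K%:R & 4 / (s * e) <= K%:R].
  exists (maxn (Num.truncn (8 / e)) (Num.truncn (4 / (s * e)))).+1; split => //.
    by apply/ltW/(lt_le_trans (truncnS_gt _)); rewrite ler_nat ltnS leq_maxl.
  by apply/ltW/(lt_le_trans (truncnS_gt _)); rewrite ler_nat ltnS leq_maxr.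
have KR : 0 < K%:R :> R by rewrite ltr0n.
have K3 : 1 / K%:R <= e / 8.
  by rewrite ler_pdivrMr//; move: K1; rewrite ler_pdivrMr//; lra.
have K4 : 2 / (s * K%:R) <= e / 2.
  rewrite ler_pdivrMr ?mulr_gt0//; move: K2; rewrite ler_pdivrMr ?mulr_gt0//; lra.
have [lo [hi [hiK hw hin]]] := digit_window ha K0 d0.
have [lo' [hi' [hiK' hw' hin']]] := digit_window hb K0 d0.
have := @loglower_box (fun n => leading_digit n`! == a)
  (fun n => leading_digit (primorial n) == b) K lo hi lo' hi' s K0 hiK hiK' s0.
move=> H; apply: loglower_monotone (H _ _); last first.
- move=> n m Ln /hin'[mK mi]; rewrite sE; exact: sin_sq_digit (primorial_gt0 n) d2 mK Ln mi.
- move=> n m Ln /hin[mK mi]; rewrite sE; exact: sin_sq_digit (fact_gt0 n) d2 mK Ln mi.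
have /andP[wa0 wa1] := digit_weight_bounds ha; have /andP[wb0 wb1] := digit_weight_bounds hb.
have A0 : 0 <= (hi - lo)%:R / K%:R :> R by rewrite divr_ge0.
have B0 : 0 <= (hi' - lo')%:R / K%:R :> R by rewrite divr_ge0.
have A1 : (hi - lo)%:R / K%:R <= 1 :> R.
  by rewrite ler_pdivrMr// mul1r ler_nat (leq_trans (leq_subr _ _)).
clear H hin hin' hiK hiK' K1 K2; have Ki : 0 <= 1 / K%:R :> R by rewrite divr_ge0// ltW.
move: ((hi - lo)%:R / K%:R) ((hi' - lo')%:R / K%:R) (2 / (s * K%:R))
  (1 / K%:R) hw hw' Ki K3 K4 A0 B0 A1.
move: (digit_weight a) (digit_weight b) wa0 wa1 wb0 wb1.
move=> v w v0 v1 w0 w1 A B r k vA wB k0 k8 r2 A0 B0 A1.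
have : (A + (2 * d + k) - v) * w >= 0 by rewrite mulr_ge0//; lra.
have : A * (B + (2 * d + k) - w) >= 0 by rewrite mulr_ge0//; lra.
have dk0 : 0 <= 2 * d + k by lra.
have : A * (2 * d + k) <= 2 * d + k by rewrite ler_piMl.
have : w * (2 * d + k) <= 2 * d + k by rewrite ler_piMl.
by lra.
Qed.

End BoxDensity.

Section LogDensity.
Variable R : realType.

Lemma sum_digit_weight : \sum_(i < 9) digit_weight R i.+1 = 1.
Proof.
under eq_bigr do rewrite digit_weightE//.
rewrite -(big_mkord xpredT (fun i => ln i.+2%:R / ln 10 - ln i.+1%:R / ln 10 : R)).
rewrite (telescope_sumr (fun i => ln i.+1%:R / ln 10 : R))//.
by rewrite ln1 mul0r subr0 divff// gt_eqF// ln_gt0// ltr1n.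
Qed.

(* Digits are shifted by one: the index i : 'I_9 stands for the digit i + 1. *)
Definition digit_event (p : 'I_9 * 'I_9) (n : nat) : bool :=
  (leading_digit n`! == p.1.+1) && (leading_digit (primorial n) == p.2.+1).

Lemma sum_digit_event n : \sum_p (digit_event p n)%:R <= 1 :> R.
Proof.
case: (pickP (fun p => digit_event p n)) => [p0 Hp0|H]; last first.
  by rewrite big1// => p _; rewrite H.
rewrite (bigD1 p0)//= Hp0 big1 ?addr0// => p pp0; case Hp: (digit_event p n) => //.
move: Hp0 Hp; rewrite /digit_event => /andP[/eqP -> /eqP ->] /andP[].
rewrite !eqSS => /eqP h1 /eqP h2; case/negP: pp0; apply/eqP.
by rewrite [p]surjective_pairing [p0]surjective_pairing; congr pair; apply: val_inj.
Qed.

Lemma loglower_digit_event (p : 'I_9 * 'I_9) :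
  loglower (digit_weight R p.1.+1 * digit_weight R p.2.+1) (fun n => (digit_event p n)%:R).
Proof. by apply: loglower_digits; rewrite ltn0Sn ltn_ord. Qed.

(** For the upper bound, the lower bounds of the other 80 events are subtracted from the harmonic
    sum, which is at most 1 + ln N. *)
Lemma logsum_digit_event (p : 'I_9 * 'I_9) (e : R) : 0 < e ->
  exists N0, forall N, (N0 <= N)%N ->
    `|logsum (fun n => (digit_event p n)%:R) N -
      digit_weight R p.1.+1 * digit_weight R p.2.+1 * ln N%:R| <= e * ln N%:R.
Proof.
move=> e0; have e2 : 0 < e / 2 by rewrite divr_gt0.
have [N1 H1] := loglower_digit_event p e0.
have Hs := @loglower_sum R _ (index_enum _) (fun q => q != p) _ _
  (fun q _ => loglower_digit_event q).
have [N2 H2] := Hs _ e2.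
have [N3 _ H3] := ln_unbounded (2 / e).
exists (maxn N1 (maxn N2 N3)) => N; rewrite !geq_max => /and3P[/H1 h1 /H2 h2 /H3 h3].
have T : \sum_(q | q != p) digit_weight R q.1.+1 * digit_weight R q.2.+1 =
    1 - digit_weight R p.1.+1 * digit_weight R p.2.+1.
  have <- : \sum_(q : 'I_9 * 'I_9) digit_weight R q.1.+1 * digit_weight R q.2.+1 = 1.
    rewrite -(pair_bigA _ (fun i j : 'I_9 => digit_weight R i.+1 * digit_weight R j.+1))/=.
    under eq_bigr do rewrite -mulr_sumr sum_digit_weight mulr1.
    exact: sum_digit_weight.
  by rewrite [in RHS](bigD1 p)//= addrAC subrr add0r.
have S : logsum (fun n => (digit_event p n)%:R) N +
    logsum (fun n => \sum_(q | q != p) (digit_event q n)%:R) N <= harmonic_sum R N.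
  rewrite /logsum -big_split/=; apply: ler_sum => n _.
  rewrite -mulrDl -[leRHS]mul1r; apply: ler_wpM2r; first by rewrite invr_ge0.
  by have := sum_digit_event n; rewrite (bigD1 p).
rewrite T in h2; have := harmonic_sum_le R N.
rewrite ler_pdivrMr// in h3.
by rewrite ler_norml => h4; apply/andP; split; lra.
Qed.

End LogDensity.

Theorem theorem1p10 (R : realType) (a b : nat)
    (ha : (1 <= a <= 9)%N) (hb : (1 <= b <= 9)%N) :
  has_log_density (benford_set a b)
    (log10 (1 + 1 / a%:R) * log10 (1 + 1 / b%:R) : R).
Proof.
have a1 : (a.-1 < 9)%N by lia.
have b1 : (b.-1 < 9)%N by lia.
pose p : 'I_9 * 'I_9 := (Ordinal a1, Ordinal b1).
have aE : p.1.+1 = a by rewrite /= prednK//; lia.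
have bE : p.2.+1 = b by rewrite /= prednK//; lia.
apply/cvgrPdist_le => e e0; have [N0 HN0] := logsum_digit_event p e0.
(* N > 1 makes ln N positive and keeps clear of the junk inverses at N = 0, 1. *)
near=> N; have N2 : (1 < N)%N by near: N; exact: nbhs_infty_gt.
have NN0 : (N0 <= N)%N by near: N; exact: nbhs_infty_ge.
have L0 : 0 < ln N%:R :> R by rewrite ln_gt0// ltr1n.
have -> : \sum_(1 <= n < N.+1) (n%:R)^-1 * \1_(benford_set a b) n =
    logsum (fun n => (digit_event p n)%:R : R) N.
  apply: eq_big_nat => n /andP[n0 _]; rewrite mulrC indicE; congr ((nat_of_bool _)%:R / _).
  apply/idP/idP; rewrite inE /digit_event aE bE.
    by move=> [_ -> ->]; rewrite !eqxx.
  by move=> /andP[/eqP h1 /eqP h2].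
have wE c : log10 (1 + 1 / c%:R : R) = digit_weight R c by [].
rewrite !wE; have := HN0 _ NN0; rewrite aE bE.
move: (logsum _ _) (digit_weight R a) (digit_weight R b) => S u v h.
rewrite distrC (_ : _ - _ = (S - u * v * ln N%:R) / ln N%:R); last first.
  by field; rewrite gt_eqF.
by rewrite normrM normfV (gtr0_norm L0) ler_pdivrMr.
Unshelve. all: by end_near.
Qed.
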